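(* Let $n\ge 1$, and let $O_n=O_n(X,Y)$ be the Okada algebra with generic parameters over $K$. Let $I_n=\{t\in\mathcal D_n: t=t^*\}$ be the set of symmetric Okada arc diagrams of rank $n$ and let $M_n=KI_n$ be the $K$-vector space with basis $I_n$. For $d\in\mathcal D_n$ and $t\in I_n$ put $$d\cdot t=\begin{cases}\lambda(d,t)\,[d\circ t\circ d^*], & \text{if } \operatorname{PLab}([d\circ t\circ d^*])=\operatorname{PLab}(t),\\ 0,&\text{otherwise,}\end{cases}$$ and extend $K$-bilinearly to a map $O_n\times M_n\to M_n$, where $O_n$ has basis $\mathcal D_n$. Then: (1) this defines an $O_n(X,Y)$-module structure on $M_n$; (2) the module $M_n$ is a Gelfand model for $O_n(X,Y)$.
   Context: Generic Okada algebra. Let $K_0$ be a field of characteristic $0$, let $x_1,x_2,\dots,y_1,y_2,\dots$ be algebraically independent indeterminates over $K_0$, and let $K=K_0(x_1,x_2,\dots,y_1,y_2,\dots)$. $O_n=O_n(X,Y)$ is the associative unital $K$-algebra generated by $E_1,\dots,E_{n-1}$ with relations $E_i^2=x_iE_i$ ($1\le i\le n-1$), $E_iE_j=E_jE_i$ ($|i-j|\ge 2$), $E_{i+1}E_iE_{i+1}=y_iE_{i+1}$ ($1\le i\le n-2$). Okada arc diagrams. Order the vertices $1<2<\cdots<n<\overline n<\cdots<\overline 2<\overline 1$ and put $|i|=|\overline i|=i$; the vertices $i$ form the left boundary and the $\overline i$ the right boundary. An Okada arc diagram of rank $n$ is a noncrossing perfect matching of these $2n$ vertices (with respect to this order) in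 which each arc joining $a$ and $b$ has a height label $h\in\mathbb N$ with (i) $1\le h\le\min(|a|,|b|)$, (ii) $h\equiv\min(|a|,|b|)\pmod 2$, and (iii) if the arc $\{a,b\}$ is nested inside $\{c,d\}$ (that is, $c<a<b<d$) then the label of $\{a,b\}$ is strictly greater than that of $\{c,d\}$. An arc is propagating if it joins a left vertex to a right vertex. $\mathcal D_n$ is the set of Okada arc diagrams of rank $n$. For $d_1,d_2\in\mathcal D_n$, the composition $d_1\circ d_2$ is formed by placing $d_2$ to the right of $d_1$, identifying the vertex $\overline i$ of $d_1$ with the vertex $i$ of $d_2$, and concatenating arcs; each resulting arc or loop gets the minimum of the labels of its fragments. $[d_1\circ d_2]\in\mathcal D_n$ is obtained by deleting closed loops. This makes $\mathcal D_n$ a monoid whose identity consists of the arcs $\{i,\overline i\}$ labelled $i$, and $[d_1\circ d_2\circ d_3]$ denotes the monoid product. The monoid is generated by $G_1,\dots,G_{n-1}$, where $G_i$ has propagating arcs $\{j,\overline j\}$ labelled $j$ for $j\ne i,i+1$ and arcs $\{i,i+1\}$ and $\{\overline i,\overline{i+1}\}$ both labelled $i$. $d^*$ is the mirror image of $d$ (interchange $i$ and $\overline i$ for all $i$, keeping labels). $\operatorname{PLab}(d)\subseteq\{1,\dots,n\}$ is the set of labels of the propagating arcs of $d$. The basis and the scalars $\lambda$. For $d\in\mathcal D_n$ take a word of minimal length with $d=[G_{i_1}\circ\cdots\circ G_{i_l}]$ and set $E_d=E_{i_1}\cdots E_{i_l}\in O_n$ (independent of the choice; $E_{\mathrm{id}}=1$).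 The $E_d$ ($d\in\mathcal D_n$) form a $K$-basis of $O_n$, and $E_{d_1}E_{d_2}=\lambda(d_1,d_2)E_{[d_1\circ d_2]}$ with $\lambda(d_1,d_2)\in K$ a monomial in the parameters. We identify $d$ with $E_d$ (so $G_i=E_i$); thus $O_n$ has basis $\mathcal D_n$ and product $d_1d_2=\lambda(d_1,d_2)[d_1\circ d_2]$. Gelfand model. A finite-dimensional $K$-algebra is split semisimple if it is isomorphic to a finite direct sum of matrix algebras $M_{d_i}(K)$. A Gelfand model for a finite-dimensional split semisimple algebra $A$ is an $A$-module in which every irreducible $A$-module occurs exactly once, up to isomorphism. ($O_n$ is split semisimple.) *)

(* Defs.v *)
From HB Require Import structures.
From mathcomp Require Import all_boot all_order all_algebra.
From mathcomp Require Import mpoly zify.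

Set Implicit Arguments.
Unset Strict Implicit.
Unset Printing Implicit Defensive.

Import GRing.Theory.
Local Open Scope ring_scope.

(* Indices are shifted by one throughout: [x k], [y k], [E k] and the ordinal *)
(* of value [k] stand for x_(k+1), y_(k+1), E_(k+1) and k+1; the labels of    *)
(* the arcs are not shifted.                                                  *)

(* [inl i] is the left vertex i, [inr i] is the right vertex \bar i. *)
Definition vertex (n : nat) : finType := ('I_n + 'I_n)%type.

(* |i| = |\bar i| = i, with the shift of indices. *)
Definition vabs n (v : vertex n) : nat :=
  match v with inl i | inr i => i.+1 end.

(* The position of v in the order 1 < ... < n < \bar n < ... < \bar 1. *)
Definition vpos n (v : vertex n) : nat :=
  match v with inl i => i | inr i => n + n - i.+1 end%N.

Definition vopp n (v : vertex n) : vertex n :=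
  match v with inl i => inr i | inr i => inl i end.

Definition is_right n (v : vertex n) : bool :=
  if v is inr _ then true else false.

(* The first component sends a vertex to the other end of its arc, the second *)
(* one sends a vertex to the label of its arc.                                *)
Definition prediagram (n : nat) : finType :=
  ({ffun vertex n -> vertex n} * {ffun vertex n -> 'I_n.+1})%type.

Definition is_okada n (d : prediagram n) : bool :=
  let m := d.1 in let h := fun v => d.2 v : nat in
  [&& [forall v, [&& m (m v) == v, m v != v & h (m v) == h v]],
      [forall v, (0 < h v <= minn (vabs v) (vabs (m v)))%N &&
                 (odd (h v) == odd (minn (vabs v) (vabs (m v))))],
      [forall a, forall c,
         ~~ [&& vpos a < vpos c, vpos c < vpos (m a)
              & vpos (m a) < vpos (m c)]%N] &
      [forall a, forall c,
         [&& vpos c < vpos a, vpos a < vpos (m a)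
           & vpos (m a) < vpos (m c)]%N ==> (h c < h a)%N]].

Definition okada (n : nat) : finType := {d : prediagram n | is_okada d}.

Definition mate n (d : okada n) (v : vertex n) : vertex n := (val d).1 v.
Definition lab n (d : okada n) (v : vertex n) : 'I_n.+1 := (val d).2 v.

Lemma vabs_bound n (v : vertex n) : (0 < vabs v <= n)%N.
Proof. by case: v => i /=. Qed.

Definition id_pre n : prediagram n :=
  ([ffun v => vopp v], [ffun v => inord (vabs v)]).

Lemma id_preP n : is_okada (id_pre n).
Proof.
have labK (v : vertex n) : (inord (vabs v) : 'I_n.+1) = vabs v :> nat.
  by apply: inordK; rewrite ltnS; have /andP[] := vabs_bound v.
apply/and4P; split; apply/forallP => a; rewrite /= ?ffunE.
- by case: a => i /=; rewrite /= ?ffunE /= !eqxx.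
- by rewrite labK; case: a => i /=; rewrite minnn leqnn eqxx.
- apply/forallP => c; rewrite !ffunE.
  by case: a c => [i|i] [j|j] /=; have := ltn_ord i; have := ltn_ord j; lia.
apply/forallP => c; rewrite !ffunE !labK.
by case: a c => [i|i] [j|j] /=; have := ltn_ord i; have := ltn_ord j; lia.
Qed.

Definition id_diag n : okada n := exist _ (id_pre n) (id_preP n).

Lemma gen_lo_subproof n (i : 'I_n.-1) : (i < n)%N.
Proof. by have := ltn_ord i; lia. Qed.

Lemma gen_hi_subproof n (i : 'I_n.-1) : (i.+1 < n)%N.
Proof. by have := ltn_ord i; lia. Qed.

Definition gen_lo n (i : 'I_n.-1) : 'I_n := Ordinal (gen_lo_subproof i).
Definition gen_hi n (i : 'I_n.-1) : 'I_n := Ordinal (gen_hi_subproof i).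

Definition gen_mate n (i : 'I_n.-1) (v : vertex n) : vertex n :=
  match v with
  | inl j => if j == gen_lo i then inl (gen_hi i)
             else if j == gen_hi i then inl (gen_lo i) else inr j
  | inr j => if j == gen_lo i then inr (gen_hi i)
             else if j == gen_hi i then inr (gen_lo i) else inl j
  end.

Definition gen_lab n (i : 'I_n.-1) (v : vertex n) : nat :=
  if vabs v == i.+2 then i.+1 else vabs v.

Definition gen_pre n (i : 'I_n.-1) : prediagram n :=
  ([ffun v => gen_mate i v], [ffun v => inord (gen_lab i v)]).

Lemma gen_preP n (i : 'I_n.-1) : is_okada (gen_pre i).
Proof.
have labK (v : vertex n) : (inord (gen_lab i v) : 'I_n.+1) = gen_lab i v :> nat.
  apply: inordK; rewrite ltnS /gen_lab; have /andP[] := vabs_bound v.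
  by have := gen_hi_subproof i; case: eqP; lia.
have split_ord (j : 'I_n) : [\/ j = gen_lo i, j = gen_hi i |
    [/\ (j == gen_lo i) = false, (j == gen_hi i) = false,
        nat_of_ord j <> i & nat_of_ord j <> i.+1]].
  case: (eqVneq j (gen_lo i)) => [->|jl]; first by constructor 1.
  case: (eqVneq j (gen_hi i)) => [->|jh]; first by constructor 2.
  constructor 3; split=> //; first by move=> e; case/eqP: jl; apply/val_inj.
  by move=> e; case/eqP: jh; apply/val_inj.
have hl : (gen_hi i == gen_lo i) = false by rewrite -val_eqE /= gtn_eqF.
have hi := gen_hi_subproof i.
have mE v : [/\ gen_mate i (gen_mate i v) = v, gen_mate i v != v
               & gen_lab i (gen_mate i v) = gen_lab i v].
  by case: v => j /=; case: (split_ord j) => [->|->|[jl jh j1 j2]];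
    rewrite /= ?jl ?jh ?hl ?eqxx /= ?jl ?jh ?hl ?eqxx /gen_lab /=;
    split; rewrite ?eqxx //; first [by rewrite (inj_eq inl_inj) ?hl 1?eq_sym ?hl
      | by rewrite (inj_eq inr_inj) ?hl 1?eq_sym ?hl | by do ?case: eqP; lia].
apply/and4P; split; apply/forallP => a; rewrite /= !ffunE.
- by have [-> -> ->] := mE a; rewrite !eqxx.
- rewrite labK; case: a => j /=; case: (split_ord j) => [->|->|[jl jh j1 j2]];
    by rewrite /= ?jl ?jh ?hl ?eqxx /gen_lab /=; do ?case: eqP; lia.
- apply/forallP => c; rewrite !ffunE.
  by case: a c => [j|j] [k|k] /=; have := ltn_ord j; have := ltn_ord k;
    case: (split_ord j) => [->|->|[jl jh j1 j2]];
    case: (split_ord k) => [->|->|[kl kh k1 k2]];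
    rewrite /= ?jl ?jh ?kl ?kh ?hl ?eqxx /=; lia.
apply/forallP => c; rewrite !ffunE !labK /gen_lab.
by case: a c => [j|j] [k|k] /=; have := ltn_ord j; have := ltn_ord k;
  case: (split_ord j) => [->|->|[jl jh j1 j2]];
  case: (split_ord k) => [->|->|[kl kh k1 k2]];
  rewrite /= ?jl ?jh ?kl ?kh ?hl ?eqxx /=; do ?case: eqP; lia.
Qed.

Definition gen_diag n (i : 'I_n.-1) : okada n :=
  exist _ (gen_pre i) (gen_preP i).

Definition mirror_pre n (d : okada n) : prediagram n :=
  ([ffun v => vopp (mate d (vopp v))], [ffun v => lab d (vopp v)]).

Lemma voppK n : involutive (@vopp n).
Proof. by case. Qed.

Lemma vabs_opp n (v : vertex n) : vabs (vopp v) = vabs v.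
Proof. by case: v. Qed.

Lemma vpos_opp n (v : vertex n) : vpos (vopp v) = (n + n - (vpos v).+1)%N.
Proof. by case: v => i //=; have := ltn_ord i; lia. Qed.

Lemma vpos_bound n (v : vertex n) : (vpos v < n + n)%N.
Proof. by case: v => i /=; have := ltn_ord i; lia. Qed.

Lemma mirror_preP n (d : okada n) : is_okada (mirror_pre d).
Proof.
case/and4P: (valP d) => /forallP dm /forallP dh /forallP dc /forallP dn.
have mK v : (val d).1 ((val d).1 v) = v by case/and3P: (dm v) => /eqP.
have hK v : (val d).2 ((val d).1 v) = (val d).2 v.
  by case/and3P: (dm v) => _ _ /eqP /val_inj.
apply/and4P; split; apply/forallP => a; rewrite /= !ffunE /mate /lab.
- case/and3P: (dm (vopp a)) => /eqP e1 e2 /eqP e3.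
  rewrite !voppK e1 voppK eqxx /=; apply/andP; split; last by apply/eqP.
  by apply: contra e2 => /eqP {2}<-; rewrite voppK.
- by rewrite vabs_opp -[vabs a]vabs_opp; apply: dh.
- apply/forallP => c; rewrite !ffunE /mate.
  have := forallP (dc ((val d).1 (vopp c))) ((val d).1 (vopp a)).
  rewrite !mK -[in vpos a](voppK a) -[in vpos c](voppK c) !vpos_opp.
  move: (vpos_bound (vopp a)) (vpos_bound (vopp c)).
  move: (vpos_bound ((val d).1 (vopp a))) (vpos_bound ((val d).1 (vopp c))).
  lia.
apply/forallP => c; rewrite !ffunE /mate /lab.
have := forallP (dn ((val d).1 (vopp a))) ((val d).1 (vopp c)).
rewrite !mK !hK -[in vpos a](voppK a) -[in vpos c](voppK c) !vpos_opp.
move: (vpos_bound (vopp a)) (vpos_bound (vopp c)).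
move: (vpos_bound ((val d).1 (vopp a))) (vpos_bound ((val d).1 (vopp c))).
by move=> b1 b2 b3 b4 H; apply/implyP => A; apply: (implyP H); lia.
Qed.

Definition mirror n (d : okada n) : okada n :=
  exist _ (mirror_pre d) (mirror_preP d).

(* The diagram d2 is placed to the right of d1: [inl v] and [inr v] are the   *)
(* vertex v of d1 and of d2, and the right vertices of d1 are glued to the    *)
(* left vertices of d2. The connected components of [glue d1 d2] are the arcs *)
(* and the closed loops of the concatenation.                                 *)
Definition glue n (d1 d2 : okada n) : rel (vertex n + vertex n)%type :=
  fun u v => match u, v with
  | inl a, inl b => mate d1 a == b
  | inr a, inr b => mate d2 a == b
  | inl (inr i), inr (inl j) | inr (inl i), inl (inr j) => i == j
  | _, _ => false
  end.

Definition outer n (v : vertex n) : (vertex n + vertex n)%type :=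
  match v with inl i => inl (inl i) | inr i => inr (inr i) end.

Definition frag_lab n (d1 d2 : okada n) (u : (vertex n + vertex n)%type) :
  'I_n.+1 := match u with inl a => lab d1 a | inr a => lab d2 a end.

Definition comp_mate n (d1 d2 : okada n) (u : vertex n) : vertex n :=
  odflt u [pick v | (v != u) && connect (glue d1 d2) (outer u) (outer v)].

Definition comp_lab n (d1 d2 : okada n) (u : vertex n) : 'I_n.+1 :=
  frag_lab d1 d2 [arg min_(w < outer u | connect (glue d1 d2) (outer u) w)
                    (frag_lab d1 d2 w : nat)].

(* [d1 o d2]. The concatenation is always an Okada arc diagram, so that the   *)
(* default value of [insubd] is never used.                                   *)
Definition okada_comp n (d1 d2 : okada n) : okada n :=
  insubd (id_diag n)
    ([ffun u => comp_mate d1 d2 u], [ffun u => comp_lab d1 d2 u]).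

Definition PLab n (d : okada n) : {set 'I_n.+1} :=
  [set lab d (inl i) | i : 'I_n & is_right (mate d (inl i))].

Definition diag_of_word n (w : seq 'I_n.-1) : okada n :=
  \big[@okada_comp n/id_diag n]_(i <- w) gen_diag i.

Definition reduced_word n (d : okada n) (w : seq 'I_n.-1) : Prop :=
  diag_of_word w = d /\
  forall w' : seq 'I_n.-1, diag_of_word w' = d -> (size w <= size w')%N.

Definition sym_okada (n : nat) : finType := {d : okada n | d == mirror d}.

Definition xy_eval (K0 K : fieldType) (iota : {rmorphism K0 -> K})
    (x y : nat -> K) (N : nat) (p : {mpoly K0[N + N]}) : K :=
  mmap iota (fun i => match split i with inl j => x j | inr j => y j end) p.

(* K = K0(x_1, x_2, ..., y_1, y_2, ...), where the x_i and the y_i are        *)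
(* algebraically independent over K0, which is embedded in K by iota.         *)
Definition is_rational_function_field (K0 K : fieldType)
    (iota : {rmorphism K0 -> K}) (x y : nat -> K) : Prop :=
  (forall (N : nat) (p : {mpoly K0[N + N]}),
     xy_eval iota x y p = 0 -> p = 0) /\
  (forall c : K, exists (N : nat) (p q : {mpoly K0[N + N]}),
     q != 0 /\ c = xy_eval iota x y p / xy_eval iota x y q).

Definition okada_relations (K : fieldType) (x y : nat -> K) (n : nat)
    (A : algType K) (E : 'I_n.-1 -> A) : Prop :=
  [/\ forall i, E i * E i = x i *: E i,
      forall i j : 'I_n.-1, (i.+2 <= j)%N -> E i * E j = E j * E i
    & forall i j : 'I_n.-1, j = i.+1 :> nat -> E j * E i * E j = y i *: E j].

(* O is the unital K-algebra presented by the generators E and the relations  *)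
(* above: it is spanned by the words in the E i, and its relations are        *)
(* consequences of the given ones.                                            *)
Definition is_okada_algebra (K : fieldType) (x y : nat -> K) (n : nat)
    (O : algType K) (E : 'I_n.-1 -> O) : Prop :=
  [/\ okada_relations x y E,
      forall a : O, exists s : seq (K * seq 'I_n.-1),
        a = \sum_(cw <- s) cw.1 *: \prod_(i <- cw.2) E i
    & forall (A : algType K) (F : 'I_n.-1 -> A), okada_relations x y F ->
        exists f : {lrmorphism O -> A}, forall i, f (E i) = F i].

Definition split_semisimple (K : fieldType) (A : algType K) : Prop :=
  exists (r : nat) (d : 'I_r -> nat)
         (f : forall i, {lrmorphism A -> 'M[K]_((d i).+1)}),
    (forall B : forall i, 'M[K]_((d i).+1), exists a, forall i, f i a = B i) /\
    (forall a, (forall i, f i a = 0) -> a = 0).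

Definition irreducible_module (A : nzRingType) (V : lmodType A) : Prop :=
  (exists v : V, v <> 0) /\
  forall P : V -> Prop,
    P 0 -> (forall (a : A) u v, P u -> P v -> P (a *: u + v)) ->
    (forall v, P v -> v = 0) \/ (forall v, P v).

Definition isomorphic_modules (A : nzRingType) (V W : lmodType A) : Prop :=
  exists f : {linear V -> W}, bijective f.

(* M is the direct sum of modules S_i, via the maps f_i, where the S_i are    *)
(* the irreducible modules, each one occurring once up to isomorphism.        *)
Definition gelfand_model (K : fieldType) (A : algType K) (M : lmodType A) :
  Prop :=
  split_semisimple A /\
  exists (r : nat) (S : 'I_r -> lmodType A) (f : forall i, {linear S i -> M}),
    [/\ forall i, irreducible_module (S i),
        forall i j, isomorphic_modules (S i) (S j) -> i = j,
        forall V : lmodType A, irreducible_module V ->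
          exists i, isomorphic_modules V (S i),
        forall m : M, exists v : forall i, S i, m = \sum_i f i (v i)
      & forall v : forall i, S i,
          \sum_i f i (v i) = 0 -> forall i, v i = 0].

Definition module_axioms (A : nzRingType) (V : zmodType) (s : A -> V -> V) :
  Prop :=
  [/\ forall a b v, s a (s b v) = s (a * b) v,
      left_id 1 s, right_distributive s +%R
    & forall v, {morph s^~ v : a b / a + b}].

Section ModuleOf.
Variables (A : nzRingType) (V : zmodType) (s : A -> V -> V).
Hypothesis sP : module_axioms s.

Definition module_of & module_axioms s : Type := V.

HB.instance Definition _ := GRing.Zmodule.copy (module_of sP) V.
HB.instance Definition _ :=
  GRing.Zmodule_isLmodule.Build A (module_of sP)
    (let: And4 p _ _ _ := sP in p) (let: And4 _ p _ _ := sP in p)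
    (let: And4 _ _ p _ := sP in p) (let: And4 _ _ _ p := sP in p).

Lemma module_of_scaleE (a : A) (v : module_of sP) : a *: v = s a v.
Proof. by []. Qed.

End ModuleOf.

Definition sym_space (K : fieldType) (n : nat) : lmodType K :=
  {ffun sym_okada n -> K^o}.

(* The basis vector of M_n given by the symmetric diagram d, and 0 if d is    *)
(* not symmetric.                                                             *)
Definition sym_vec (K : fieldType) n (d : okada n) : sym_space K n :=
  [ffun t => (val t == d)%:R].

Definition word_elt (A : nzRingType) n (E : 'I_n.-1 -> A) (w : seq 'I_n.-1) :
  A := \prod_(i <- w) E i.

(* d . t; the diagram [d o t o d^*] is symmetric when t is. *)
Definition sym_act (K : fieldType) n (lam : okada n -> okada n -> K)
    (d : okada n) (t : sym_okada n) : sym_space K n :=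
  let u := okada_comp (okada_comp d (val t)) (mirror d) in
  if PLab u == PLab (val t) then lam d (val t) *: sym_vec K u else 0.

(* [act] is a K-bilinear map whose values on the basis vectors, where the     *)
(* diagram d is identified with the element B d of O, are the d . t.          *)
Definition extends_sym_act (K : fieldType) n (O : algType K)
    (B : okada n -> O) (lam : okada n -> okada n -> K)
    (act : O -> sym_space K n -> sym_space K n) : Prop :=
  [/\ forall a, linear (act a), forall m, linear (act^~ m)
    & forall d (t : sym_okada n),
        act (B d) (sym_vec K (val t)) = sym_act lam d t].

(* Main.v *)
(** O_n modulo the ideal of E_{n-1} is O_{n-1}, and that ideal is Morita
    equivalent to O_{n-2} for generic parameters.  Hence the irreducible modules
    are indexed by the Young-Fibonacci words w of rank n: V_{1w} is inflated from
    O_{n-1}, and V_{2w} is O_{n-1} (x)_{O_{n-2}} V_w, with the basis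
    v_k (x) p where v_k = E_k E_{k+1} ... E_{n-1}.  In this basis each E_j sends
    a basis vector to a multiple of a basis vector or to zero, so that V_w has a
    purely combinatorial description.

    The map from O_n onto the product of the matrix algebras is surjective as
    soon as the Gram matrix of the pairing of E_{n-1} O_{n-1} and O_{n-1} E_{n-1},
    with values in O_{n-2} E_{n-1}, is invertible on each V_w.  Its determinant is
    a polynomial in the parameters; for y_j = 1 and x_j a rapidly increasing power
    of T the diagonal of the matrix dominates.  Straightening
    words with the defining relations shows that O_n is spanned by elements
    C(p, q), with p and q basis vectors of the same V_w; there are as many of them
    as matrix units, so they form a basis and O_n is split semisimple.

    The composition G_i o d is an explicit surgery on d which satisfies the same
    relations; since the straightening never lengthens a word, a reduced word of
    a diagram d is straightened with scalar 1, and E_d is some C(p, q).  The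
    mirror image exchanges p and q, so the symmetric diagrams are the C(p, p), and
    d . t = lambda(d, t) [d o t o d^*] is then the action of d on the basis
    vector p of the direct sum of the V_w.  The shape w is determined by PLab:
    under left multiplication by a generator the sum of the labels of the
    propagating arcs can only decrease, and if it does not then PLab does not
    change, so PLab is constant on each two-sided cell. *)

Require Import Defs.
From HB Require Import structures.
From mathcomp Require Import all_boot all_order all_algebra.
From mathcomp Require Import fingroup perm mpoly zify.
From Stdlib Require Classical_Prop.

Set Implicit Arguments.
Unset Strict Implicit.
Unset Printing Implicit Defensive.

Import GRing.Theory.
Local Open Scope ring_scope.

(** * Words and the modules V_w *)

(** The linear independence of the [B d] is not among the data, and [okada_comp] is defined through
    connected components, where associativity or compatibility with [mirror] would be laborious.
    Both obstacles are avoided alike: a derivation [wred s c t] is made once, on words, and then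
    read in the modules, in [O] and among diagrams, so that all readings share the target word, and
    the linear ones the scalar. Compositions are computed on arcs only with a generator on one side;
    facts about arbitrary compositions are pulled back from [lamE], because two elements C(p, q)
    that are proportional are equal.

    Independence is a square matrix argument: the elements C(p, q) and the matrix entries are
    indexed by the same pairs of paths, and inverting the Gram matrices provides a one-sided
    inverse.

    The order [slt] on shapes records zeros: a word takes C(p, q) out of its cell exactly when it
    kills p in V_w, and then the shape strictly drops. This is why a condition on PLab alone can
    decide when d . t vanishes. *)

Section Rewriting.
Variables (R : comNzRingType) (x y : nat -> R).

(* [wred s c t]: the relations of O_n, oriented so that they never lengthen a
   word, turn the word s into c times the word t.  As a relation on words it can
   be interpreted in algebras, in modules and in the monoid of diagrams. *)
Inductive wred : seq nat -> R -> seq nat -> Prop :=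
  | wred_refl s : wred s 1 s
  | wred_trans s c t d u : wred s c t -> wred t d u -> wred s (c * d) u
  | wred_ctx a b s c t : wred s c t -> wred (a ++ s ++ b) c (a ++ t ++ b)
  | wred_swapl i j : (i.+1 < j)%N -> wred [:: i; j] 1 [:: j; i]
  | wred_swapr i j : (i.+1 < j)%N -> wred [:: j; i] 1 [:: i; j]
  | wred_sq i : wred [:: i; i] (x i) [:: i]
  | wred_braid i : wred [:: i.+1; i; i.+1] (y i) [:: i.+1].

Lemma wred_trans1 s t c u : wred s 1 t -> wred t c u -> wred s c u.
Proof. by move=> st tu; rewrite -[c]mul1r; apply: wred_trans tu. Qed.

Lemma wred_trans2 s t c u : wred s c t -> wred t 1 u -> wred s c u.
Proof. by move=> st tu; rewrite -[c]mulr1; apply: wred_trans tu. Qed.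

Lemma wred_catl a s c t : wred s c t -> wred (a ++ s) c (a ++ t).
Proof. by move=> /(wred_ctx a [::]); rewrite !cats0. Qed.

Lemma wred_catr b s c t : wred s c t -> wred (s ++ b) c (t ++ b).
Proof. by move=> /(wred_ctx [::] b). Qed.

Lemma wred_rev s c t : wred s c t -> wred (rev s) c (rev t).
Proof.
elim=> {s c t} [s|s c t d u _ st _ tu|a b s c t _ st|i j ij|i j ij|i|i].
- exact: wred_refl.
- exact: wred_trans tu.
- by rewrite !rev_cat -!catA; apply: wred_ctx.
- exact: wred_swapr.
- exact: wred_swapl.
- exact: wred_sq.
exact: wred_braid.
Qed.

(** Scalars enter only through the square and braid rules, and these shorten the word. A reduced
    word of a diagram cannot be shortened, so its straightening has scalar 1. *)
Lemma wred_size s c t : wred s c t ->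
  (size t <= size s)%N /\ (size t = size s -> c = 1).
Proof.
elim=> {s c t} [//|s c t d u _ [st1 st2] _ [tu1 tu2]|a b s c t _ [h1 h2]|//|//|//|//].
  split=> [|e]; first exact: leq_trans st1.
  have [e1 e2] : size t = size s /\ size u = size t.
    by move: st1 tu1 e; clear; lia.
  by rewrite st2 // tu2 // mulr1.
rewrite !size_cat; split=> [|e]; first by rewrite leq_add2l leq_add2r.
by apply: h2; move: e; clear; lia.
Qed.

Definition far j s := all (fun i => (i.+1 < j)%N || (j.+1 < i)%N) s.

Lemma wred_far j s : far j s -> wred (j :: s) 1 (rcons s j).
Proof.
elim: s => [|i s IH] /=; first by move=> _; apply: wred_refl.
case/andP=> ij /IH H; apply: (@wred_trans1 _ [:: i, j & s]).
  apply: (wred_catr s (s := [:: j; i]) (t := [:: i; j])).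
  by case/orP: ij => ij; [apply: wred_swapr | apply: wred_swapl].
exact: (wred_catl [:: i] H).
Qed.

Lemma wred_farr j s : far j s -> wred (rcons s j) 1 (j :: s).
Proof.
move=> fs; rewrite -[j :: s]revK rev_cons -[rcons s j]revK rev_rcons.
by apply/wred_rev/wred_far; rewrite /far all_rev.
Qed.

Lemma wred_farcat s t : all (fun i => far i t) s -> wred (s ++ t) 1 (t ++ s).
Proof.
elim: s => [|i s IH] /=; first by rewrite cats0 => _; apply: wred_refl.
case/andP=> it /IH H; apply: (wred_trans1 (wred_catl [:: i] H)) => /=.
by rewrite -cat_cons -[t ++ i :: s]cat_rcons; apply: wred_catr; apply: wred_far.
Qed.

(* With v_k = E_k E_{k+1} ... E_N, one has E_j v_k = c v_k' s for
   [head_act j k = (c, k', s)], see [wred_head]. *)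
Definition head_act (j k : nat) : R * nat * seq nat :=
  if (j.+1 < k)%N then (1, k, [:: j])
  else if (j.+1 == k)%N then (1, j, [::])
  else if (j == k)%N then (x j, j, [::])
  else if (j == k.+1)%N then (y k, j, [::])
  else (y j.-1, j, iota k (j.-1 - k)).

Variant head_act_spec j k : R * nat * seq nat -> Prop :=
  | HeadFar of (j.+1 < k)%N : head_act_spec j k (1, k, [:: j])
  | HeadPred of (j.+1 = k)%N : head_act_spec j k (1, j, [::])
  | HeadEq of j = k : head_act_spec j k (x j, j, [::])
  | HeadSucc of j = k.+1 : head_act_spec j k (y k, j, [::])
  | HeadLow of (k.+1 < j)%N :
      head_act_spec j k (y j.-1, j, iota k (j.-1 - k)).

Lemma head_actP j k : head_act_spec j k (head_act j k).
Proof.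
rewrite /head_act; case: ltnP => h1; first by constructor.
case: eqP => h2; first by constructor.
case: eqP => h3; first by constructor.
by case: eqP => h4; constructor; lia.
Qed.

Lemma far_iota j k l : (k + l < j)%N || (j.+1 < k)%N -> far j (iota k l).
Proof. by move=> h; apply/allP => i; rewrite mem_iota; lia. Qed.

Lemma wred_head j k N : (j <= N)%N -> (k <= N)%N ->
  wred (j :: iota k (N.+1 - k)) (head_act j k).1.1
    (iota (head_act j k).1.2 (N.+1 - (head_act j k).1.2) ++ (head_act j k).2).
Proof.
move=> jN kN; case: head_actP => h /=.
- by rewrite cats1; apply: wred_far; apply: far_iota; lia.
- rewrite cats0 -h; have -> : (N.+1 - j = (N.+1 - j.+1).+1)%N by lia.
  exact: wred_refl.
- rewrite cats0 h; have -> : (N.+1 - k = (N - k).+1)%N by lia.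
  exact: (wred_catr _ (wred_sq k)).
- rewrite cats0 h; have -> : (N.+1 - k = (N - k.+1).+2)%N by lia.
  have -> : (N.+1 - k.+1 = (N - k.+1).+1)%N by lia.
  exact: (wred_catr _ (wred_braid k)).
(* Here k + 1 < j: E_j moves right past E_k ... E_{j-2} and meets E_{j-1} E_j in a braid; the prefix
   E_k ... E_{j-2} then commutes with E_j ... E_N and comes out on the right as the tail word. *)
have -> : (N.+1 - k = (j.-1 - k) + (N - j).+2)%N by lia.
rewrite iotaD; have -> : (k + (j.-1 - k) = j.-1)%N by lia.
have -> : (N.+1 - j = (N - j).+1)%N by lia.
set s := iota k _ => /=; have -> : j.-1.+1 = j by lia.
apply: (@wred_trans1 _ (s ++ [:: j, j.-1, j & iota j.+1 (N - j)])).
  rewrite -cat_cons -[s ++ j :: _]cat_rcons; apply: wred_catr.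
  by apply: wred_far; apply: far_iota; lia.
apply: (@wred_trans2 _ (s ++ [:: j & iota j.+1 (N - j)])).
  have := wred_braid j.-1; have -> : j.-1.+1 = j by lia.
  by move=> H; apply: (wred_ctx s (iota j.+1 (N - j)) H).
rewrite -[j :: _ ++ s]/(iota j (N - j).+1 ++ s).
apply: wred_farcat; apply/allP => i; rewrite mem_iota => hi.
by rewrite -[j :: _]/(iota j (N - j).+1); apply: far_iota; lia.
Qed.

Lemma head_act_bound j k N : (j <= N)%N -> (k <= N)%N ->
  ((head_act j k).1.2 <= N)%N /\ all (fun i => i.+1 < N)%N (head_act j k).2.
Proof.
move=> jN kN; case: head_actP => h /=; split=> //; first by rewrite andbT; lia.
by apply/allP => i; rewrite mem_iota; lia.
Qed.

Section Soundness.
Variables (X : Type) (sc : R -> X -> X) (e : nat -> X -> X).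
Hypothesis sc1 : forall v, sc 1 v = v.
Hypothesis scM : forall c d v, sc c (sc d v) = sc (c * d) v.
Hypothesis esc : forall j c v, e j (sc c v) = sc c (e j v).
Hypothesis e_sq : forall j v, e j (e j v) = sc (x j) (e j v).
Hypothesis e_comm : forall i j v, (i.+1 < j)%N -> e i (e j v) = e j (e i v).
Hypothesis e_braid : forall i v,
  e i.+1 (e i (e i.+1 v)) = sc (y i) (e i.+1 v).

Lemma wact_sc s c v : foldr e (sc c v) s = sc c (foldr e v s).
Proof. by elim: s => //= j s ->; rewrite esc. Qed.

Lemma wred_sound s c t v : wred s c t -> foldr e v s = sc c (foldr e v t).
Proof.
move=> H; elim: H v => {s c t} [s v|s c t d u _ st _ tu v|a b s c t _ st v
  |i j ij v|i j ij v|i v|i v] /=; rewrite ?sc1 //.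
- by rewrite st tu scM.
- by rewrite !foldr_cat st wact_sc.
- exact: e_comm.
exact/esym/e_comm.
Qed.

End Soundness.

(* A basis vector of V_w: [None] is a digit 1 of the Young-Fibonacci word w, and
   [Some k] is a digit 2 together with the choice of v_k. *)
Definition ypath := seq (option nat).

(* A word is a list of booleans, [false] for 1 and [true] for 2. *)
Fixpoint srank (w : seq bool) : nat :=
  if w is b :: w' then (b.+1 + srank w')%N else 0%N.

Definition yshape (p : ypath) : seq bool := map isSome p.

Definition prank (p : ypath) := srank (yshape p).

Fixpoint pvalid (p : ypath) : bool :=
  match p with
  | [::] => true
  | None :: p' => pvalid p'
  | Some k :: p' => (k <= prank p')%N && pvalid p'
  end.

(* A multiple of a basis vector, [None] being zero. *)
Definition spath := option (R * ypath).

Definition scp (c : R) (v : spath) : spath :=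
  omap (fun r => (c * r.1, r.2)) v.

Definition consp (k : option nat) (v : spath) : spath :=
  omap (fun r => (r.1, k :: r.2)) v.

Definition lin (f : ypath -> spath) (v : spath) : spath :=
  if v is Some (c, p) then scp c (f p) else None.

(** For a digit 1, the letters from the top generator on act as zero, because V_{1w} is inflated.
    For a digit 2, the letters left over by [head_act] act on the tail, with no bound on j or k: the
    relations hold for all letters, and ranges matter only for the stability of the valid paths. *)
Fixpoint act (w : seq bool) (j : nat) (p : ypath) : spath :=
  match w, p with
  | false :: w', None :: p' =>
      if (j.+1 < srank w')%N then consp None (act w' j p') else None
  | true :: w', Some k :: p' =>
      let: (c, k', s) := head_act j k in
      scp c (consp (Some k')
        (foldr (fun i => lin (act w' i)) (Some (1, p')) s))
  | _, _ => None
  end.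

Definition eact w j := lin (act w j).

Definition wact w s (p : ypath) : spath := foldr (eact w) (Some (1, p)) s.

Lemma scp1 v : scp 1 v = v.
Proof. by case: v => [[c p]|] //=; rewrite mul1r. Qed.

Lemma scpM c d v : scp c (scp d v) = scp (c * d) v.
Proof. by case: v => [[e p]|] //=; rewrite mulrA. Qed.

Lemma lin_sc f c v : lin f (scp c v) = scp c (lin f v).
Proof. by case: v => [[d p]|] //=; rewrite scpM. Qed.

Lemma lin1 f p : lin f (Some (1, p)) = f p.
Proof. exact: scp1. Qed.

Lemma wact_lin w s v : foldr (eact w) v s = lin (wact w s) v.
Proof.
case: v => [[c p]|] /=; last by elim: s => //= j s ->.
have -> : Some (c, p) = scp c (Some (1, p)) by rewrite /= mulr1.
elim: s => //= j s ->; exact: lin_sc.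
Qed.

Lemma wact_cons w j s p : wact w (j :: s) p = eact w j (wact w s p).
Proof. by []. Qed.

Lemma wact_cat w s t p : wact w (s ++ t) p = lin (wact w s) (wact w t p).
Proof. by rewrite /wact foldr_cat wact_lin. Qed.

Lemma act_Some w j k p : act (true :: w) j (Some k :: p) =
  scp (head_act j k).1.1
    (consp (Some (head_act j k).1.2) (wact w (head_act j k).2 p)).
Proof. by rewrite /= /wact; case: (head_act j k) => [[c k'] s]. Qed.

Lemma act_None w j p : act (false :: w) j (None :: p) =
  if (j.+1 < srank w)%N then consp None (act w j p) else None.
Proof. by []. Qed.

Lemma eact_Some w j k v : eact (true :: w) j (consp (Some k) v) =
  scp (head_act j k).1.1
    (consp (Some (head_act j k).1.2) (foldr (eact w) v (head_act j k).2)).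
Proof.
case: v => [[c p]|]; last first.
  rewrite /=; have -> s : foldr (eact w) None s = None by elim: s => //= ? ? ->.
  by [].
rewrite [LHS](_ : _ = scp c (act (true :: w) j (Some k :: p))) //.
rewrite act_Some wact_lin /=.
by case: wact => [[d q]|] //=; rewrite mulrCA.
Qed.

Lemma eact_None w j v : eact (false :: w) j (consp None v) =
  if (j.+1 < srank w)%N then consp None (eact w j v) else None.
Proof.
case: v => [[c p]|] /=; last by case: ifP.
by case: ifP => // _; case: act => [[d q]|].
Qed.

Lemma scp_cons c k v : scp c (consp k v) = consp k (scp c v).
Proof. by case: v => [[d p]|]. Qed.

Lemma eact_sc w j c v : eact w j (scp c v) = scp c (eact w j v).
Proof. exact: lin_sc. Qed.

(** Induction on w. The delicate case is the commutation of E_i and E_j when both change the head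
    v_k: the two tails then differ by a straightening, which [sound] turns into an equality through
    the induction hypothesis. *)
Lemma eact_rel w :
  [/\ forall j v, eact w j (eact w j v) = scp (x j) (eact w j v),
      forall i j v, (i.+1 < j)%N ->
        eact w i (eact w j v) = eact w j (eact w i v)
    & forall i v, eact w i.+1 (eact w i (eact w i.+1 v)) =
        scp (y i) (eact w i.+1 v)].
Proof.
elim: w => [|b w [IH1 IH2 IH3]].
  have E j v : eact [::] j v = None by case: v => [[]|].
  by split=> *; rewrite !E.
have sound s c t v := @wred_sound spath scp (eact w) scp1 scpM (@eact_sc w)
  IH1 IH2 IH3 s c t v.
(* All the maps compared are homogeneous, so basis vectors with coefficient 1 suffice. *)
have ext : forall f g : spath -> spath,
  (forall c v, f (scp c v) = scp c (f v)) ->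
  (forall c v, g (scp c v) = scp c (g v)) -> f None = None -> g None = None ->
  (forall p, f (Some (1, p)) = g (Some (1, p))) -> forall v, f v = g v.
  move=> f g fs gs f0 g0 fg [[c p]|]; last by rewrite f0 g0.
  have -> : Some (c, p) = scp c (Some (1, p)) by rewrite /= mulr1.
  by rewrite fs gs fg.
case: b.
  have red p : (exists k v, Some (1, p) = consp (Some k) v) \/
    (forall j, eact (true :: w) j (Some (1, p)) = None).
    case: p => [|[k|] p]; [by right| left | by right].
    by exists k, (Some (1, p)).
  split.
  - move=> j; apply: ext => //; try by [move=> *; rewrite ?eact_sc ?scpM // mulrC | move=> *; rewrite !eact_sc !scpM 1?mulrC].
    move=> p; case: (red p) => [[k [v ->]]|->] //.
    rewrite eact_Some eact_sc eact_Some !scpM.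
    have Ejj : head_act j j = (x j, j, [::]) by case: (head_actP j j) => // h; lia.
    case: (ltnP j.+1 k) => jk.
      have Ejk : head_act j k = (1, k, [:: j]).
        by case: (head_actP j k) => // h; lia.
      by rewrite Ejk /= Ejk /= !mulr1 !scp1 IH1 scp_cons.
    have -> : (head_act j k).1.2 = j by case: (head_actP j k) => // h; lia.
    by rewrite Ejj /= mulrC.
  - move=> i j v ij; move: v; apply: ext => //; try by move=> *; rewrite !eact_sc.
    move=> p; case: (red p) => [[k [v ->]]|H]; last by rewrite !H.
    rewrite !eact_Some !eact_sc !eact_Some.
    case: (ltnP j.+1 k) => jk.
      case: (head_actP j k) => /= h; try lia.
      case: (head_actP i k) => /= h'; try lia.
      case: (head_actP j k) => /= h1; try lia.
      by rewrite IH2.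
    have Eij : head_act i j = (1, j, [:: i]) by case: (head_actP i j) => // h; lia.
    have -> : (head_act j k).1.2 = j by case: (head_actP j k) => // h; lia.
    rewrite Eij /= scp1.
    case: (ltnP i.+1 k) => ik.
      have -> : head_act i k = (1, k, [:: i]) by case: (head_actP i k) => // h; lia.
      rewrite /= scp1.
      have -> : (head_act j k).1.2 = j by case: (head_actP j k) => // h; lia.
      congr (scp _ (consp _ _)).
      rewrite -[eact w i _]/(foldr (eact w) v (i :: (head_act j k).2)).
      rewrite (sound _ 1 (rcons (head_act j k).2 i)) ?scp1 ?foldr_rcons //.
      apply: wred_far; case: (head_actP j k) => //= h; first by lia.
      by apply: far_iota; lia.
    have Ei : (head_act i k).1.2 = i by case: (head_actP i k) => // h; lia.
    rewrite Ei; have -> : head_act j i = (y j.-1, j, iota i (j.-1 - i)).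
      case: (head_actP j i) => // h; first by lia.
      - by lia.
      - by lia.
      by lia.
    rewrite /= !scp_cons !scpM.
    congr (consp _ _); rewrite -foldr_cat.
    case: (ltnP k.+1 j) => kj.
      have -> : head_act j k = (y j.-1, j, iota k (j.-1 - k)).
        by case: (head_actP j k) => // h; lia.
      (* Both sides have head v_j and factor y_{j-1}. Their tails are E_i (E_k ... E_{j-2}) and its
         straightened form, so this is [wred_head] for the shorter chain ending at j - 2. *)
      have [ij2 kj2] : (i <= j.-2)%N /\ (k <= j.-2)%N by lia.
      have := sound _ _ _ v (wred_head ij2 kj2).
      rewrite Ei (_ : j.-2.+1 = j.-1); last by lia.
      by rewrite [foldr _ _ (i :: _)]/= => ->; rewrite scpM mulrC.
    have [kE jE] : k = i.+1 /\ j = k.+1 by lia.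
    have -> : head_act j k = (y k, j, [::]) by case: (head_actP j k) => // h; lia.
    have -> : head_act i k = (1, i, [::]) by case: (head_actP i k) => // h; lia.
    rewrite /= mul1r jE /=; have -> : (k - i = 1)%N by lia.
    by [].
  - move=> i; apply: ext => //; try by [move=> *; rewrite !eact_sc | move=> *; rewrite !eact_sc !scpM 1?mulrC].
    move=> p; case: (red p) => [[k [v ->]]|->] //.
    rewrite eact_Some !eact_sc eact_Some eact_sc eact_Some.
    case: (ltnP i.+2 k) => ik.
      have -> : head_act i.+1 k = (1, k, [:: i.+1]) by case: (head_actP i.+1 k) => // h; lia.
      rewrite /=; have -> : head_act i k = (1, k, [:: i]) by case: (head_actP i k) => // h; lia.
      rewrite /=; have -> : head_act i.+1 k = (1, k, [:: i.+1]) by case: (head_actP i.+1 k) => // h; lia.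
      by rewrite /= !scp1 IH3 scp_cons.
    have -> : (head_act i.+1 k).1.2 = i.+1 by case: (head_actP i.+1 k) => // h; lia.
    have -> : head_act i i.+1 = (1, i, [::]) by case: (head_actP i i.+1) => // h; lia.
    rewrite /=; have -> : head_act i.+1 i = (y i, i.+1, [::]).
      by case: (head_actP i.+1 i) => // h; try lia.
    by rewrite /= scp1 !scpM mulrC.
have red p : (exists v, Some (1, p) = consp None v) \/
    (forall j, eact (false :: w) j (Some (1, p)) = None).
  case: p => [|[k|] p]; [by right| by right |left].
  by exists (Some (1, p)).
split.
- move=> j; apply: ext => //; try by [move=> *; rewrite !eact_sc | move=> *; rewrite !eact_sc !scpM 1?mulrC].
  move=> p; case: (red p) => [[v ->]|->] //.
  rewrite eact_None; case: ifP => h //; rewrite eact_None h IH1.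
  by rewrite scp_cons.
- move=> i j v ij; move: v; apply: ext => //; try by move=> *; rewrite !eact_sc.
  move=> p; case: (red p) => [[v ->]|H]; last by rewrite !H.
  rewrite !eact_None; case: (ltnP j.+1 (srank w)) => h.
    have h' : (i.+1 < srank w)%N by lia.
    by rewrite h' !eact_None h h' IH2.
  by case: ifP => h' //; rewrite eact_None ltnNge h.
move=> i; apply: ext => //; try by [move=> *; rewrite !eact_sc | move=> *; rewrite !eact_sc !scpM 1?mulrC].
move=> p; case: (red p) => [[v ->]|->] //.
rewrite eact_None; case: ifP => h //.
have h' : (i.+1 < srank w)%N by lia.
by rewrite eact_None h' eact_None h IH3 scp_cons.
Qed.

Lemma wred_wact w s c t p : wred s c t -> wact w s p = scp c (wact w t p).
Proof.
have [h1 h2 h3] := eact_rel w.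
exact: (wred_sound scp1 scpM (@eact_sc w) h1 h2 h3).
Qed.

End Rewriting.

Arguments wact : simpl never.
Arguments act : simpl never.
Arguments eact : simpl never.

(* C_{2w}((k, p), (l, q)) = E_k ... E_{n-1} C_w(p, q) E_{n-2} ... E_l *)
Fixpoint cword (p q : ypath) : seq nat :=
  match p, q with
  | None :: p', None :: q' => cword p' q'
  | Some k :: p', Some l :: q' =>
      iota k ((prank p').+1 - k) ++ cword p' q' ++ rev (iota l (prank p' - l))
  | _, _ => [::]
  end.

(* The lexicographic order in which 2 is smaller than 1. *)
Fixpoint slt (u w : seq bool) : bool :=
  match u, w with
  | b :: u', c :: w' => if b == c then slt u' w' else b
  | _, _ => false
  end.

Lemma slt_irr w : slt w w = false.
Proof. by elim: w => //= b w ->; rewrite eqxx. Qed.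

Lemma slt_trans v u w : slt u v -> slt v w -> slt u w.
Proof.
elim: v u w => [|b v IH] [|a u] [|c w] //=.
by case: a b c => [] [] [] //=; apply: IH.
Qed.

Lemma cword_bound p q : pvalid p -> pvalid q -> yshape q = yshape p ->
  all (fun i => i.+1 < prank p)%N (cword p q).
Proof.
elim: p q => [|[k|] p IH] [|[l|] q] //= vp vq [] // e; last first.
  by apply: sub_all (IH _ vp vq e) => i; rewrite /prank /=; lia.
case/andP: vp => kp vp; case/andP: vq => lq vq.
have rq : prank q = prank p by rewrite /prank e.
rewrite rq in lq; rewrite !all_cat all_rev.
apply/and3P; split.
- by apply/allP => i; rewrite mem_iota /prank /= -/(prank p); lia.
- apply: sub_all (IH _ vp vq e) => i; rewrite /prank /=; lia.
by apply/allP => i; rewrite mem_iota /prank /= -/(prank p); lia.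
Qed.

Lemma prank_shape p q : yshape p = yshape q -> prank p = prank q.
Proof. by rewrite /prank => ->. Qed.

(** * Left multiplication of the elements C(p, q) by words *)

Section Cells.
Variables (R : comNzRingType) (x y : nat -> R).
Local Notation wred := (wred x y).
Local Notation act := (act x y).
Local Notation eact := (eact x y).
Local Notation wact := (wact x y).

Lemma wact_valid_of w :
  (forall j p c p', yshape p = w -> pvalid p -> (j.+1 < srank w)%N ->
     act w j p = Some (c, p') -> yshape p' = w /\ pvalid p') ->
  forall s p c p', yshape p = w -> pvalid p -> all (fun i => i.+1 < srank w)%N s ->
     wact w s p = Some (c, p') -> yshape p' = w /\ pvalid p'.
Proof.
move=> H; elim=> [|j s IH] p c p' sp vp /=; first by move=> _ [_ <-].
case/andP=> js ss; rewrite wact_cons.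
case E: (wact w s p) => [[d q]|] //; have [sq vq] := IH _ _ _ sp vp ss E.
by rewrite /eact /=; case E': (act w j q) => [[d' q']|] //= [_ <-]; apply: H E'.
Qed.

Lemma act_valid w j p c p' : yshape p = w -> pvalid p -> (j.+1 < srank w)%N ->
  act w j p = Some (c, p') -> yshape p' = w /\ pvalid p'.
Proof.
elim: w j p c p' => [|[] w IH] j [|[k|] p] // c p' [sp] /=.
  case/andP=> kp vp jw; rewrite act_Some.
  have rp : prank p = srank w by rewrite /prank sp.
  rewrite rp in kp; have jN : (j <= srank w)%N by lia.
  have [b1 b2] := head_act_bound x y jN kp.
  case E: (wact _ _ _) => [[d q]|] //= [_ <-].
  have [sq vq] := wact_valid_of IH sp vp b2 E.
  by rewrite /= -/(yshape q) sq vq andbT /prank sq.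
move=> vp _; rewrite act_None; case: ifP => // jw; case E: (act w j p) => [[d q]|] //= [_ <-].
by have [sq vq] := IH _ _ _ _ sp vp jw E; rewrite /= -/(yshape q) sq vq.
Qed.

Lemma wact_valid w s p c p' : yshape p = w -> pvalid p ->
  all (fun i => i.+1 < srank w)%N s ->
  wact w s p = Some (c, p') -> yshape p' = w /\ pvalid p'.
Proof. exact: (wact_valid_of (@act_valid w)). Qed.

(** Triangularity with respect to [slt]. In the first alternative the scalar of the derivation is
    the scalar by which s acts on p in V_w; this is what later identifies [lam d t] with a matrix
    entry. *)
Definition cell_step s p q := exists c p' q',
  [/\ wred (s ++ cword p q) c (cword p' q'), yshape q' = yshape p',
      pvalid p', pvalid q' & prank p' = prank p] /\
  ([/\ q' = q, yshape p' = yshape p & wact (yshape p) s p = Some (c, p')] \/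
   wact (yshape p) s p = None /\ slt (yshape p') (yshape p)).

Definition cell_steps n := forall s p q, prank p = n -> yshape q = yshape p ->
  pvalid p -> pvalid q -> all (fun i => i.+1 < n)%N s -> cell_step s p q.

Lemma cell_steps1 n :
  (forall j p q, prank p = n -> yshape q = yshape p -> pvalid p -> pvalid q ->
     (j.+1 < n)%N -> cell_step [:: j] p q) -> cell_steps n.
Proof.
move=> H; elim=> [|j s IH] p q rp sq vp vq /=.
  move=> _; exists 1, p, q; split; last by left; split.
  by split=> //; apply: wred_refl.
case/andP=> js ss; have [c [p1 [q1 [[w1 s1 vp1 vq1 r1] h1]]]] := IH p q rp sq vp vq ss.
have rp1 : prank p1 = n by rewrite r1.
have [d [p2 [q2 [[w2 s2 vp2 vq2 r2] h2]]]] := H j p1 q1 rp1 s1 vp1 vq1 js.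
exists (c * d), p2, q2; split.
  split=> //; last by rewrite r2 r1.
  by apply: wred_trans w2; apply: (wred_catl [:: j]).
rewrite wact_cons; case: h1 => [[e1 e2 ->]|[-> lt1]] /=; last first.
  right; split=> //; case: h2 => [[_ -> _]|[_ lt2]] //.
  exact: slt_trans lt1.
rewrite -e2; case: h2 => [[f1 f2]|].
  rewrite wact_cons /eact lin1 => E; left.
  by split; rewrite ?f1 ?e1 ?f2 //= E.
by rewrite wact_cons /eact lin1 => -[E lt2]; right; rewrite /= E.
Qed.

(** Strong induction on the rank. Under a digit 2 the letter is absorbed by the head and the
    leftover word acts on the tail. Under a digit 1 only the top letter is new: it acts as zero on
    V_{1w}, and the digit that follows decides how a leading 2 is formed. *)
Lemma cell_stepsP n : cell_steps n.
Proof.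
have [m] := ubnP n; elim: m n => // m IHm n /ltnSE nm.
apply: cell_steps1 => j p q rp sq vp vq jn.
case: p q rp sq vp vq => [|[k|] p] [|[l|] q] // rp sq;
  try by [case: sq | move: jn; rewrite -rp].
- case: sq => sq.
  move=> /andP[kp vp] /andP[lq vq].
  have rq : prank q = prank p by rewrite /prank sq.
  have nE : n = (prank p).+2 by rewrite -rp.
  have jp : (j <= prank p)%N by lia.
  have [b1 b2] := head_act_bound x y jp kp.
  have [|c [p1 [q1 [[w1 s1 vp1 vq1 r1] h1]]]] :=
    IHm (prank p) _ (head_act x y j k).2 p q erefl sq vp vq b2; first by lia.
  exists ((head_act x y j k).1.1 * c), (Some (head_act x y j k).1.2 :: p1), (Some l :: q1).
  have rq1 : prank q1 = prank p by rewrite -r1; apply: prank_shape.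
  have E : wact (yshape (Some k :: p)) [:: j] (Some k :: p) =
    scp (head_act x y j k).1.1 (consp (Some (head_act x y j k).1.2)
        (wact (yshape p) (head_act x y j k).2 p)).
    by rewrite -act_Some wact_cons /eact -[wact _ [::] _]/(Some (1, Some k :: p)) lin1.
  split.
    split=> /=; rewrite ?s1 ?r1 ?b1 ?rq1 ?vp1 ?vq1 ?andbT //; try by rewrite -rq.
      apply: wred_trans.
        have := wred_catr (cword p q ++ rev (iota l (prank p - l))) (wred_head x y jp kp).
        by rewrite cat_cons -catA; apply.
      by apply: wred_catl; rewrite catA; apply: wred_catr.
    by rewrite /prank /= -/(prank p1) r1.
  rewrite E; case: h1 => [[-> e2 ->]|[-> lt1]]; last by right.
  by left; split; rewrite ?e2 //=; rewrite e2.
case: sq => sq vp vq; have nE : n = (prank p).+1 by rewrite -rp.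
have E : wact (yshape (None :: p)) [:: j] (None :: p) =
    if (j.+1 < prank p)%N then consp None (wact (yshape p) [:: j] p) else None.
  rewrite wact_cons /eact -[wact _ [::] _]/(Some (1, None :: p)) lin1 act_None.
  by rewrite wact_cons /eact -[wact _ [::] _]/(Some (1, p)) lin1.
case: ltnP E => [jp E|pj E].
  have [||c [p1 [q1 [[w1 s1 vp1 vq1 r1] h1]]]] :=
    IHm (prank p) _ [:: j] p q erefl sq vp vq; [by lia | by rewrite /= jp |].
  exists c, (None :: p1), (None :: q1); split.
    by split; rewrite //= ?s1 // /prank /= -/(prank p1) r1.
  rewrite E; case: h1 => [[-> e2 ->]|[-> lt1]]; last by right.
  by left; split; rewrite ?e2 //=; rewrite e2.
have {pj} pj : prank p = j.+1 by lia.
case: p q sq vp vq rp nE E pj => [|[k|] p] [|[l|] q] // sq;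
  try by case: sq.
  case: sq => sq /andP[kp vp] /andP[lq vq] rp nE E pj.
  have jE : (prank p).+1 = j by move: pj; rewrite /prank /=; lia.
  have rq : prank q = prank p by rewrite /prank sq.
  rewrite rq in lq.
  (* Shape 12...: E_{j-1}, the last letter of the chain, commutes past the inner element to the
     right. Between E_j and E_{j-1} there remains E_k ... E_{j-2} times C(1p, 1q), of rank n - 2, to
     which the induction hypothesis applies. *)
  have [|||c [p1 [q1 [[w1 s1 vp1 vq1 r1] h1]]]] := IHm (prank p).+1 _
      (iota k (prank p - k)) (None :: p) (None :: q) erefl _ vp vq.
  - by lia.
  - by rewrite /= -/(yshape _) sq.
  - by apply/allP => i; rewrite mem_iota; lia.
  have {}r1 : prank p1 = j by rewrite r1 -jE.
  have rq1 : prank q1 = j by rewrite -r1; apply: prank_shape.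
  exists c, (Some j :: p1), (Some l :: q1); split; last by right; rewrite E.
  split; rewrite /= -/(yshape _) ?s1 ?r1 ?rq1 ?leqnn ?vp1 ?vq1 ?andbT //; first last.
  - by rewrite /prank /= -!/(prank _) r1 -jE.
  - by lia.
  have -> : (j.+1 - j = 1)%N by lia.
  have -> : ((prank p).+1 - k = (prank p - k) + 1)%N by lia.
  have -> : (j - l = (prank p - l) + 1)%N by lia.
  rewrite !iotaD rev_cat.
  have -> : (k + (prank p - k) = prank p)%N by lia.
  have -> : (l + (prank p - l) = prank p)%N by lia.
  set s := iota k _; set t := rev (iota l _).
  apply: (@wred_trans1 _ _ _ _ ([:: j] ++ (s ++ cword p q) ++ prank p :: t)).
    have F : far (prank p) (cword p q).
      by apply: sub_all (cword_bound vp vq sq) => i ->.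
    have := wred_ctx (j :: s) t (wred_far x y F).
    by rewrite /= -!catA /= cat_rcons.
  exact: wred_ctx.
case: sq => sq vp vq rp nE E pj.
have jE : prank p = j by move: pj; rewrite /prank /=; lia.
have rq : prank q = j by rewrite -jE; apply: prank_shape.
(* Shape 11...: E_j C(p, q) is literally the element of shape 2... with both heads equal to j. *)
exists 1, (Some j :: p), (Some j :: q); split; last by right; rewrite E.
split; rewrite /= -/(yshape _) ?sq ?jE ?rq ?leqnn ?vp ?vq //.
have -> : (j.+1 - j = 1)%N by lia.
by rewrite subnn /= cats0; apply: wred_refl.
Qed.

(** The only asymmetry of [cword] is the top letter, which belongs to the left chain. The letters of
    the inner word are at least two below it, so it can be moved to the other side. *)
Lemma cword_rev p q : pvalid p -> pvalid q -> yshape q = yshape p ->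
  wred (rev (cword p q)) 1 (cword q p).
Proof.
elim: p q => [|[k|] p IH] [|[l|] q] //= vp vq; try by [case | move=> _; exact: wred_refl].
  case=> sq; case/andP: vp vq => kp vp /andP[lq vq].
  have rq : prank q = prank p by rewrite /prank sq.
  rewrite rq in lq *; rewrite !rev_cat revK.
  have -> : ((prank p).+1 - k = (prank p - k) + 1)%N by lia.
  have -> : ((prank p).+1 - l = (prank p - l) + 1)%N by lia.
  rewrite !iotaD rev_cat /=.
  have -> : (k + (prank p - k) = prank p)%N by lia.
  have -> : (l + (prank p - l) = prank p)%N by lia.
  set s := rev (iota k _); set t := iota l _.
  rewrite -!catA; apply: wred_trans1 (wred_ctx t _ (IH _ vp vq sq)) _.
  have F : far (prank p) (cword q p).
    by rewrite -rq; apply: sub_all (cword_bound vq vp (esym sq)) => i ->.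
  have := wred_ctx t s (wred_farr x y F).
  by rewrite /= cat_rcons.
by case=> sq; apply: IH.
Qed.

End Cells.

(** * Enumeration of the Young-Fibonacci words and of the bases of the V_w *)

Fixpoint pw (w : seq bool) : seq ypath :=
  match w with
  | [::] => [:: [::]]
  | false :: w' => [seq None :: p | p <- pw w']
  | true :: w' => [seq Some k :: p | k <- iota 0 (srank w' + 1), p <- pw w']
  end.

Fixpoint shapes (n : nat) : seq (seq bool) :=
  if n is n1.+1 then
    [seq false :: w | w <- shapes n1] ++
    (if n1 is n2.+1 then [seq true :: w | w <- shapes n2] else [::])
  else [:: [::]].

Lemma mem_pw w p : (p \in pw w) = (yshape p == w) && pvalid p.
Proof.
elim: w p => [|[] w IH] [|[k|] p] //=; rewrite ?eqseq_cons //=.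
- by apply/allpairsP => -[[? ?] []].
- apply/allpairsP/andP => [[[k' p'] /= [h1 h2 [-> ->]]]|[/eqP sp /andP[kp vp]]].
    move: h1 h2; rewrite mem_iota IH => h1 /andP[/eqP sp ->].
    by rewrite /prank sp eqxx; split=> //; lia.
  exists (k, p); rewrite /= mem_iota IH sp eqxx vp; split=> //.
  by move: kp; rewrite /prank sp; lia.
- by apply/allpairsP => -[[? ?] []].
- by apply/mapP => -[].
- by apply/mapP => -[].
by rewrite mem_map ?IH // => ? ? [].
Qed.

Lemma uniq_pw w : uniq (pw w).
Proof.
elim: w => [|[] w IH] //=; last by rewrite map_inj_uniq // => ? ? [].
apply: (@allpairs_uniq _ _ _ (fun k p => Some k :: p) (iota 0 (srank w + 1)) (pw w)) => //.
  exact: iota_uniq.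
by move=> [? ?] [? ?] _ _ /= [-> ->].
Qed.

Lemma mem_shapes n w : (w \in shapes n) = (srank w == n).
Proof.
have [m] := ubnP n; elim: m n w => // m IH [|n] [|b w] nm //=.
  by rewrite mem_cat; apply/negbTE/norP; split; [|case: n nm => //= n nm]; apply/mapP => -[].
rewrite mem_cat; case: b; last first.
  rewrite mem_map => [|? ? [] //]; rewrite IH; last by lia.
  case: n nm => [|n] nm; rewrite ?orbF //.
  by rewrite [X in _ || X](_ : _ = false) ?orbF //; apply/mapP => -[].
rewrite [X in X || _](_ : _ = false) /=; last by apply/mapP => -[].
case: n nm => [|n] nm //.
by rewrite mem_map => [|? ? [] //]; rewrite IH //; lia.
Qed.

Lemma uniq_shapes n : uniq (shapes n).
Proof.
have [m] := ubnP n; elim: m n => // m IH [|n] nm //=.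
rewrite cat_uniq map_inj_uniq => [|? ? [] //]; rewrite IH /=; last by lia.
apply/andP; split; first by case: n nm => [|n] nm //; apply/hasPn => w /mapP[u _ ->]; apply/mapP => -[].
by case: n nm => [|n] nm //; rewrite map_inj_uniq => [|? ? [] //]; rewrite IH //; lia.
Qed.

(** * Operators realised by combinations of words *)

Section Span.
Variables (R : comNzRingType) (x y : nat -> R).
Local Notation act := (act x y).
Local Notation eact := (eact x y).
Local Notation wact := (wact x y).
Local Notation spath := (spath R).

Definition tcoef (v : spath) (p : ypath) : R :=
  if v is Some (c, q) then if q == p then c else 0 else 0.

Lemma tcoef_sc c v p : tcoef (scp c v) p = c * tcoef v p.
Proof. by case: v => [[d q]|] /=; [case: eqP|]; rewrite ?mulr0. Qed.

Lemma tcoef_cons k v l p : tcoef (consp k v) (l :: p) = (k == l)%:R * tcoef v p.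
Proof.
case: v => [[c q]|] /=; last by rewrite mulr0.
by rewrite eqseq_cons; case: eqP; rewrite ?mul1r ?mul0r.
Qed.

(* For a = v_k (x) p, the coefficient of v_{n-1} (x) p in E_{n-1} ... E_k b. *)
Definition gram (w : seq bool) (a b : ypath) : R :=
  let k := odflt 0%N (head None a) in
  tcoef (wact (yshape b) (rev (iota k ((srank w).+1 - k))) b)
     (Some (srank w) :: behead a).

Definition comb_coef (a : seq (R * seq nat)) (r r' : ypath) : R :=
  \sum_(cs <- a) cs.1 * tcoef (wact (yshape r) cs.2 r) r'.

(** [F r r'] is the coefficient of r' in the image of r. A single combination has to serve all
    shapes of rank n at once: this describes the image of the free algebra in the product of the
    End(V_w). *)
Definition in_word_span n (F : ypath -> ypath -> R) := exists a,
  all (fun cs => all (fun i => i.+1 < n)%N cs.2) a /\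
  forall r, pvalid r -> prank r = n -> forall r', comb_coef a r r' = F r r'.

Lemma word_span_ext n F G :
  (forall r, pvalid r -> prank r = n -> forall r', F r r' = G r r') ->
  in_word_span n F -> in_word_span n G.
Proof. by move=> FG [a [ha aF]]; exists a; split=> // r vr rr r'; rewrite aF // FG. Qed.

Lemma word_span0 n : in_word_span n (fun _ _ => 0).
Proof. by exists [::]; split=> // r _ _ r'; rewrite /comb_coef big_nil. Qed.

Lemma word_spanD n F G : in_word_span n F -> in_word_span n G ->
  in_word_span n (fun r r' => F r r' + G r r').
Proof.
move=> [a [ha aF]] [b [hb bG]]; exists (a ++ b); rewrite all_cat ha hb; split=> // r vr rr r'.
by rewrite /comb_coef big_cat /= -/(comb_coef _ _ _) -/(comb_coef b _ _) aF // bG.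
Qed.

Lemma word_spanZ n c F : in_word_span n F -> in_word_span n (fun r r' => c * F r r').
Proof.
move=> [a [ha aF]]; exists [seq (c * cs.1, cs.2) | cs <- a]; split.
  by rewrite all_map; apply: sub_all ha.
move=> r vr rr r'; rewrite -aF // /comb_coef big_map mulr_sumr.
by apply: eq_bigr => cs _; rewrite /= mulrA.
Qed.

Lemma word_span_sum n (I : eqType) (s : seq I) (F : I -> ypath -> ypath -> R) :
  (forall i, i \in s -> in_word_span n (F i)) ->
  in_word_span n (fun r r' => \sum_(i <- s) F i r r').
Proof.
elim: s => [|i s IH] H.
  by apply: word_span_ext (word_span0 n) => *; rewrite big_nil.
apply: (@word_span_ext n (fun r r' => F i r r' + \sum_(j <- s) F j r r')).
  by move=> *; rewrite big_cons.
by apply: word_spanD; [apply: H; rewrite inE eqxx | apply: IH => j js; apply: H; rewrite inE js orbT].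
Qed.

Lemma sum_delta (L : seq ypath) q (F : ypath -> R) : uniq L ->
  \sum_(p <- L) (p == q)%:R * F p = if q \in L then F q else 0.
Proof.
move=> uL; case: ifP => qL.
  rewrite (bigD1_seq q) //= eqxx mul1r big1 ?addr0 // => p /negbTE ->.
  by rewrite mul0r.
rewrite big1_seq // => p /andP[_ pL]; case: eqP => [e|]; last by rewrite mul0r.
by rewrite -e pL in qL.
Qed.

Definition supported (L : seq ypath) (v : spath) : bool :=
  if v is Some (_, q) then q \in L else true.

Lemma tcoef_lin (f : ypath -> spath) (v : spath) L r' : uniq L ->
  supported L v ->
  tcoef (lin f v) r' = \sum_(m <- L) tcoef v m * tcoef (f m) r'.
Proof.
move=> uL; case: v => [[c q]|] /= qL; last by rewrite big1 // => *; rewrite mul0r.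
rewrite tcoef_sc (bigD1_seq q) //= eqxx big1 ?addr0 // => m /negbTE mq.
by rewrite eq_sym mq mul0r.
Qed.

Lemma wact_climb w N p : N = srank w -> forall k, (k <= N)%N ->
  wact (true :: w) (iota k (N - k)) (Some N :: p) = Some (1, Some k :: p).
Proof.
move=> NE k kN; have [d dE] : exists d, N = (k + d)%N by exists (N - k)%N; lia.
elim: d k kN dE => [|d IH] k kN dE; first by rewrite dE addn0 subnn.
have -> : (N - k = (N - k.+1).+1)%N by lia.
rewrite [iota _ _]/= wact_cons IH; [|lia|lia].
rewrite /eact lin1 act_Some; have -> : head_act x y k k.+1 = (1, k, [::]).
  by case: (head_actP x y k k.+1) => // h; lia.
by rewrite /= mulr1.
Qed.

Lemma wact_far w N s v : all (fun i => i.+1 < N)%N s ->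
  foldr (eact (true :: w)) (consp (Some N) v) s =
  consp (Some N) (foldr (eact w) v s).
Proof.
elim: s => //= i s IH /andP[iN /IH ->]; rewrite eact_Some.
have -> : head_act x y i N = (1, N, [:: i]) by case: (head_actP x y i N) => // h; lia.
by rewrite /= scp1.
Qed.

(** The letter applied last is the top one, and E_N v_k has head v_N for every k. *)
Lemma wact_rev_head w N l m r : (l <= N)%N -> (m <= N)%N ->
  exists u, wact (true :: w) (rev (iota l (N.+1 - l))) (Some m :: r) =
    consp (Some N) u.
Proof.
move=> lN mN; have -> : (N.+1 - l = (N - l) + 1)%N by lia.
rewrite iotaD rev_cat /= wact_cons; have -> : (l + (N - l) = N)%N by lia.
have H s : all (fun i => i <= N)%N s -> wact (true :: w) s (Some m :: r) = None \/
    exists2 k, (k <= N)%N & exists u, wact (true :: w) s (Some m :: r) = consp (Some k) u.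
  elim: s => [|j s IH] /=; first by right; exists m => //; exists (Some (1, r)).
  case/andP=> jN /IH[e|[k kN [u e]]]; rewrite wact_cons e; first by left.
  right; exists (head_act x y j k).1.2; first by have [] := head_act_bound x y jN kN.
  by rewrite eact_Some scp_cons; eexists.
case: (H (rev (iota l (N - l)))) => [|->|[k kN [u ->]]].
- by rewrite all_rev; apply/allP => i; rewrite mem_iota; lia.
- by exists None.
rewrite eact_Some scp_cons; have -> : (head_act x y N k).1.2 = N.
  by case: (head_actP x y N k) => // h; lia.
by eexists.
Qed.

(* The words involved go through E_{n-1}, so they act by zero on every V_{1w}. *)
Lemma word_span_ideal n k l p q : pvalid p -> pvalid q -> yshape p = yshape q ->
  prank p = n -> (k <= n)%N -> (l <= n)%N ->
  in_word_span n (fun r r' => (r == q)%:R * (r' == p)%:R) ->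
  in_word_span n.+2 (fun r r' =>
    (r' == Some k :: p)%:R * gram (yshape p) (Some l :: q) r).
Proof.
move=> vp vq pq rp kn ln [a [ha aE]].
exists [seq (cs.1, iota k (n - k) ++ cs.2 ++ rev (iota l (n.+1 - l))) | cs <- a].
split.
  rewrite all_map; apply: sub_all ha => cs /= hcs.
  rewrite !all_cat all_rev; apply/and3P; split.
  - by apply/allP => i; rewrite mem_iota; lia.
  - by apply: sub_all hcs => i; lia.
  by apply/allP => i; rewrite mem_iota; lia.
move=> r vr rr r'; rewrite /comb_coef big_map.
case: r vr rr => [|[m|] r] //.
  case/andP=> mr vr; rewrite /prank /= -/(prank r) => rr.
  have {}rr : prank r = n by lia.
  rewrite rr in mr; have [u uE] := wact_rev_head (yshape r) r ln mr.
  have uL : supported (pw (yshape r)) u.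
    case: u uE => [[c r1]|] // uE; rewrite /= mem_pw.
    have V1 : pvalid (Some m :: r) by rewrite /= rr mr.
    have V2 : all (fun i => i.+1 < srank (true :: yshape r))%N (rev (iota l (n.+1 - l))).
      rewrite all_rev /= -/(prank r) rr; apply/allP => i; rewrite mem_iota; lia.
    have [|] := @wact_valid _ x y (true :: yshape r) _ (Some m :: r) _ _ _ V1 V2 uE => //.
    by move=> /= [->] /andP[_ ->]; rewrite eqxx.
  rewrite /gram /= -/(prank p) rp uE tcoef_cons eqxx mul1r.
  transitivity (\sum_(m0 <- pw (yshape r)) tcoef u m0 *
      ((r' == Some k :: p)%:R * (m0 == q)%:R)); last first.
    rewrite mulrC; under eq_bigr => m0 _ do rewrite mulrA [_ * _%:R]mulrC.
    rewrite sum_delta ?uniq_pw //; case: ifP => // qr.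
    case: u {uE} uL => [[c r1]|] /= uL; rewrite ?mul0r //.
    by case: eqP => [e|]; rewrite ?mul0r //; rewrite -e uL in qr.
  transitivity (\sum_(cs <- a) \sum_(m0 <- pw (yshape r)) tcoef u m0 *
     (cs.1 * tcoef (consp (Some k) (wact (yshape r) cs.2 m0)) r')).
    rewrite !big_seq; apply: eq_bigr => cs csa.
    rewrite /= !wact_cat uE -/(eact _ _).
    have -> : lin (wact (true :: yshape r) cs.2) (consp (Some n) u) =
       consp (Some n) (lin (wact (yshape r) cs.2) u).
      rewrite -!wact_lin; apply: wact_far; have := allP ha _ csa.
      by [].
    have -> v : lin (wact (true :: yshape r) (iota k (n - k))) (consp (Some n) v) =
        consp (Some k) v.
      by case: v => [[c r1]|] //=; rewrite wact_climb //= mulr1.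
    have -> v : consp (Some k) (lin (wact (yshape r) cs.2) v) =
       lin (fun m0 => consp (Some k) (wact (yshape r) cs.2 m0)) v.
      by case: v => [[c r1]|] //=; rewrite scp_cons.
    rewrite (tcoef_lin _ _ (uniq_pw (yshape r)) uL) mulr_sumr.
    by apply: eq_bigr => m0 _; rewrite mulrCA.
  rewrite exchange_big /= !big_seq; apply: eq_bigr => m0.
  rewrite mem_pw => /andP[/eqP sm vm]; rewrite -mulr_sumr; congr (_ * _).
  have rm : prank m0 = n by rewrite /prank sm.
  case: r' => [|k' r'].
    by rewrite big1 ?mul0r // => cs _; case: wact => [[]|] *; rewrite /= ?mulr0.
  under eq_bigr do rewrite tcoef_cons mulrCA.
  rewrite -mulr_sumr -sm -/(comb_coef a m0 r') aE // eqseq_cons [Some k == k']eq_sym.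
  by case: (k' == _); case: (r' == _); rewrite ?mul1r ?mul0r ?mulr1 ?mulr0.
move=> vr; rewrite /prank /= -/(prank r) => -[]; rewrite add0n => rr.
have top : wact (yshape (None :: r)) (rev (iota l (n.+1 - l))) (None :: r) = None.
  have -> : (n.+1 - l = (n - l) + 1)%N by lia.
  rewrite iotaD rev_cat /= wact_cons; have -> : (l + (n - l) = n)%N by lia.
  have H s : wact (false :: yshape r) s (None :: r) = None \/
     exists u, wact (false :: yshape r) s (None :: r) = consp None u.
    elim: s => [|j s [e|[u e]]]; first by right; exists (Some (1, r)).
      by left; rewrite wact_cons e.
    rewrite wact_cons e eact_None; case: ifP => _; last by left.
    by right; eexists.
  case: (H (rev (iota l (n - l)))) => [->|[u ->]] //.
  by rewrite eact_None -/(prank r) rr ltnn.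
rewrite /gram [srank _]rp [odflt _ _]/= top /= mulr0 big1 // => cs _.
by rewrite /= !wact_cat top /= mulr0.
Qed.

End Span.

Lemma pvalid_Some k p : pvalid (Some k :: p) = (k <= prank p)%N && pvalid p.
Proof. by []. Qed.

Definition paths n : seq ypath := flatten [seq pw w | w <- shapes n].

Lemma mem_paths n p : (p \in paths n) = pvalid p && (prank p == n).
Proof.
apply/flatten_mapP/andP => [[w]|[vp /eqP rp]].
  by rewrite mem_shapes mem_pw => /eqP <- /andP[/eqP <- ->].
by exists (yshape p); rewrite ?mem_shapes ?mem_pw ?eqxx // -rp.
Qed.

Lemma uniq_paths n : uniq (paths n).
Proof.
rewrite /paths; elim: (shapes n) (uniq_shapes n) => //= w s IH /andP[ws us].
rewrite cat_uniq uniq_pw IH // andbT; apply/hasPn => p /flatten_mapP[u us' pu].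
apply: contra ws => pw'; move: pu pw'; rewrite !mem_pw => /andP[/eqP -> _] /andP[/eqP <- _].
by [].
Qed.

(** * Matrix units from invertible Gram matrices *)

Section Units.
Variables (R : comNzRingType) (x y : nat -> R).
Local Notation act := (act x y).
Local Notation wact := (wact x y).
Local Notation gram := (gram x y).
Local Notation comb_coef := (comb_coef x y).
Local Notation in_word_span := (in_word_span x y).

Lemma tcoef_wact_shape r s r' : pvalid r -> all (fun i => i.+1 < prank r)%N s ->
  yshape r' != yshape r -> tcoef (wact (yshape r) s r) r' = 0.
Proof.
move=> vr hs; case E: (wact _ _ _) => [[c q]|] //= sr.
have [sq _] := wact_valid erefl vr hs E.
by case: eqP => // e; rewrite -e sq eqxx in sr.
Qed.

Lemma wact_tail w s p : all (fun i => i.+1 < srank w)%N s ->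
  wact (false :: w) s (None :: p) = consp None (wact w s p).
Proof.
elim: s => //= i s IH /andP[iw /IH e].
by rewrite !wact_cons e eact_None iw.
Qed.

Hypothesis gram_inv : forall w, exists h : ypath -> ypath -> R,
  {in pw (true :: w) &, forall a b,
     \sum_(c <- pw (true :: w)) h a c * gram w c b = (a == b)%:R}.

(** Induction on the rank. For a shape 2w, the ideal of the top generator gives the rows of the Gram
    matrix placed at p, and inverting that matrix isolates a unit. For a shape 1w, a combination
    that works in rank n - 1 acts correctly on every V_{1u}; its unwanted action on the V_{2u} is a
    sum of units already obtained and is subtracted. *)
Lemma word_span_units n p q : pvalid p -> pvalid q -> yshape p = yshape q ->
  prank p = n -> in_word_span n (fun r r' => (r == q)%:R * (r' == p)%:R).
Proof.
have [m] := ubnP n; elim: m n p q => // m IH n.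
have two k l p q : pvalid (Some k :: p) -> pvalid (Some l :: q) ->
    yshape p = yshape q -> prank (Some k :: p) = n -> (n < m.+1)%N ->
    in_word_span n (fun r r' => (r == Some l :: q)%:R * (r' == Some k :: p)%:R).
  rewrite !pvalid_Some => /andP[kp vp] /andP[lq vq] pq rp nm.
  have nE : n = (prank p).+2 by rewrite -rp.
  have [h hE] := gram_inv (yshape p).
  have rq : prank q = prank p by rewrite /prank pq.
  have qin : Some l :: q \in pw (true :: yshape p).
    by rewrite mem_pw pq /= lq vq eqxx.
  suff : in_word_span (prank p).+2 (fun r r' => \sum_(c <- pw (true :: yshape p))
    h (Some l :: q) c * ((r' == Some k :: p)%:R * gram (yshape p) c r)).
    rewrite -nE; apply: word_span_ext => r vr rr r'.
    under eq_bigr do rewrite mulrCA.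
    rewrite -mulr_sumr mulrC; congr (_ * _).
    case: (eqVneq (yshape r) (true :: yshape p)) => sr.
      by rewrite hE // ?mem_pw ?sr ?eqxx ?vr // eq_sym.
    rewrite big1_seq => [|c /andP[_]].
      by case: eqP => // e; rewrite e /= -/(yshape q) pq eqxx in sr.
    rewrite mem_pw => /andP[/eqP sc vc]; rewrite /gram tcoef_wact_shape ?mulr0 //.
      rewrite all_rev; apply/allP => i; rewrite mem_iota rr nE.
      case: c sc vc => [|[j|] c] // [] // sc; rewrite pvalid_Some => /andP[jc vc].
      by move: jc; rewrite /prank sc; lia.
    apply: contra sr => /eqP <-; case: c sc vc => [|[j|] c] //= [sc] _.
    by rewrite -/(yshape _) sc.
  apply: word_span_sum => c; rewrite mem_pw => /andP[/eqP sc vc]; apply: word_spanZ.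
  case: c sc vc => [|[j|] c] // [] // sc; rewrite pvalid_Some => /andP[jc vc].
  have rc : prank c = prank p by rewrite /prank sc.
  rewrite rc in jc.
  by apply: word_span_ideal => //; apply: IH => //; lia.
move=> p q nm vp vq pq rp.
case: p q vp vq pq rp => [|[k|] p] [|[l|] q] // vp vq pq rp; try by case: pq.
- exists [:: (1, [::])]; split=> // r vr rr r'.
  rewrite /comb_coef big_seq1 mul1r /= -rp in rr *.
  have -> : r = [::] by case: r rr {vr} => [|[]].
  by rewrite eqxx mul1r eq_sym; case: eqP.
- by case: pq => pq; apply: two.
case: pq => pq; have nE : n = (prank p).+1 by rewrite -rp.
have [|a [ha aE]] := IH (prank p) p q _ vp vq pq erefl; first by lia.
have ha' : all (fun cs => all (fun i => i.+1 < n)%N cs.2) a.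
  by apply: sub_all ha => cs; apply: sub_all => i; lia.
pose L := [seq b <- paths n | head false (yshape b)].
suff : in_word_span n (fun r r' => comb_coef a r r' + (-1) * \sum_(b <- L)
    \sum_(b' <- pw (yshape b)) comb_coef a b b' * ((r == b)%:R * (r' == b')%:R)).
  apply: word_span_ext => r vr rr r'.
  have uL : uniq L by rewrite filter_uniq // uniq_paths.
  have -> : \sum_(b <- L) \sum_(b' <- pw (yshape b))
      comb_coef a b b' * ((r == b)%:R * (r' == b')%:R) =
    \sum_(b <- L) (b == r)%:R * \sum_(b' <- pw (yshape b)) (b' == r')%:R * comb_coef a b b'.
    apply: eq_bigr => b _; rewrite mulr_sumr; apply: eq_bigr => b' _.
    by rewrite mulrC -mulrA ![_ == b]eq_sym ![_ == b']eq_sym.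
  rewrite sum_delta // mem_filter mem_paths vr rr eqxx andbT.
  rewrite sum_delta ?uniq_pw // mem_pw.
  case: r vr rr => [|[j|] r] vr rr /=.
  - by rewrite -rr in nE.
  - rewrite ?eqseq_cons /= mul0r; case: ifP => [_|]; first by rewrite mulN1r subrr.
    rewrite mulr0 addr0 => h.
    rewrite /comb_coef big1_seq // => cs /andP[_ csa].
    case E: (wact _ _ _) => [[c b]|]; rewrite ?mulr0 //=.
    case: eqP => [e|]; last by rewrite mulr0.
    have hs : all (fun i => i.+1 < prank (Some j :: r))%N cs.2.
      by rewrite rr; apply: (allP ha').
    have [sb vb] := wact_valid erefl vr hs E.
    by move: h; rewrite -e sb vb eqxx.
  rewrite mulr0 addr0; have rr' : prank r = prank p by move: rr; rewrite nE => -[].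
  transitivity (\sum_(cs <- a) cs.1 * tcoef (consp None (wact (yshape r) cs.2 r)) r').
    rewrite /comb_coef !big_seq; apply: eq_bigr => cs csa.
    by rewrite wact_tail //; rewrite -/(prank r) rr'; apply: (allP ha).
  case: r' => [|k r'].
    by rewrite big1 ?mulr0 // => cs _; case: (wact _ _ _) => [[]|] *; rewrite /= ?mulr0.
  under eq_bigr do rewrite tcoef_cons mulrCA.
  rewrite -mulr_sumr -/(comb_coef a r r') aE // !eqseq_cons eqxx /=.
  by rewrite [None == k]eq_sym; case: (k == _); rewrite ?mul0r ?mul1r ?mulr0.
apply: word_spanD; first by exists a; split.
apply/word_spanZ/word_span_sum => b; rewrite mem_filter mem_paths => /and3P[hb vb /eqP rb].
apply: word_span_sum => b'; rewrite mem_pw => /andP[/eqP sb' vb'].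
apply: word_spanZ; case: b b' hb vb rb sb' vb' => [|[j|] b] [|[j'|] b'] //= _ vb rb [sb'] vb'.
by apply: two => //; rewrite -rb /prank /= sb'.
Qed.

End Units.

(** * Generic invertibility of the Gram matrices *)

(* In the Leibniz formula, the identity is the only term of maximal degree. *)
Lemma poly_det_neq0 (F : idomainType) m (A : 'M[{poly F}]_m) (d : 'I_m -> nat) :
  (forall i, size (A i i) = (d i + d i).+1) ->
  (forall i j, i != j -> (size (A i j) <= d i + d j)%N) -> \det A != 0.
Proof.
move=> Adiag Aoff; pose D := (\sum_i (d i + d i))%N.
have Aii i : A i i != 0 by rewrite -size_poly_eq0 Adiag.
have size1 : size (\prod_i A i i) = D.+1.
  rewrite size_prod // (eq_bigr (fun i => (d i + d i) + 1)%N) => [|i _]; last by rewrite Adiag addn1.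
  by rewrite big_split /= sum1_card -addSn addnK.
rewrite /determinant (bigD1 (1%g : 'S_m)) //= odd_perm1 expr0 mul1r.
under [X in X + _]eq_bigr do rewrite perm1.
rewrite -size_poly_gt0 size_polyDl ?size1 //.
apply: (big_ind (fun p : {poly F} => (size p < D.+1)%N)) => [|p q hp hq|s s1].
- by rewrite size_poly0.
- by rewrite (leq_ltn_trans (size_polyD _ _)) // gtn_max hp hq.
rewrite ltnS -signr_odd mulr_sign; apply: (@leq_trans (size (\prod_i A i (s i)))).
  by case: ifP => _; rewrite ?size_polyN.
apply: leq_trans (size_prod_leq _ _) _.
(* [size] is the degree plus one, so only a fixed point of s contributes an extra 1. As s permutes
   the d i, they add up to D, and s has fewer fixed points than the matrix has rows. *)
have : (\sum_i size (A i (s i)) <= \sum_i ((d i + d (s i)) + (s i == i)))%N.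
  apply: leq_sum => i _; case: (eqVneq (s i) i) => [->|si]; first by rewrite Adiag addn1.
  by rewrite addn0 Aoff // eq_sym.
rewrite !big_split /= -(reindex_inj (P := xpredT) (F := d) (@perm_inj _ s)) /=.
have -> : (\sum_i d i + \sum_i d i = D)%N by rewrite -big_split.
move=> H; suff fix_lt : (\sum_i (s i == i) < #|'I_m|)%N.
  by rewrite leq_subLR addnC (leq_trans _ (leq_add (leqnn D) fix_lt)) // addnS ltnS.
have [i si] : exists i, s i != i.
  apply/existsP; apply: contraNT s1 => /existsPn h; apply/eqP/permP => i.
  by rewrite perm1; apply/eqP; rewrite -[_ == _]negbK h.
rewrite -sum1_card (bigD1 i) //= (negbTE si) add0n [X in (_ < X)%N](bigD1 i) //= add1n ltnS.
by apply: leq_sum => j _; case: eqP.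
Qed.

Lemma list_inverse (K : fieldType) (L : seq ypath) (g : ypath -> ypath -> K) :
  uniq L ->
  \det (\matrix_(i < size L, j < size L) g (nth [::] L i) (nth [::] L j)) != 0 ->
  exists h : ypath -> ypath -> K,
    {in L &, forall a b, \sum_(c <- L) h a c * g c b = (a == b)%:R}.
Proof.
set M := \matrix_(i, j) _ => uL dM.
have uM : M \in unitmx by rewrite unitmxE unitfE.
have [L0|L0] := posnP (size L).
  by exists (fun _ _ => 0) => a b; rewrite (size0nil L0).
pose e (p : ypath) : 'I_(size L) := insubd (Ordinal L0) (index p L).
have eE p : p \in L -> nat_of_ord (e p) = index p L.
  by move=> pL; rewrite val_insubd index_mem pL.
exists (fun a c => invmx M (e a) (e c)) => a b aL bL.
have := congr1 (fun B : 'M_(size L) => B (e a) (e b)) (mulVmx uM).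
rewrite !mxE -val_eqE /= !eE //.
have -> : (index a L == index b L) = (a == b).
  apply/eqP/eqP => [/(congr1 (nth [::] L))|->] //.
  by rewrite !nth_index.
move=> <-.
  rewrite (big_nth [::]) big_mkord; apply: eq_bigr => i _; rewrite !mxE eE // nth_index //.
  by congr (invmx M _ _ * _); apply: val_inj; rewrite /= eE ?mem_nth // index_uniq.
Qed.

(** * Change of the ground ring *)

Section Naturality.
Variables (R S : comNzRingType) (phi : {rmorphism R -> S}).
Variables (x y : nat -> R) (x' y' : nat -> S) (N : nat).
Hypothesis phix : forall i, (i < N)%N -> phi (x i) = x' i.
Hypothesis phiy : forall i, (i < N)%N -> phi (y i) = y' i.

Definition map_spath (v : spath R) : spath S := omap (fun r => (phi r.1, r.2)) v.

Lemma head_act_map j k : (j < N)%N ->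
  head_act x' y' j k = (phi (head_act x y j k).1.1, (head_act x y j k).1.2, (head_act x y j k).2).
Proof.
move=> jN; rewrite /head_act; case: ltnP => h1 /=; first by rewrite rmorph1.
case: eqP => h2 /=; first by rewrite rmorph1.
case: eqP => h3 /=; first by rewrite phix.
by case: eqP => h4 /=; rewrite phiy //; lia.
Qed.

Lemma map_scp c v : map_spath (scp c v) = scp (phi c) (map_spath v).
Proof. by case: v => [[d p]|] //=; rewrite rmorphM. Qed.

Lemma map_consp k v : map_spath (consp k v) = consp k (map_spath v).
Proof. by case: v => [[d p]|]. Qed.

Lemma wact_map_of w :
  (forall j p, (j < N)%N -> act x' y' w j p = map_spath (act x y w j p)) ->
  forall s p, all (fun i => i < N)%N s ->
    wact x' y' w s p = map_spath (wact x y w s p).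
Proof.
move=> H; elim=> [|j s IH] p /=; first by rewrite /wact /= rmorph1.
case/andP=> jN sN; rewrite !wact_cons IH //.
by case: (wact x y w s p) => [[c q]|] //=; rewrite /eact /= H // map_scp.
Qed.

Lemma act_map w j p : (j < N)%N -> act x' y' w j p = map_spath (act x y w j p).
Proof.
elim: w j p => [|[] w IH] j [|[k|] p] // jN.
  rewrite !act_Some head_act_map //= map_scp map_consp (wact_map_of IH) //.
  case: (head_actP x y j k) => h /=; rewrite ?jN //.
  by apply/allP => i; rewrite mem_iota; lia.
by rewrite !act_None; case: ifP => // _; rewrite map_consp IH.
Qed.

Lemma gram_map w a b : (srank w < N)%N -> gram x' y' w a b = phi (gram x y w a b).
Proof.
move=> wN; rewrite /gram (wact_map_of (@act_map (yshape b))).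
  by case: (wact _ _ _ _ _) => [[c q]|] /=; [case: eqP|]; rewrite ?rmorph0.
by rewrite all_rev; apply/allP => i; rewrite mem_iota; lia.
Qed.

End Naturality.

(** * Degrees of the Gram matrix for powers of one variable *)

Section Degree.
Variable F : idomainType.
Local Notation x := (fun j : nat => 'X^(2 ^ j.+1) : {poly F}).
Local Notation y := (fun _ : nat => 1 : {poly F}).
Local Notation act := (act x y).
Local Notation eact := (eact x y).
Local Notation wact := (wact x y).

(* The word s multiplies a basis vector by a power of T of exponent at most
   [wdeg s]. *)
Definition wdeg (s : seq nat) := (\sum_(i <- s) 2 ^ i.+1)%N.

Lemma wdeg_iota k l : (wdeg (iota k l) + 2 ^ k.+1 = 2 ^ (k + l).+1)%N.
Proof.
elim: l k => [|l IH] k; first by rewrite /wdeg big_nil addn0.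
rewrite /wdeg /= big_cons -/(wdeg _) addnS -addSn -IH.
by rewrite [(2 ^ k.+2)%N]expnS; lia.
Qed.

Definition Xpow_le (e : nat) (v : spath {poly F}) :=
  forall c p, v = Some (c, p) -> exists2 d, (d <= e)%N & c = 'X^d.

Lemma wact_deg_of w :
  (forall j p, Xpow_le (2 ^ j.+1) (act w j p)) ->
  forall s p, Xpow_le (wdeg s) (wact w s p).
Proof.
move=> H; elim=> [|j s IH] p c q /=.
  by case=> <- _; exists 0%N => //; rewrite expr0.
rewrite wact_cons; case E: (wact _ _ _) => [[c1 q1]|] //.
rewrite /eact /=; case E2: (act _ _ _) => [[c2 q2]|] //= [<- _].
have [d1 h1 ->] := IH _ _ _ E; have [d2 h2 ->] := H _ _ _ _ E2.
by exists (d1 + d2)%N; rewrite ?exprD // /wdeg big_cons addnC leq_add.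
Qed.

(** The exponents double in order that a letter outweigh all smaller ones together: for k + 1 < j,
    E_j leaves the tail word E_k ... E_{j-2}, whose weight 2^j - 2^(k+1) stays below 2^(j+1). *)
Lemma act_deg w j p : Xpow_le (2 ^ j.+1) (act w j p).
Proof.
elim: w j p => [|[] w IH] j [|[k|] p] // c q.
  rewrite act_Some; case E: (wact _ _ _) => [[c1 q1]|] //= [<- _].
  have [d h ->] := wact_deg_of IH E.
  case: (head_actP x y j k) h => hk /= h.
  - by exists d; rewrite ?mul1r //; move: h; rewrite /wdeg big_seq1.
  - by move: h; rewrite /wdeg big_nil => h; exists d; rewrite ?mul1r // (leq_trans h).
  - move: h; rewrite /wdeg big_nil leqn0 => /eqP ->.
    by exists (2 ^ j.+1)%N; rewrite ?expr0 ?mulr1.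
  - by move: h; rewrite /wdeg big_nil => h; exists d; rewrite ?mul1r // (leq_trans h).
  exists d; rewrite ?mul1r //; apply: leq_trans h _.
  have := wdeg_iota k (j.-1 - k); have -> : (k + (j.-1 - k)).+1 = j by lia.
  by move=> e; rewrite [(2 ^ j.+1)%N]expnS -e; lia.
rewrite act_None; case: ifP => // _; case E: (act _ _ _) => [[c1 q1]|] //= [<- _].
exact: IH E.
Qed.

Lemma wact_deg w s p : Xpow_le (wdeg s) (wact w s p).
Proof. exact: (wact_deg_of (@act_deg w)). Qed.

Lemma wact_up w N v k : (k <= N)%N ->
  foldr (eact (true :: w)) (consp (Some k) v) (rev (iota k.+1 (N - k))) =
  consp (Some N) v.
Proof.
move=> kN; have [d ->] : exists d, N = (k + d)%N by exists (N - k)%N; lia.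
have -> : (k + d - k = d)%N by lia.
elim: d => [|d IH]; first by rewrite addn0.
rewrite -[d.+1]addn1 iotaD rev_cat /= IH eact_Some.
have -> : head_act x y (k.+1 + d)%N (k + d)%N = (1, (k.+1 + d)%N, [::]).
  by case: (head_actP x y (k.+1 + d)%N (k + d)%N) => // h; lia.
by rewrite /= scp1 addn1 addSn addnS.
Qed.

(** For l = m the entry at p = q is the parameter x_m, of degree 2^m + 2^m. For l < m the letters l,
    ..., m-2 pass to the tail and the head then climbs to the top; for l > m the letters m, ..., l-2
    do. The tail weight is 2^max - 2^(min+1), below 2^l + 2^m, so the bounds have the form required
    by [poly_det_neq0]. *)
Lemma gram_deg w l m p q : yshape p = w -> (l <= srank w)%N -> (m <= srank w)%N ->
  let g := size (gram x y w (Some l :: q) (Some m :: p)) in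
  if (l == m) && (p == q) then g = (2 ^ l + 2 ^ m).+1 else (g <= 2 ^ l + 2 ^ m)%N.
Proof.
move=> sp lN mN; rewrite /gram /= -/(yshape p) sp.
set N := srank w; set v := wact _ _ _.
have tcoef_le u e : Xpow_le e u -> (size (tcoef u q) <= e.+1)%N.
  case: u => [[c r]|] h /=; last by rewrite size_poly0.
  case: eqP => _; last by rewrite size_poly0.
  by have [d de ->] := h _ _ erefl; rewrite size_polyXn.
case: (ltngtP l m) => lm.
- have vE : v = consp (Some N) (wact w (rev (iota l (m.-1 - l))) p).
    rewrite /v; have -> : (N.+1 - l = (m.-1 - l) + (1 + (N - m.-1)))%N by lia.
    rewrite iotaD rev_cat iotaD rev_cat.
    have -> : (l + (m.-1 - l) = m.-1)%N by lia.
    rewrite addn1 -catA /wact !foldr_cat.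
    rewrite -[Some (1, Some m :: p)]/(consp (Some m) (Some (1, p))).
    rewrite wact_far; last first.
      by rewrite all_rev; apply/allP => i; rewrite mem_iota; lia.
    rewrite /= eact_Some; have -> : head_act x y m.-1 m = (1, m.-1, [::]).
      by case: (head_actP x y m.-1 m) => // h; lia.
    by rewrite /= scp1 wact_up //; lia.
  rewrite vE tcoef_cons eqxx mul1r.
  rewrite (leq_trans (tcoef_le _ _ (@wact_deg w _ _))) //.
  rewrite /wdeg big_rev -/(wdeg _).
  have := wdeg_iota l (m.-1 - l); have -> : (l + (m.-1 - l)).+1 = m by lia.
  have : (0 < 2 ^ l)%N by rewrite expn_gt0.
  by lia.
- have vE : v = consp (Some N) (wact w (iota m (l.-1 - m)) p).
    rewrite /v; have -> : (N.+1 - l = 1 + (N - l))%N by lia.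
    rewrite iotaD rev_cat addn1 /wact foldr_cat.
    rewrite -[Some (1, Some m :: p)]/(consp (Some m) (Some (1, p))).
    move: (Some (1, p)) => u; rewrite /= eact_Some; have -> : head_act x y l m = (1, l, iota m (l.-1 - m)).
      case: (head_actP x y l m) => // h; try lia.
      by have -> : (l.-1 - m = 0)%N by lia.
    by rewrite /= scp1 wact_up //; lia.
  rewrite vE tcoef_cons eqxx mul1r.
  rewrite (leq_trans (tcoef_le _ _ (@wact_deg w _ _))) //.
  have := wdeg_iota m (l.-1 - m); have -> : (m + (l.-1 - m)).+1 = l by lia.
  have : (0 < 2 ^ m)%N by rewrite expn_gt0.
  by lia.
have vE : v = consp (Some N) (scp 'X^(2 ^ m.+1) (Some (1, p))).
  rewrite /v lm; have -> : (N.+1 - m = 1 + (N - m))%N by lia.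
  rewrite iotaD rev_cat addn1 /wact foldr_cat.
  rewrite -[Some (1, Some m :: p)]/(consp (Some m) (Some (1, p))).
  move: (Some (1, p)) => u; rewrite /= eact_Some; have -> : head_act x y m m = ('X^(2 ^ m.+1), m, [::]).
    by case: (head_actP x y m m) => // h; lia.
  by rewrite /= scp_cons wact_up.
rewrite vE tcoef_cons eqxx mul1r /= mulr1; case: (eqVneq p q) => _; last by rewrite size_poly0.
by rewrite size_polyXn lm expnS mul2n -addnn.
Qed.

Lemma gram_poly_det w :
  \det (\matrix_(i < size (pw (true :: w)), j < size (pw (true :: w)))
    gram x y w (nth [::] (pw (true :: w)) i) (nth [::] (pw (true :: w)) j)) != 0.
Proof.
set L := pw (true :: w).
pose d (i : 'I_(size L)) := (2 ^ odflt 0%N (head None (nth [::] L i)))%N.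
have LE (i : 'I_(size L)) : exists k p, [/\ nth [::] L i = Some k :: p,
     yshape p = w & (k <= srank w)%N].
  have : nth [::] L i \in L by apply: mem_nth.
  rewrite mem_pw; case: (nth _ _ _) => [|[k|] p] //= /andP[].
  by rewrite eqseq_cons /= => /eqP sp /andP[kp _]; exists k, p; rewrite -{2}sp.
apply: (@poly_det_neq0 _ _ _ d) => [i|i j ij]; rewrite mxE /d.
  have [k [p [-> sp kp]]] := LE i.
  by have := gram_deg p sp kp kp; rewrite /= !eqxx.
have [k [p [e1 sp kp]]] := LE i; have [l [q [e2 sq lq]]] := LE j.
have := gram_deg p sq kp lq; rewrite e1 e2 /=; case: ifP => // /andP[/eqP kl /eqP qp].
case/negP: ij; rewrite -(inj_eq val_inj) -(nth_uniq [::] _ _ (uniq_pw (true :: w))) ?ltn_ord //.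
by rewrite -/L e1 e2 kl qp.
Qed.

End Degree.

(** * Transfer to the field of rational functions *)

Section Generic.
Variables (K0 K : fieldType) (iota : {rmorphism K0 -> K}) (x y : nat -> K).
Hypothesis genericK : is_rational_function_field iota x y.

Let X N (i : nat) : {mpoly K0[N + N]} :=
  if insub i is Some j then 'X_(lshift N j) else 0.
Let Y N (i : nat) : {mpoly K0[N + N]} :=
  if insub i is Some j then 'X_(rshift N j) else 0.

Let evalX N i : (i < N)%N -> xy_eval iota x y (X N i) = x i.
Proof. by move=> iN; rewrite /X insubT /xy_eval mmapX mmap1U (unsplitK (inl _)). Qed.

Let evalY N i : (i < N)%N -> xy_eval iota x y (Y N i) = y i.
Proof. by move=> iN; rewrite /Y insubT /xy_eval mmapX mmap1U (unsplitK (inr _)). Qed.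

Lemma generic_x_neq0 i : x i != 0.
Proof.
apply/eqP => xi; have := @evalX i.+1 i (ltnSn i); rewrite xi => /(genericK.1).
have i1 := ltnSn i; rewrite /X insubT => /(congr1 (@msupp _ _)).
by rewrite msuppX msupp0.
Qed.

Lemma generic_y_neq0 i : y i != 0.
Proof.
apply/eqP => yi; have := @evalY i.+1 i (ltnSn i); rewrite yi => /(genericK.1).
have i1 := ltnSn i; rewrite /Y insubT => /(congr1 (@msupp _ _)).
by rewrite msuppX msupp0.
Qed.

(** Only finitely many parameters occur, so the determinant lives in a polynomial ring. Its image
    under the specialisation [psi] is nonzero, hence so is the determinant, and algebraic
    independence keeps it nonzero in K. *)
Lemma gram_inv w : exists h : ypath -> ypath -> K,
  {in pw (true :: w) &, forall a b,
     \sum_(c <- pw (true :: w)) h a c * gram x y w c b = (a == b)%:R}.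
Proof.
apply: list_inverse (uniq_pw _) _; set L := pw (true :: w).
pose N := (srank w).+1.
pose M := \matrix_(i < size L, j < size L)
  gram (X N) (Y N) w (nth [::] L i) (nth [::] L j).
pose psi := mmap (@polyC K0) (fun i : 'I_(N + N) =>
  match split i with inl j => 'X^(2 ^ j.+1) | inr _ => 1 end).
have psiX i : (i < N)%N -> psi (X N i) = 'X^(2 ^ i.+1).
  by move=> iN; rewrite /X insubT /psi mmapX mmap1U (unsplitK (inl _)).
have psiY i : (i < N)%N -> psi (Y N i) = 1.
  by move=> iN; rewrite /Y insubT /psi mmapX mmap1U (unsplitK (inr _)).
have detM : \det M != 0.
  apply: contra (gram_poly_det K0 w) => /eqP dM; rewrite -(rmorph0 psi) -dM -det_map_mx.
  apply/eqP; congr (\det _); apply/matrixP => i j; rewrite !mxE.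
  exact: (gram_map psiX psiY).
apply: contra detM => /eqP d0; apply/eqP/(genericK.1); rewrite -d0.
rewrite /xy_eval -det_map_mx; congr (\det _); apply/matrixP => i j; rewrite !mxE.
exact/esym/(gram_map (@evalX N) (@evalY N)).
Qed.

End Generic.

(** * Left multiplication of a diagram by a generator *)

Section Diagrams.
Variable n : nat.
Implicit Types (d : okada n) (u v : vertex n) (i : 'I_n.-1).

Lemma mateK d : involutive (mate d).
Proof. by move=> v; case/and4P: (valP d) => /forallP/(_ v)/and3P[/eqP]. Qed.

Lemma mate_neq d v : mate d v != v.
Proof. by case/and4P: (valP d) => /forallP/(_ v)/and3P[]. Qed.

Lemma lab_mate d v : lab d (mate d v) = lab d v.
Proof. by case/and4P: (valP d) => /forallP/(_ v)/and3P[_ _ /eqP/val_inj]. Qed.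

Lemma lab_gt0 d v : (0 < lab d v)%N.
Proof. by case/and4P: (valP d) => _ /forallP/(_ v)/andP[/andP[]]. Qed.

Lemma lab_le d v : (lab d v <= vabs v)%N.
Proof.
by case/and4P: (valP d) => _ /forallP/(_ v)/andP[/andP[_]]; rewrite leq_min => /andP[].
Qed.

Lemma odd_lab d v : odd (lab d v) = odd (minn (vabs v) (vabs (mate d v))).
Proof. by case/and4P: (valP d) => _ /forallP/(_ v)/andP[_ /eqP]. Qed.

Lemma vpos_inj : injective (@vpos n).
Proof.
move=> [i|i] [j|j] /= e; move: (ltn_ord i) (ltn_ord j) => hi hj; try lia.
  by congr inl; apply: val_inj.
by congr inr; apply: val_inj => /=; lia.
Qed.

Lemma vpos_surj p : (p < n + n)%N -> exists v, vpos v = p.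
Proof.
move=> pn; case: (ltnP p n) => h; first by exists (inl (Ordinal h)).
have h' : (n + n - p.+1 < n)%N by lia.
by exists (inr (Ordinal h')) => /=; lia.
Qed.

Lemma noncross d u v :
  ~ [&& vpos u < vpos v, vpos v < vpos (mate d u) & vpos (mate d u) < vpos (mate d v)]%N.
Proof.
by case/and4P: (valP d) => _ _ /forallP/(_ u)/forallP/(_ v)/negP.
Qed.

Lemma nested_lab d u v :
  (vpos u < vpos v)%N -> (vpos v < vpos (mate d v))%N ->
  (vpos (mate d v) < vpos (mate d u))%N -> (lab d u < lab d v)%N.
Proof.
move=> h1 h2 h3; case/and4P: (valP d) => _ _ _ /forallP/(_ v)/forallP/(_ u)/implyP; apply.
by apply/and3P.
Qed.

Lemma vpos_neq u v : u <> v -> vpos u <> vpos v.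
Proof. by move=> uv /vpos_inj. Qed.

Lemma mate_inj d : injective (mate d).
Proof. exact: inv_inj (mateK d). Qed.

(* In this form the noncrossing condition for the arcs at [lo i] and [hi i], which
   are consecutive vertices, adds up to the one for the arc that joins their
   other ends. *)
Lemma noncross_sep d u v : v <> u -> v <> mate d u ->
  (vpos u < vpos v)%N (+) (vpos (mate d u) < vpos v)%N =
  (vpos u < vpos (mate d v))%N (+) (vpos (mate d u) < vpos (mate d v))%N.
Proof.
move=> vu vmu.
have muv : mate d v <> u by move=> e; apply: vmu; rewrite -e mateK.
have mvu : mate d v <> mate d u by move/mate_inj.
move: (vpos_neq vu) (vpos_neq vmu) (vpos_neq muv) (vpos_neq mvu).
have mu : mate d u <> u by apply/eqP/mate_neq.
have mv : mate d v <> v by apply/eqP/mate_neq.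
move: (vpos_neq mu) (vpos_neq mv).
move: (@noncross d u v) (@noncross d u (mate d v)) (@noncross d (mate d u) v)
  (@noncross d (mate d u) (mate d v)) (@noncross d v u) (@noncross d v (mate d u))
  (@noncross d (mate d v) u) (@noncross d (mate d v) (mate d u)).
rewrite !mateK; clear.
move: (vpos u) (vpos v) (vpos (mate d u)) (vpos (mate d v)) => a b c e.
by lia.
Qed.

(* The parity condition on the label of an arc only involves its lower end; this
   is where the parity of the other one comes from. *)
Lemma closed_even d s e : (s <= e <= n + n)%N ->
  (forall v, s <= vpos v < e -> s <= vpos (mate d v) < e)%N ->
  odd (e - s) = false.
Proof.
have [m] := ubnP (e - s); elim: m s e => // m IH s e /ltnSE em /andP[se en] H.
case: (ltnP s e) => [lt_se|es]; last by have -> : (e - s = 0)%N by lia.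
have [|v vs] := @vpos_surj s; first by lia.
have mv : mate d v <> v by apply/eqP/mate_neq.
have := H v; rewrite vs leqnn lt_se => /(_ isT) /andP[h1 h2].
have h3 := vpos_neq mv; rewrite vs in h3.
set t := vpos (mate d v) in h1 h2 h3.
have sepE u : u <> v -> u <> mate d v -> (s <= vpos u)%N -> (s <= vpos (mate d u))%N ->
    (t < vpos u)%N = (t < vpos (mate d u))%N.
  move=> uv umv su smu; have := noncross_sep uv umv; rewrite vs -/t.
  have uv' := vpos_neq uv; have muv : mate d u <> v by move=> E; apply: umv; rewrite -E mateK.
  have muv' := vpos_neq muv; rewrite vs in uv' muv'.
  have -> : (s < vpos u)%N by lia.
  have -> : (s < vpos (mate d u))%N by lia.
  by move=> /= /negb_inj.
have side u : (s < vpos u < e)%N -> vpos u <> t -> (s < vpos (mate d u) < e)%N /\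
     vpos (mate d u) <> t /\ (t < vpos u)%N = (t < vpos (mate d u))%N.
  move=> hu ut; have uv : u <> v by move=> E; rewrite E vs ltnn in hu.
  have umv : u <> mate d v by move=> E; apply: ut; rewrite E.
  have muv : mate d u <> v by move=> E; apply: umv; rewrite -E mateK.
  have muv' := vpos_neq muv; rewrite vs in muv'.
  have [|h4 h5] := andP (H u _); first by lia.
  split; first by lia.
  split; first by move=> /vpos_inj /mate_inj.
  by apply: sepE => //; lia.
have := IH s.+1 t; have := IH t.+1 e.
have -> : (e - s = (t - s.+1) + (e - t.+1) + 2)%N by lia.
move=> H1 H2; rewrite !oddD H1 ?H2 //; try lia.
- by move=> u hu; have [||a [b c]] := side u; lia.
by move=> u hu; have [||a [b c]] := side u; lia.
Qed.

Lemma odd_vpos_mate d v : odd (vpos (mate d v)) = ~~ odd (vpos v).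
Proof.
wlog lt_v : v / (vpos v < vpos (mate d v))%N.
  move=> H; case: (ltngtP (vpos v) (vpos (mate d v))) => h; first exact: H.
    by have := H (mate d v); rewrite mateK h => /(_ isT) ->; rewrite negbK.
  by case/eqP: (mate_neq d v); apply: vpos_inj.
have H : odd (vpos (mate d v) - (vpos v).+1) = false.
  apply: (@closed_even d) => [|u hu]; first by have := vpos_bound (mate d v); lia.
  have uv : u <> v by move=> E; rewrite E ltnn in hu.
  have umv : u <> mate d v by move=> E; rewrite E ltnn andbF in hu.
  have muv : mate d u <> v by move=> E; apply: umv; rewrite -E mateK.
  have mumv : mate d u <> mate d v by move/mate_inj.
  have := noncross_sep uv umv; move: (vpos_neq muv) (vpos_neq mumv) hu lt_v; clear.
  move: (vpos v) (vpos u) (vpos (mate d v)) (vpos (mate d u)) => a b c e.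
  by lia.
have -> : vpos (mate d v) = (vpos (mate d v) - (vpos v).+1 + (vpos v).+1)%N by lia.
by rewrite oddD H.
Qed.

Definition lo i : vertex n := inl (gen_lo i).
Definition hi i : vertex n := inl (gen_hi i).

(* G_i o d: the arcs of d at the left vertices i and i+1 are replaced by an arc
   joining these two vertices and an arc joining their other ends. *)
Definition gmate i d v :=
  if v == lo i then hi i else if v == hi i then lo i
  else if v == mate d (lo i) then mate d (hi i)
  else if v == mate d (hi i) then mate d (lo i) else mate d v.

Definition glab i d v : nat :=
  if (v == lo i) || (v == hi i) then i.+1
  else if (v == mate d (lo i)) || (v == mate d (hi i))
       then minn (lab d (lo i)) (lab d (hi i)) else lab d v.

Lemma hi_neq_lo i : hi i <> lo i.
Proof. by case; lia. Qed.

Lemma glab_bound i d v : (glab i d v < n.+1)%N.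
Proof.
have := ltn_ord i; have := ltn_ord (lab d (lo i)); have := ltn_ord (lab d v).
by rewrite /glab; case: ifP => _; [|case: ifP => _]; lia.
Qed.

Definition gact_pre i d : prediagram n :=
  ([ffun v => gmate i d v], [ffun v => Ordinal (glab_bound i d v)]).

Variant gclass i d v : vertex n -> nat -> Prop :=
  | GLo of v = lo i : gclass i d v (hi i) i.+1
  | GHi of v = hi i : gclass i d v (lo i) i.+1
  | GA of v = mate d (lo i) & mate d (lo i) <> hi i & v <> lo i & v <> hi i :
      gclass i d v (mate d (hi i)) (minn (lab d (lo i)) (lab d (hi i)))
  | GB of v = mate d (hi i) & mate d (lo i) <> hi i & v <> lo i & v <> hi i :
      gclass i d v (mate d (lo i)) (minn (lab d (lo i)) (lab d (hi i)))
  | GOther of v <> lo i & v <> hi i & v <> mate d (lo i) & v <> mate d (hi i)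
       & mate d v <> lo i & mate d v <> hi i
       & mate d v <> mate d (lo i) & mate d v <> mate d (hi i) :
      gclass i d v (mate d v) (lab d v).

Lemma gclassP i d v : gclass i d v (gmate i d v) (glab i d v).
Proof.
rewrite /gmate /glab; case: eqP => h1; first exact: GLo.
case: eqP => h2; first exact: GHi.
case: eqP => h3 /=; first by apply: GA => //; rewrite -h3.
case: eqP => h4 /=.
  by apply: GB => // e; apply: h1; rewrite h4 -e mateK.
apply: GOther => //; try by move/mate_inj.
  by move=> e; apply: h3; rewrite -e mateK.
by move=> e; apply: h4; rewrite -e mateK.
Qed.

Lemma gmateK i d : involutive (gmate i d).
Proof.
move=> v; case: (gclassP i d v) => [->|->|-> ab h1 h2|-> ab h1 h2|h1 h2 h3 h4 h5 h6 h7 h8].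
- by rewrite /gmate (introF eqP (@hi_neq_lo i)) eqxx.
- by rewrite /gmate eqxx.
- have ba : mate d (hi i) <> lo i by move=> e; apply: ab; rewrite -e mateK.
  have h3 : mate d (hi i) <> mate d (lo i) by move/mate_inj/hi_neq_lo.
  rewrite /gmate (introF eqP ba) (negbTE (mate_neq d _)) (introF eqP h3) eqxx //.
- rewrite /gmate (negbTE (mate_neq d _)) (introF eqP ab) eqxx //.
rewrite /gmate; do 4 (case: eqP => // _); exact: mateK.
Qed.

Lemma gmate_neq i d v : gmate i d v <> v.
Proof.
case: (gclassP i d v) => [->|->|-> ab h1 h2|-> ab h1 h2|h1 h2 h3 h4 h5 h6 h7 h8].
- exact: hi_neq_lo.
- by move/esym/hi_neq_lo.
- by move/mate_inj/hi_neq_lo.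
- by move/mate_inj/esym/hi_neq_lo.
exact/eqP/mate_neq.
Qed.

Lemma glab_mate i d v : glab i d (gmate i d v) = glab i d v.
Proof.
have := gmateK i d v; case: (gclassP i d v) => [->|->|-> ab h1 h2|-> ab h1 h2|h1 h2 h3 h4 h5 h6 h7 h8] _.
- by rewrite /glab eqxx orbT.
- by rewrite /glab eqxx.
- have ba : mate d (hi i) <> lo i by move=> e; apply: ab; rewrite -e mateK.
  by rewrite /glab (introF eqP ba) (negbTE (mate_neq d _)) eqxx orbT.
- by rewrite /glab (negbTE (mate_neq d _)) (introF eqP ab) eqxx.
rewrite /glab; do 4 (case: eqP => // _); congr nat_of_ord; exact: lab_mate.
Qed.

Lemma vabs_pos v : vabs v = if is_right v then (n + n - vpos v)%N else (vpos v).+1.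
Proof. by case: v => j //=; have := ltn_ord j; lia. Qed.

Lemma right_pos v : is_right v = (n <= vpos v)%N.
Proof. by case: v => j //=; have := ltn_ord j; lia. Qed.

(** An arc joins positions of opposite parity. So the height of the other end of the arc at [lo i]
    has the parity of i + 1 if that end is on the right, and the opposite one if it is on the left;
    likewise at [hi i]. Noncrossing and nesting tell which of the two labels is the minimum, and the
    cases close by parity. *)
Lemma glab_ok i d v : (0 < glab i d v <= minn (vabs v) (vabs (gmate i d v)))%N &&
   (odd (glab i d v) == odd (minn (vabs v) (vabs (gmate i d v)))).
Proof.
have Vlo : vabs (lo i) = i.+1 by [].
have Vhi : vabs (hi i) = i.+2 by [].
wlog : v / v <> mate d (hi i) \/ v = hi i \/ v = lo i.
  move=> H; case: (eqVneq v (mate d (hi i))) => [vb|/eqP vb]; last by apply: H; left.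
  case: (eqVneq v (lo i)) => [vl|/eqP vl]; first by apply: H; auto.
  have := H (gmate i d v); rewrite gmateK glab_mate minnC; apply.
  rewrite vb /gmate; left; rewrite (negbTE (mate_neq d _)) -vb (introF eqP vl) vb.
  case: eqP => [e|h].
    by move/mate_inj/hi_neq_lo: e.
  by rewrite eqxx => /mate_inj/esym/hi_neq_lo.
case: (gclassP i d v) => [->|->|-> ab h1 h2|-> ab h1 h2 [//|[//|//]]|h1 h2 h3 h4 h5 h6 h7 h8] _.
- by rewrite Vlo Vhi (_ : minn i.+1 i.+2 = i.+1) ?leqnn ?eqxx //; lia.
- by rewrite Vlo Vhi (_ : minn i.+2 i.+1 = i.+1) ?leqnn ?eqxx //; lia.
- have hl := odd_lab d (lo i); have hh := odd_lab d (hi i).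
  have pa := odd_vpos_mate d (lo i); have pb := odd_vpos_mate d (hi i).
  have ba : mate d (hi i) <> lo i by move=> e; apply: ab; rewrite -e mateK.
  have sp := @noncross_sep d (lo i) (hi i) (@hi_neq_lo i) (nesym ab).
  have n1 := @nested_lab d (lo i) (hi i); have n2 := @nested_lab d (mate d (hi i)) (mate d (lo i)).
  rewrite !mateK !lab_mate in n2.
  have la := lab_le d (mate d (lo i)); have lb := lab_le d (mate d (hi i)).
  have l1 := lab_gt0 d (lo i); have l2 := lab_gt0 d (hi i).
  rewrite !lab_mate in la lb.
  have na := vpos_neq ab; have nb := vpos_neq ba; have na' := vpos_neq h1.
  have nb' : vpos (mate d (hi i)) <> vpos (hi i) by apply/vpos_neq/eqP/mate_neq.
  have nab : vpos (mate d (hi i)) <> vpos (mate d (lo i)).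
    by apply: vpos_neq => /mate_inj/hi_neq_lo.
  have := vpos_bound (mate d (hi i)); have := vpos_bound (mate d (lo i)).
  have : vpos (hi i) = i.+1 by []. have : vpos (lo i) = i by [].
  have := gen_hi_subproof i.
  move: (vabs_pos (mate d (lo i))) (vabs_pos (mate d (hi i))).
  rewrite Vlo in hl; rewrite Vhi in hh.
  rewrite !right_pos; move: hl hh pa pb sp n1 n2 la lb l1 l2 na nb na' nb' nab.
  move: (vpos (mate d (lo i))) (vpos (mate d (hi i))) (vpos (lo i)) (vpos (hi i)).
  move: (vabs (mate d (lo i))) (vabs (mate d (hi i))).
  move: (nat_of_ord (lab d (lo i))) (nat_of_ord (lab d (hi i))) (nat_of_ord i).
  move=> hl hh j va vb pa pb pl ph; clear => ohl ohh opa opb sp n1 n2 la lb l1 l2 na nb na' nb' nab.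
  move=> ea eb jn pl_j ph_j pan pbn; subst pl ph.
  have ova : odd va = odd j (+) (n <= pa)%N.
    by rewrite ea; case: leqP => _; rewrite ?oddB ?oddD ?addbb /= ?opa; case: (odd j); lia.
  have ovb : odd vb = ~~ odd j (+) (n <= pb)%N.
    by rewrite eb; case: leqP => _; rewrite ?oddB ?oddD ?addbb /= ?opb /=; case: (odd j); lia.
  have odd_minn a b : odd (minn a b) = if (a <= b)%N then odd a else odd b.
    by case: leqP.
  apply/andP; split; first by move: l1 l2 la lb; clear; lia.
  rewrite odd_minn; move: ohl ohh; rewrite !odd_minn ova ovb /= => -> ->.
  clear opa opb ova ovb odd_minn; case: (leqP n pa) ea => ca ea; case: (leqP n pb) eb => cb eb;
  case: (leqP hl hh) => c1; case: (leqP j.+1 va) => c2; case: (leqP j.+2 vb) => c3; case: (leqP va vb) => c4;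
  case: (odd j) => //=; exfalso; clear l1 l2; lia.
by case/and4P: (valP d) => _ /forallP/(_ v).
Qed.

Lemma gmate_sep i d u v : v <> u -> v <> gmate i d u ->
  (vpos u < vpos v)%N (+) (vpos (gmate i d u) < vpos v)%N =
  (vpos u < vpos (gmate i d v))%N (+) (vpos (gmate i d u) < vpos (gmate i d v))%N.
Proof.
move=> vu vgu.
have gvu : gmate i d v <> u by move=> e; apply: vgu; rewrite -e gmateK.
have gvgu : gmate i d v <> gmate i d u by move/(inv_inj (gmateK i d)).
have Phi : vpos (hi i) = (vpos (lo i)).+1 by [].
move: (vpos_neq vu) (vpos_neq vgu) (vpos_neq gvu) (vpos_neq gvgu).
case: (gclassP i d u) vu vgu gvu gvgu => [->|->|-> ab h1 h2|-> ab h1 h2|h1 h2 h3 h4 h5 h6 h7 h8] vu vgu gvu gvgu.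
- by move=> *; lia.
- by move=> *; lia.
- case: (gclassP i d v) vu vgu gvu gvgu => [->|->|-> _ k1 k2|-> _ k1 k2|k1 k2 k3 k4 k5 k6 k7 k8] vu vgu gvu gvgu //.
  + by move=> *; lia.
  + by move=> *; lia.
  have := noncross_sep k1 k3; have := noncross_sep k2 k4.
  by move: (vpos_neq k1) (vpos_neq k2) (vpos_neq k5) (vpos_neq k6); lia.
- case: (gclassP i d v) vu vgu gvu gvgu => [->|->|-> _ k1 k2|-> _ k1 k2|k1 k2 k3 k4 k5 k6 k7 k8] vu vgu gvu gvgu //.
  + by move=> *; lia.
  + by move=> *; lia.
  have := noncross_sep k1 k3; have := noncross_sep k2 k4.
  by move: (vpos_neq k1) (vpos_neq k2) (vpos_neq k5) (vpos_neq k6); lia.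
move: (vpos_neq h1) (vpos_neq h2) (vpos_neq h5) (vpos_neq h6).
have := noncross_sep (nesym h1) (nesym h5); have := noncross_sep (nesym h2) (nesym h6).
case: (gclassP i d v) vu vgu gvu gvgu => [->|->|-> _ k1 k2|-> _ k1 k2|k1 k2 k3 k4 k5 k6 k7 k8] vu vgu gvu gvgu //.
- by move=> *; lia.
- by move=> *; lia.
- by move=> *; lia.
- by move=> *; lia.
by move=> *; apply: noncross_sep.
Qed.

Lemma glab_nested i d u v : (vpos u < vpos v)%N ->
  (vpos v < vpos (gmate i d v))%N ->
  (vpos (gmate i d v) < vpos (gmate i d u))%N -> (glab i d u < glab i d v)%N.
Proof.
have Phi : vpos (hi i) = (vpos (lo i)).+1 by [].
have Plo : vpos (lo i) = i by [].
have ilt : (i.+1 < n)%N := gen_hi_subproof i.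
have Nlo : vpos (mate d (lo i)) <> vpos (lo i) by apply/vpos_neq/eqP/mate_neq.
have Nhi : vpos (mate d (hi i)) <> vpos (hi i) by apply/vpos_neq/eqP/mate_neq.
(* An arc around the new arc of G_i has its first end strictly below [lo i], and a label is at most
   the height of either end: hence it is smaller than the new label i + 1. *)
have lab_lt w : (vpos w < i)%N -> (lab d w <= i)%N.
  by move=> wi; have := lab_le d w; rewrite vabs_pos right_pos; case: (leqP n (vpos w)); lia.
move=> uv vgv gvgu.
have vu : v <> u by move=> e; rewrite e ltnn in uv.
have vgu : v <> gmate i d u by move=> e; rewrite e gmateK in vgv gvgu; lia.
have gvu : gmate i d v <> u by move=> e; apply: vgu; rewrite -e gmateK.
have gvgu' : gmate i d v <> gmate i d u by move/(inv_inj (gmateK i d)).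
move: uv vgv gvgu.
case: (gclassP i d v) vu vgu gvu gvgu' => [->|->|-> ab k1 k2|-> ab k1 k2|k1 k2 k3 k4 k5 k6 k7 k8].
- case: (gclassP i d u) => [->|->|-> _ h1 h2|-> _ h1 h2|h1 h2 h3 h4 h5 h6 h7 h8] // _ _ _ _ c1 c2 c3; try lia.
  + by have := lab_lt (mate d (lo i)); rewrite lab_mate; lia.
  + by have := lab_lt (mate d (hi i)); rewrite lab_mate; lia.
  by have := lab_lt u; lia.
- by lia.
- case: (gclassP i d u) => [->|->|-> _ h1 h2|-> _ h1 h2|h1 h2 h3 h4 h5 h6 h7 h8] // _ _ _ _; try lia.
  have := noncross_sep (nesym h1) (nesym h5); have := noncross_sep (nesym h2) (nesym h6).
  move: (vpos_neq h1) (vpos_neq h2) (vpos_neq h5) (vpos_neq h6).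
  have := @nested_lab d u (lo i); have := @nested_lab d u (hi i).
  have := @nested_lab d u (mate d (lo i)); have := @nested_lab d u (mate d (hi i)).
  by rewrite !mateK !lab_mate Phi; lia.
- case: (gclassP i d u) => [->|->|-> _ h1 h2|-> _ h1 h2|h1 h2 h3 h4 h5 h6 h7 h8] // _ _ _ _; try lia.
  have := noncross_sep (nesym h1) (nesym h5); have := noncross_sep (nesym h2) (nesym h6).
  move: (vpos_neq h1) (vpos_neq h2) (vpos_neq h5) (vpos_neq h6).
  have := @nested_lab d u (lo i); have := @nested_lab d u (hi i).
  have := @nested_lab d u (mate d (lo i)); have := @nested_lab d u (mate d (hi i)).
  by rewrite !mateK !lab_mate Phi; lia.
case: (gclassP i d u) => [->|->|-> _ h1 h2|-> _ h1 h2|h1 h2 h3 h4 h5 h6 h7 h8] // _ _ _ _; try by [lia|apply: nested_lab].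
- have := noncross_sep k1 k3; have := noncross_sep k2 k4.
  move: (vpos_neq k1) (vpos_neq k2) (vpos_neq k5) (vpos_neq k6).
  have := @nested_lab d (lo i) v; have := @nested_lab d (hi i) v.
  have := @nested_lab d (mate d (lo i)) v; have := @nested_lab d (mate d (hi i)) v.
  by rewrite !mateK !lab_mate Phi; lia.
have := noncross_sep k1 k3; have := noncross_sep k2 k4.
move: (vpos_neq k1) (vpos_neq k2) (vpos_neq k5) (vpos_neq k6).
have := @nested_lab d (lo i) v; have := @nested_lab d (hi i) v.
have := @nested_lab d (mate d (lo i)) v; have := @nested_lab d (mate d (hi i)) v.
by rewrite !mateK !lab_mate Phi; lia.
Qed.

Lemma gact_preP i d : is_okada (gact_pre i d).
Proof.
apply/and4P; split; apply/forallP => a; rewrite /= ?ffunE /=.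
- by rewrite ?ffunE gmateK eqxx /= glab_mate eqxx andbT; apply/eqP/gmate_neq.
- exact: glab_ok.
- apply/forallP => c; rewrite !ffunE; apply/negP => /and3P[h1 h2 h3].
  have ca : c <> a by move=> e; rewrite e ltnn in h1.
  have cga : c <> gmate i d a by move=> e; rewrite e ltnn in h2.
  by have := gmate_sep ca cga; rewrite h1 h3; lia.
apply/forallP => c; rewrite !ffunE; apply/implyP => /and3P[h1 h2 h3].
exact: glab_nested.
Qed.

Definition gact i d : okada n := exist _ (gact_pre i d) (gact_preP i d).

Lemma mate_gact i d v : mate (gact i d) v = gmate i d v.
Proof. by rewrite /mate ffunE. Qed.

Lemma lab_gact i d v : lab (gact i d) v = glab i d v :> nat.
Proof. by rewrite /lab ffunE. Qed.

Lemma okada_ext d1 d2 : mate d1 =1 mate d2 ->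
  (forall v, lab d1 v = lab d2 v :> nat) -> d1 = d2.
Proof.
move=> em el; apply: val_inj; move: em el; rewrite /mate /lab.
case: (val d1) => m1 l1; case: (val d2) => m2 l2 /= em el.
by congr pair; apply/ffunP => v //; apply: val_inj; apply: el.
Qed.

End Diagrams.

(** * Composition with a generator, from connected components *)

Section Composition.
Variable n : nat.
Implicit Types (d e : okada n) (u v : vertex n) (i : 'I_n.-1).
Local Notation node := (vertex n + vertex n)%type.

Definition is_comp d1 d2 e := forall u,
  [/\ connect (glue d1 d2) (outer u) (outer (mate e u)),
      forall v, connect (glue d1 d2) (outer u) (outer v) -> v = u \/ v = mate e u,
      forall w, connect (glue d1 d2) (outer u) w -> (lab e u <= frag_lab d1 d2 w)%N
    & exists2 w, connect (glue d1 d2) (outer u) w &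
        frag_lab d1 d2 w = lab e u :> nat].

Lemma is_compE d1 d2 e : is_comp d1 d2 e -> okada_comp d1 d2 = e.
Proof.
move=> H; rewrite /okada_comp -[RHS](valKd (id_diag n)); congr insubd.
rewrite [RHS]surjective_pairing; congr pair; apply/ffunP => u; rewrite ffunE.
  have [h1 h2 _ _] := H u; rewrite /comp_mate; case: pickP => [v /andP[vu /h2[e1|//]]|/(_ (mate e u))].
    by rewrite e1 eqxx in vu.
  by rewrite h1 mate_neq.
have [_ _ h3 [w h4 h5]] := H u; apply: val_inj; rewrite /= /comp_lab.
case: arg_minnP => [|w' cw' min_w']; first exact: connect0.
by apply/eqP; rewrite eqn_leq h3 // andbT; have := min_w' w h4; rewrite h5.
Qed.

Lemma mate_gen i v : mate (gen_diag i) v = gen_mate i v.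
Proof. by rewrite /mate ffunE. Qed.

Lemma lab_gen i v : lab (gen_diag i) v = gen_lab i v :> nat.
Proof.
rewrite /lab ffunE inordK // /gen_lab; have := vabs_bound v.
by have := gen_hi_subproof i; case: ifP => _; lia.
Qed.

Section LeftGen.
Variables (i : 'I_n.-1) (d : okada n).
Local Notation G := (glue (gen_diag i) d).
Local Notation m := (mate d).
Local Notation lo := (lo i).
Local Notation hi := (hi i).

Let tip v := (v == lo) || (v == hi).
Let joined v := [|| v == lo, v == hi, v == m lo | v == m hi].

(** The vertex of d reached from w along a straight arc of G_i or across the gluing; the left arc of
    G_i is a component of its own and gets [None]. Together with [same], this yields an invariant of
    connectivity that bounds the components from above. *)
Let class (w : node) : option (vertex n) :=
  match w with
  | inl (inl j) => if tip (inl j) then None else Some (inl j)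
  | inl (inr j) => Some (inl j)
  | inr v => Some v
  end.

Let same u v := [|| v == u, v == m u | joined u && joined v].

Let same_mate u v : same u v -> same u (m v).
Proof.
rewrite /same /joined => /or3P[/eqP->|/eqP->|/andP[-> /or4P[]/eqP->]].
- by rewrite eqxx orbT.
- by rewrite mateK eqxx.
- by rewrite eqxx !orbT.
- by rewrite eqxx !orbT.
- by rewrite mateK eqxx !orbT.
by rewrite mateK eqxx !orbT.
Qed.

Let joined_mate v : joined (m v) = joined v.
Proof.
rewrite /joined !(inj_eq (@mate_inj _ d)).
have E w : (m v == w) = (v == m w) by rewrite -(inj_eq (@mate_inj _ d)) mateK.
by rewrite !E; case: (v == m lo); case: (v == m hi); case: (v == lo); case: (v == hi).
Qed.

Let same_tips u : same u lo = same u hi.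
Proof.
have joined_lo : joined lo by rewrite /joined eqxx.
have joined_hi : joined hi by rewrite /joined eqxx orbT.
have E v : joined v -> same u v = joined u.
  move=> jv; rewrite /same jv andbT; case: eqP => [<-//|_]; case: eqP => [e|_] //.
  by move: jv; rewrite e joined_mate => ->.
by rewrite !E.
Qed.

Let in_class u (w : node) := match class (outer u), class w with
  | None, None => true
  | Some a, Some b => same a b
  | _, _ => false
  end.

Let inlE (j k : 'I_n) : ((inl j : vertex n) == inl k) = (j == k).
Proof. exact: (inj_eq inl_inj). Qed.

Let inrE (j k : 'I_n) : ((inr j : vertex n) == inr k) = (j == k).
Proof. exact: (inj_eq inr_inj). Qed.

Let in_class_glue u w w' : G w w' -> in_class u w -> in_class u w'.
Proof.
rewrite /in_class; case: (class (outer u)) => [a|].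
  case: w w' => [[j|j]|[j|j]] [[k|k]|[k|k]] //=; rewrite ?mate_gen /= /tip.
  - by rewrite !inlE; case: (j == gen_lo i) => //=; case: (j == gen_hi i) => //= /eqP.
  - rewrite !inlE; case: (j == gen_lo i) => //=; case: (j == gen_hi i) => //=.
    by rewrite inrE => /eqP<-.
  - case E1: (j == gen_lo i) => [/eqP //|]; case E2: (j == gen_hi i) => [/eqP //|].
    by rewrite inlE => /eqP <-; rewrite !inlE E1 E2.
  - case: (eqVneq j (gen_lo i)) => [->|_]; first by rewrite inrE => /eqP <-; rewrite same_tips.
    case: (eqVneq j (gen_hi i)) => [->|_]; first by rewrite inrE => /eqP <-; rewrite same_tips.
    by move/eqP.
  - by move/eqP=> ->.
  - by move/eqP=> ->.
  - by move/eqP=> <- /same_mate.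
  - by move/eqP=> <- /same_mate.
  - by move/eqP=> <- /same_mate.
  by move/eqP=> <- /same_mate.
case: w w' => [[j|j]|[j|j]] [[k|k]|[k|k]] //=; rewrite ?mate_gen /= /tip !inlE.
- case: (j == gen_lo i) => /=; first by rewrite inlE => /eqP <-; rewrite eqxx orbT.
  by case: (j == gen_hi i) => //=; rewrite inlE => /eqP <-; rewrite eqxx.
by case: (j == gen_lo i) => //=; case: (j == gen_hi i).
Qed.

Let connect_class u w : connect G (outer u) w -> in_class u w.
Proof.
have refl : in_class u (outer u).
  by rewrite /in_class; case: (class (outer u)) => // a; rewrite /same eqxx.
move=> /connectP[p + ->]; elim: p (outer u) refl => //= w' p IH w0 hw /andP[e ep].
exact: IH (in_class_glue e hw) ep.
Qed.

Let class_outer u : class (outer u) = if tip u then None else Some u.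
Proof. by case: u => j //=; rewrite /tip; case: eqP => //; case: eqP. Qed.

Let connect_in u : ~~ tip u ->
  connect G (outer u) (inr u) /\ connect G (inr u) (outer u).
Proof.
case: u => j /= tj; last by split; exact: connect0.
have [jl jh] : (j == gen_lo i) = false /\ (j == gen_hi i) = false.
  by move: tj; rewrite /tip !inlE => /norP[/negbTE -> /negbTE ->].
split.
  apply: (@connect_trans _ _ (inl (inr j))); apply: connect1;
    by rewrite /= ?mate_gen /= ?jl ?jh ?eqxx.
apply: (@connect_trans _ _ (inl (inr j))); apply: connect1;
  by rewrite /= ?mate_gen /= ?jl ?jh ?eqxx.
Qed.

Let connect_mate v : connect G (inr v) (inr (m v)).
Proof. by apply: connect1; case: v => j; rewrite /= eqxx. Qed.

Let connect_tips : connect G (inr lo) (inr hi) /\ connect G (inr hi) (inr lo).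
Proof.
have hl : (gen_hi i == gen_lo i) = false.
  by apply/eqP => e; apply: (@hi_neq_lo n i); rewrite /hi e.
split.
  apply: (@connect_trans _ _ (inl (inr (gen_lo i)))); first by apply: connect1; rewrite /= eqxx.
  apply: (@connect_trans _ _ (inl (inr (gen_hi i)))); apply: connect1;
    by rewrite /= ?mate_gen /= ?eqxx.
apply: (@connect_trans _ _ (inl (inr (gen_hi i)))); first by apply: connect1; rewrite /= eqxx.
apply: (@connect_trans _ _ (inl (inr (gen_lo i)))); apply: connect1;
  by rewrite /= ?mate_gen /= ?hl ?eqxx.
Qed.

(** When d joins the two vertices of the right arc of G_i, a closed loop appears; it contains no
    outer vertex, so its label and its deletion do not affect the four conditions. *)
Lemma is_comp_gact : is_comp (gen_diag i) d (gact i d).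
Proof.
have hl : (hi == lo) = false by apply/eqP/hi_neq_lo.
have tipN v : v <> lo -> v <> hi -> ~~ tip v.
  by move=> /eqP/negbTE h1 /eqP/negbTE h2; rewrite /tip h1 h2.
move=> u; rewrite mate_gact; split.
- case: (gclassP i d u) => [->|->|-> ab h1 h2|-> ab h1 h2|h1 h2 h3 h4 h5 h6 h7 h8].
  + by apply: connect1; rewrite /= mate_gen /= eqxx.
  + by apply: connect1; rewrite /= mate_gen /= -inlE hl eqxx.
  + have ba : m hi <> lo by move=> e; apply: ab; rewrite -e mateK.
    apply: connect_trans (connect_in (tipN _ h1 h2)).1 _.
    apply: connect_trans (connect_mate _) _; rewrite mateK.
    apply: connect_trans connect_tips.1 _; apply: connect_trans (connect_mate _) _.
    by apply: (connect_in _).2; apply: tipN => //; apply/eqP/mate_neq.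
  + apply: connect_trans (connect_in (tipN _ h1 h2)).1 _.
    apply: connect_trans (connect_mate _) _; rewrite mateK.
    apply: connect_trans connect_tips.2 _; apply: connect_trans (connect_mate _) _.
    by apply: (connect_in _).2; apply: tipN => //; apply/eqP/mate_neq.
  apply: connect_trans (connect_in (tipN _ h1 h2)).1 _.
  apply: connect_trans (connect_mate _) _.
  by apply: (connect_in _).2; apply: tipN.
- move=> v /connect_class; rewrite /in_class !class_outer /gmate.
  rewrite /tip; case: eqP => [->|h1] /=.
    by case: eqP => [->|h2] /=; [left|case: eqP => [->|h3] //; right].
  case: eqP => [->|h2] /=.
    by case: eqP => [->|h3] /=; [right|case: eqP => [->|h4] //; left].
  case: eqP => //= k1; case: eqP => //= k2; rewrite /same => /or3P[/eqP->|/eqP e|].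
  + by left.
  + right; case: eqP => [e1|_]; first by case: k1; rewrite e e1 mateK.
    by case: eqP => [e1|_] //; case: k2; rewrite e e1 mateK.
  rewrite /joined (introF eqP h1) (introF eqP h2) (introF eqP k1) (introF eqP k2) /=.
  case/andP=> /orP[]/eqP-> /orP[]/eqP->; rewrite ?eqxx; auto.
    by right; case: eqP => // /mate_inj/hi_neq_lo.
- move=> w /connect_class; rewrite /in_class class_outer lab_gact.
  case: ifP => [tu|/negbT tu]; case E: (class w) => [b|] //= H.
    have -> : glab i d u = i.+1 by rewrite /glab -/(tip u) tu.
    case: w E {H} => [[j|j]|[j|j]] //=; case: ifP => // tj _.
    rewrite lab_gen /gen_lab /=; case/orP: tj => /eqP [->] /=; last by rewrite eqxx.
    by case: eqP => // ?; lia.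
  have le_b : (glab i d u <= lab d b)%N.
    rewrite /glab -/(tip u) (negbTE tu); case/or3P: H => [/eqP ->|/eqP ->|/andP[ju jb]].
    - by case: ifP => // /orP[]/eqP ->; rewrite lab_mate geq_min leqnn ?orbT.
    - by case: ifP => [/orP[]/eqP ->|_]; rewrite !lab_mate // geq_min leqnn ?orbT.
    have -> : (u == m lo) || (u == m hi).
      by move: ju; rewrite /joined orbA -/(tip u) (negbTE tu).
    by case/or4P: jb => /eqP ->; rewrite ?lab_mate geq_min leqnn ?orbT.
  case: w E => [[j|j]|v] /=.
  - case: ifP => // /norP[jl jh] [bE]; rewrite -bE in le_b.
    rewrite lab_gen /gen_lab; case: eqP => [e|_]; last exact: (leq_trans le_b (lab_le d (inl j))).
    case/eqP: jh; rewrite /hi; congr inl; apply: val_inj; move: e => /= ; lia.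
  - move=> [bE]; rewrite -bE in le_b H.
    rewrite lab_gen /gen_lab; case: eqP => [e|_]; last exact: (leq_trans le_b (lab_le d (inl j))).
    have jE : j = gen_hi i by apply: val_inj; move: e => /=; lia.
    (* This node carries the label i + 1 although its height is i + 2, so its own height gives no
       bound. The component also contains the arc of d at [lo], whose label is at most i + 1. *)
    rewrite jE -[inl (gen_hi i)]/hi -same_tips in H.
    have ju : joined u.
      case/or3P: H => [/eqP <-|/eqP e1|/andP[]//]; first by rewrite /joined eqxx.
      by rewrite -joined_mate -e1 /joined eqxx.
    have uab : (u == m lo) || (u == m hi).
      by move: ju; rewrite /joined orbA -/(tip u) (negbTE tu).
    rewrite /glab -/(tip u) (negbTE tu) uab geq_min; apply/orP; left.
    exact: (lab_le d lo).
  by case=> ->.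
rewrite lab_gact /glab -/(tip u); case: ifP => [tu|/negbT tu].
  exists (outer u); first exact: connect0.
  case/orP: tu => /eqP ->; rewrite /= lab_gen /gen_lab /= ?eqxx //.
  by case: eqP => // ?; lia.
case: ifP => [uab|_]; last by exists (inr u); first exact: (connect_in tu).1.
have cu v : joined v -> connect G (outer u) (inr v).
  have clo : connect G (outer u) (inr lo).
    apply: connect_trans (connect_in tu).1 _; apply: connect_trans (connect_mate u) _.
    case/orP: uab => /eqP ->; rewrite mateK; [exact: connect0 | exact: connect_tips.2].
  case/or4P=> /eqP -> //; first exact: connect_trans clo connect_tips.1.
    exact: connect_trans clo (connect_mate _).
  by apply: connect_trans clo _; apply: connect_trans connect_tips.1 (connect_mate _).
case: (leqP (lab d lo) (lab d hi)) => h.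
  by exists (inr lo) => //; apply: cu; rewrite /joined eqxx.
by exists (inr hi) => //; apply: cu; rewrite /joined eqxx orbT.
Qed.

Lemma comp_gen : okada_comp (gen_diag i) d = gact i d.
Proof. exact/is_compE/is_comp_gact. Qed.

End LeftGen.

Lemma mate_mirror d v : mate (mirror d) v = vopp (mate d (vopp v)).
Proof. by rewrite /mate ffunE. Qed.

Lemma lab_mirror d v : lab (mirror d) v = lab d (vopp v).
Proof. by rewrite /lab ffunE. Qed.

Lemma mirrorK : involutive (@mirror n).
Proof.
move=> d; apply: okada_ext => v; first by rewrite !mate_mirror !voppK.
by rewrite !lab_mirror voppK.
Qed.

Lemma mirror_gen i : mirror (gen_diag i) = gen_diag i.
Proof.
apply: okada_ext => v; last by rewrite lab_mirror !lab_gen /gen_lab vabs_opp.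
by rewrite mate_mirror !mate_gen; case: v => j /=; case: (j == _) => //; case: (j == _).
Qed.

Definition flip (w : node) : node :=
  match w with inl v => inr (vopp v) | inr v => inl (vopp v) end.

Lemma flipK : involutive flip.
Proof. by case=> v /=; rewrite voppK. Qed.

Lemma flip_outer v : flip (outer v) = outer (vopp v).
Proof. by case: v. Qed.

Lemma glue_flip d1 d2 w w' : glue d1 d2 w w' ->
  glue (mirror d2) (mirror d1) (flip w) (flip w').
Proof.
by case: w w' => [[j|j]|[j|j]] [[k|k]|[k|k]] //=;
  rewrite ?mate_mirror ?voppK => /eqP // ->.
Qed.

Lemma connect_flip d1 d2 w w' : connect (glue d1 d2) w w' ->
  connect (glue (mirror d2) (mirror d1)) (flip w) (flip w').
Proof.
case/connectP=> p + ->; elim: p w => [|w1 p IH] w //= /andP[e ep].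
exact: connect_trans (connect1 (glue_flip e)) (IH _ ep).
Qed.

Lemma is_comp_mirror d1 d2 e : is_comp d1 d2 e ->
  is_comp (mirror d2) (mirror d1) (mirror e).
Proof.
have back w w' : connect (glue (mirror d2) (mirror d1)) w w' ->
    connect (glue d1 d2) (flip w) (flip w').
  by move/connect_flip; rewrite !mirrorK.
have fragE w : frag_lab (mirror d2) (mirror d1) w = frag_lab d1 d2 (flip w).
  by case: w => v /=; rewrite lab_mirror.
move=> H u; have [h1 h2 h3 [w h4 h5]] := H (vopp u).
rewrite mate_mirror lab_mirror; split.
- by have := connect_flip h1; rewrite !flip_outer voppK.
- move=> v /back; rewrite !flip_outer => /h2[]; first by move/(inv_inj (@voppK n)); left.
  by move=> e1; right; rewrite -e1 voppK.
- by move=> w' /back; rewrite flip_outer fragE; apply: h3.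
exists (flip w); last by rewrite fragE flipK.
by have := connect_flip h4; rewrite flip_outer voppK.
Qed.

Lemma mirror_comp_gen i d :
  mirror (okada_comp (gen_diag i) d) = okada_comp (mirror d) (gen_diag i).
Proof.
rewrite comp_gen; apply/esym; rewrite -{1}[gen_diag i]mirror_gen.
exact/is_compE/is_comp_mirror/is_comp_gact.
Qed.

End Composition.

(** * The relations of the generators, for the surgery *)

Section Relations.
Variable n : nat.
Implicit Types (d e : okada n) (u v : vertex n) (i j : 'I_n.-1).

Lemma gact_id i d : mate d (lo i) = hi i -> lab d (lo i) = i.+1 :> nat ->
  gact i d = d.
Proof.
move=> m1 l1; have m2 : mate d (hi i) = lo i by rewrite -m1 mateK.
have l2 : lab d (hi i) = i.+1 :> nat by rewrite -m1 lab_mate.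
apply: okada_ext => v; rewrite ?mate_gact ?lab_gact.
  rewrite /gmate m1 m2; case: eqP => [->|h1] //; case: eqP => [->|h2] //.
rewrite /glab m1 m2; case: (eqVneq v (lo i)) => [->|_] /=; first by rewrite l1.
by case: (eqVneq v (hi i)) => [->|_] //=; rewrite l2.
Qed.

Lemma mate_gact_lo i d : mate (gact i d) (lo i) = hi i.
Proof. by rewrite mate_gact /gmate eqxx. Qed.

Lemma lab_gact_lo i d : lab (gact i d) (lo i) = i.+1 :> nat.
Proof. by rewrite lab_gact /glab eqxx. Qed.

Lemma gact_sq i d : gact i (gact i d) = gact i d.
Proof. exact: gact_id (mate_gact_lo i d) (lab_gact_lo i d). Qed.

Lemma lo_hi j i : j = i.+1 :> nat -> lo j = hi i.
Proof. by move=> e; congr inl; apply: val_inj. Qed.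

(** After the first surgery the vertices j and j + 1 are joined with their maximal label. The arc at
    i has a smaller label, so all minima are that label: the second surgery shifts this arc upwards,
    and the third one puts it back. *)
Lemma gact_braid i j d : j = i.+1 :> nat ->
  gact j (gact i (gact j d)) = gact j d.
Proof.
move=> ji; pose u := lo i; pose v := lo j; pose w := hi j.
move: (gact j d) (mate_gact_lo j d) (lab_gact_lo j d) => e evw lev.
have hiE : hi i = v := esym (lo_hi ji).
rewrite -/v -/w in evw lev.
have ewv : mate e w = v by rewrite -evw mateK.
have lew : lab e w = j.+1 :> nat by rewrite -evw lab_mate.
have uv : u <> v by move/esym; rewrite -hiE; apply: hi_neq_lo.
have uw : u <> w by case; lia.
have vw : v <> w by move/esym; apply: hi_neq_lo.
have au : mate e u <> u by apply/eqP/mate_neq.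
have av : mate e u <> v by rewrite -ewv => /mate_inj.
have aw : mate e u <> w by rewrite -evw => /mate_inj.
have leu : (lab e u <= i.+1)%N := lab_le e u.
have m2 x : mate (gact i e) x = if x == u then v else if x == v then u
    else if x == mate e u then w else if x == w then mate e u else mate e x.
  by rewrite mate_gact /gmate hiE -/u evw.
have l2 x : nat_of_ord (lab (gact i e) x) = if (x == u) || (x == v) then i.+1
    else if (x == mate e u) || (x == w) then nat_of_ord (lab e u) else lab e x.
  rewrite lab_gact /glab hiE -/u evw lev.
  by have -> : minn (lab e u) j.+1 = lab e u by lia.
have nvu : (v == u) = false by apply/eqP => /esym.
have nwu : (w == u) = false by apply/eqP => /esym.
have nwv : (w == v) = false by apply/eqP => /esym.
have nwa : (w == mate e u) = false by apply/eqP => /esym.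
have m2v : mate (gact i e) v = u by rewrite m2 nvu eqxx.
have m2w : mate (gact i e) w = mate e u by rewrite m2 nwu nwv nwa eqxx.
have l2v : lab (gact i e) v = i.+1 :> nat by rewrite l2 eqxx orbT.
have l2w : lab (gact i e) w = lab e u :> nat by rewrite l2 nwu nwv nwa eqxx.
apply: okada_ext => x; rewrite ?mate_gact ?lab_gact.
  rewrite /gmate -/v -/w m2v m2w.
  case: eqP => [->|xv] //; case: eqP => [->|xw] //; case: eqP => [->|xu] //.
  case: eqP => [->|xa]; first by rewrite mateK.
  by rewrite m2; do 4 (case: eqP => // _).
rewrite /glab -/v -/w m2v m2w l2v l2w.
case: eqP => [->|xv] //=; case: eqP => [->|xw] //=; case: eqP => [->|xu] /=; first by lia.
case: eqP => [->|xa]; first by rewrite lab_mate; lia.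
by rewrite l2; do 4 (case: eqP => //= _).
Qed.

Lemma gact_comm i j d : (i.+1 < j)%N -> gact i (gact j d) = gact j (gact i d).
Proof.
move=> ij; pose p := lo i; pose q := hi i; pose r := lo j; pose s := hi j.
have pq : p <> q by move/esym/hi_neq_lo.
have rs : r <> s by move/esym/hi_neq_lo.
have pr : p <> r by case; lia.
have ps : p <> s by case; lia.
have qr : q <> r by case; lia.
have qs : q <> s by case; lia.
have [np nq nr ns] : [/\ mate d p <> p, mate d q <> q, mate d r <> r & mate d s <> s].
  by split; apply/eqP/mate_neq.
have mp := mateK d p; have mq := mateK d q; have mr := mateK d r; have ms := mateK d s.
have F (x y : vertex n) : x <> y -> ((x == y) = false) * ((y == x) = false).
  by move=> /eqP xy; rewrite [y == x]eq_sym !(negbTE xy).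
have H x y : x = mate d y -> lab d x = lab d y :> nat by move=> ->; rewrite lab_mate.
move: (H r p) (H r q) (H s p) (H s q) (H r s) (H s r) (H p q) (H q p) => H1 H2 H3 H4 H5 H6 H7 H8.
apply: okada_ext => v; have mv := mateK d v.
  rewrite !mate_gact /gmate !mate_gact /gmate -/p -/q -/r -/s.
  rewrite !(F _ _ pq, F _ _ rs, F _ _ pr, F _ _ ps, F _ _ qr, F _ _ qs).
  (* The coincidences between the four vertices and their mates are fixed beforehand, and
     [congruence] discards the incompatible ones. *)
  case: (eqVneq r (mate d p)) => [?|/eqP ?]; case: (eqVneq r (mate d q)) => [?|/eqP ?];
  case: (eqVneq s (mate d p)) => [?|/eqP ?]; case: (eqVneq s (mate d q)) => [?|/eqP ?];
  case: (eqVneq p (mate d r)) => [?|/eqP ?]; case: (eqVneq p (mate d s)) => [?|/eqP ?];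
  case: (eqVneq q (mate d r)) => [?|/eqP ?]; case: (eqVneq q (mate d s)) => [?|/eqP ?];
  try (exfalso; congruence);
  by repeat (case: eqP => ? //; try (exfalso; congruence)); congruence.
move: (H v p) (H v q) (H v r) (H v s) => H9 H10 H11 H12.
rewrite !lab_gact /glab !mate_gact !lab_gact /gmate /glab -/p -/q -/r -/s.
rewrite !(F _ _ pq, F _ _ rs, F _ _ pr, F _ _ ps, F _ _ qr, F _ _ qs).
case: (eqVneq r (mate d p)) => [?|/eqP ?]; case: (eqVneq r (mate d q)) => [?|/eqP ?];
case: (eqVneq s (mate d p)) => [?|/eqP ?]; case: (eqVneq s (mate d q)) => [?|/eqP ?];
case: (eqVneq p (mate d r)) => [?|/eqP ?]; case: (eqVneq p (mate d s)) => [?|/eqP ?];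
case: (eqVneq q (mate d r)) => [?|/eqP ?]; case: (eqVneq q (mate d s)) => [?|/eqP ?];
  try (exfalso; congruence); rewrite /=;
  repeat (case: (v =P _) => ? //=; try (exfalso; congruence));
  repeat match goal with
  | [K : ?A -> nat_of_ord _ = nat_of_ord _, E : ?A |- _] => specialize (K E)
  end; clear ij; lia.
Qed.

End Relations.

(** * Propagating labels *)

Section PropagatingLabels.
Variable n : nat.
Implicit Types (d e : okada n) (i : 'I_n.-1) (j : 'I_n).

(** Propagating arcs are indexed by their right ends, which left multiplication by a generator keeps
    in place. Labels are positive, so weight 0 marks exactly the vertices without a propagating arc,
    and the weights determine PLab. *)
Definition prop_weight d j : nat :=
  if is_right (mate d (inr j)) then 0%N else lab d (inr j).

Lemma PLabE d :
  PLab d = [set lab d (inr j) | j : 'I_n & ~~ is_right (mate d (inr j))].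
Proof.
apply/setP => l; apply/imsetP/imsetP => -[j]; rewrite inE => hj ->.
  case E: (mate d (inl j)) hj => [k|k] // _; exists k; first by rewrite inE -E mateK.
  by rewrite -E lab_mate.
case E: (mate d (inr j)) hj => [k|k] // _; exists k; first by rewrite inE -E mateK.
by rewrite -E lab_mate.
Qed.

Lemma PLab_mirror d : PLab (mirror d) = PLab d.
Proof.
rewrite PLabE /PLab; apply/setP => l; apply/imsetP/imsetP => -[j]; rewrite inE => hj ->;
  exists j; rewrite ?inE ?lab_mirror //; move: hj; rewrite mate_mirror /=.
  by case: (mate d _).
by case: (mate d _).
Qed.

Lemma PLab_weight d e : prop_weight d =1 prop_weight e -> PLab d = PLab e.
Proof.
move=> w; have S (a b : okada n) : prop_weight a =1 prop_weight b -> PLab a \subset PLab b.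
  move=> ab; rewrite !PLabE; apply/subsetP => l /imsetP[j]; rewrite inE => hj ->.
  have := ab j; rewrite /prop_weight (negbTE hj); have := lab_gt0 a (inr j).
  case: ifP => [_ + e0|/negbT hb]; first by rewrite e0.
  by move=> _ /val_inj ->; apply: imset_f; rewrite inE.
by apply/eqP; rewrite eqEsubset !S.
Qed.

Definition total_weight d := (\sum_j prop_weight d j)%N.

Lemma prop_weight_gact i d j : (prop_weight (gact i d) j <= prop_weight d j)%N.
Proof.
rewrite /prop_weight mate_gact lab_gact.
case: (gclassP i d (inr j)) => // [->|->] _ _ _.
  by rewrite mateK lab_mate /=; case: ifP => // _; rewrite geq_minl.
by rewrite mateK lab_mate /=; case: ifP => // _; rewrite geq_minr.
Qed.

Lemma total_weight_gact i d : (total_weight (gact i d) <= total_weight d)%N.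
Proof. by apply: leq_sum => j _; apply: prop_weight_gact. Qed.

Lemma PLab_gact i d : total_weight (gact i d) = total_weight d ->
  PLab (gact i d) = PLab d.
Proof.
move=> /eqP; rewrite /total_weight (eq_bigr (fun j => prop_weight (gact i d) j)) //.
have := leqif_sum (fun j (_ : xpredT j) => leqif_eq (prop_weight_gact i d j)).
move=> [_ ->] /forallP h; apply: PLab_weight => j; exact/eqP/h.
Qed.

(* Letters out of range act as zero, as in the algebra; with the identity the
   braid relation would fail at the boundary. *)
Definition dact (j : nat) (v : option (okada n)) : option (okada n) :=
  if insub j is Some i then omap (gact i) v else None.

Lemma dact_sound (R : comNzRingType) (x y : nat -> R) s c t (v : option (okada n)) :
  wred x y s c t -> foldr dact v s = foldr dact v t.
Proof.
have dE k : (forall o, dact k o = None) \/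
    exists2 i : 'I_n.-1, val i = k & forall o, dact k o = omap (gact i) o.
  by rewrite /dact; case: insubP => [i _ iE|_]; [right; exists i | left].
apply: (@wred_sound R x y _ (fun _ o => o)) => //.
- move=> k o; case: (dE k) => [e|[i _ e]]; rewrite !e //.
  by case: o => //= d; rewrite gact_sq.
- move=> k k' o kk'; case: (dE k) => [e|[i iE e]]; case: (dE k') => [f|[l lE f]]; rewrite ?e ?f ?e ?f //.
  by case: o => //= d; rewrite gact_comm // iE lE.
move=> k o; case: (dE k.+1) => [e|[i iE e]]; first by rewrite !e.
have kn : (k < n.-1)%N by have := ltn_ord i; rewrite -[nat_of_ord i]/(val i) iE; lia.
case: (dE k) => [f|[l lE f]].
  by have := f (Some (id_diag n)); rewrite /dact insubT.
by rewrite !e !f; case: o => //= d; rewrite gact_braid // -[nat_of_ord i]/(val i) iE -lE.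
Qed.

(* The diagram of [rep_path w] pairs the vertices of each digit 2, and its
   propagating arcs are straight. *)
Fixpoint rep_path (w : seq bool) : ypath :=
  match w with
  | [::] => [::]
  | false :: w' => None :: rep_path w'
  | true :: w' => Some (srank w') :: rep_path w'
  end.

Lemma rep_path_shape w : yshape (rep_path w) = w.
Proof. by elim: w => [|[] w IH] //=; rewrite -/(yshape _) IH. Qed.

Lemma rep_path_valid w : pvalid (rep_path w).
Proof. by elim: w => [|[] w IH] //=; rewrite IH /prank rep_path_shape leqnn. Qed.

(** The heights of the digits 1, counted from the end of the word. They are the labels of the
    propagating arcs of the diagram of [rep_path w], and they recover w once its rank is known. *)
Fixpoint single_at (w : seq bool) (l : nat) : bool :=
  match w with
  | [::] => false
  | true :: w' => single_at w' l
  | false :: w' => (l == (srank w').+1) || single_at w' l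
  end.

Lemma single_at_le w l : single_at w l -> (l <= srank w)%N.
Proof. by elim: w => [|[] w IH] //=; [move/IH | case/orP=> [/eqP|/IH]]; lia. Qed.

Lemma single_at_gt0 w l : single_at w l -> (0 < l)%N.
Proof. by elim: w => [|[] w IH] //= /orP[/eqP ->|/IH]. Qed.

Lemma single_at_inj w u : srank w = srank u -> single_at w =1 single_at u -> w = u.
Proof.
elim: w u => [|b w IH] [|c u] //=; try by rewrite addSn.
have top (a : seq bool) l : (srank a < l)%N -> single_at a l = false.
  by move=> h; apply/negP => /single_at_le; lia.
case: b c => [] [] /= [rk] h.
- by congr cons; apply: IH; [lia|].
- by have := h (srank u).+1; rewrite eqxx /= top //; lia.
- by have := h (srank w).+1; rewrite eqxx /= top //; lia.
have {}rk : srank w = srank u by lia.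
congr cons; apply: IH => // l; have := h l; rewrite rk.
by case: eqP => [->|//]; rewrite !top ?rk.
Qed.

Lemma rep_diag w : (srank w <= n)%N -> exists2 d,
  foldr dact (Some (id_diag n)) (cword (rep_path w) (rep_path w)) = Some d &
  forall j, if (srank w <= j)%N || single_at w j.+1
    then mate d (inr j) = inl j /\ lab d (inr j) = j.+1 :> nat
    else is_right (mate d (inr j)).
Proof.
elim: w => [|[] w IH] /= wn.
- exists (id_diag n) => // j; split; first by rewrite /mate ffunE.
  by rewrite /lab ffunE inordK //= ltnS.
- have [|d dE dP] := IH; first by lia.
  have iN : (srank w < n.-1)%N by lia.
  pose i : 'I_n.-1 := Ordinal iN.
  exists (gact i d).
    rewrite /prank rep_path_shape subnn /= cats0.
    by rewrite subSn // subnn /= dE /dact insubT /= ; congr (Some (gact _ _)); apply: val_inj.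
  have mlo : mate d (lo i) = inr (gen_lo i).
    have := dP (gen_lo i); rewrite /= leqnn /= => -[h _].
    by rewrite /lo -h mateK.
  have mhi : mate d (hi i) = inr (gen_hi i).
    have := dP (gen_hi i); rewrite /= leqnSn /= => -[h _].
    by rewrite /hi -h mateK.
  move=> j; rewrite mate_gact lab_gact.
  case: (gclassP i d (inr j)) => //.
  + rewrite mlo mhi => -[->] _ _ _ /=.
    case: ifP => // /orP[h|/single_at_le h]; lia.
  + rewrite mlo mhi => -[->] _ _ _ /=.
    case: ifP => // /orP[h|/single_at_le h]; lia.
  rewrite mlo mhi => _ _ h1 h2 _ _ _ _; have := dP j.
  have -> : (srank w <= j)%N = (2 + srank w <= j)%N; last by [].
  have n1 : nat_of_ord j <> srank w by move=> e; apply: h1; congr inr; apply: val_inj.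
  have n2 : nat_of_ord j <> (srank w).+1 by move=> e; apply: h2; congr inr; apply: val_inj.
  by lia.
have [|d dE dP] := IH; first by lia.
exists d => // j; have := dP j; rewrite orbA.
suff -> : (false.+1 + srank w <= j)%N || (j.+1 == (srank w).+1) = (srank w <= j)%N by [].
by lia.
Qed.

Lemma PLab_rep w u d e : srank w = n -> srank u = n ->
  foldr dact (Some (id_diag n)) (cword (rep_path w) (rep_path w)) = Some d ->
  foldr dact (Some (id_diag n)) (cword (rep_path u) (rep_path u)) = Some e ->
  PLab d = PLab e -> w = u.
Proof.
have memP v a : srank v = n ->
    foldr dact (Some (id_diag n)) (cword (rep_path v) (rep_path v)) = Some a ->
    forall j, (inord j.+1 \in PLab a) = single_at v j.+1.
  move=> vn aE; have [|b bE bP] := @rep_diag v; first by rewrite vn.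
  move: bE; rewrite aE => -[ba] j; rewrite -{b}ba in bP.
  have jn : (j.+1 < n.+1)%N by have := ltn_ord j; lia.
  rewrite PLabE; apply/imsetP/idP => [[k]|sj].
    rewrite inE => hk /(congr1 val) /=; rewrite inordK //.
    have := bP k; case: ifP => [h [_ ->] [->]|_ h]; last by rewrite h in hk.
    by move: h; rewrite vn leqNgt ltn_ord.
  have := bP j; rewrite sj orbT => -[m1 l1]; exists j; first by rewrite inE m1.
  by apply: val_inj; rewrite /= inordK // l1.
move=> wn un dE eE PE; apply: single_at_inj; rewrite ?wn ?un // => -[|l].
  by apply/idP/idP => /single_at_gt0.
case: (ltnP l n) => ln.
  by have := memP w d wn dE (Ordinal ln); rewrite PE (memP u e un eE) /= => ->.
by apply/idP/idP => /single_at_le; rewrite ?wn ?un ltnNge ln.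
Qed.

End PropagatingLabels.

(** * Split semisimple algebras *)

Section Wedderburn.
Variables (K : fieldType) (A : algType K) (r : nat) (d : 'I_r -> nat).
Variable f : forall i, {lrmorphism A -> 'M[K]_((d i).+1)}.
Hypothesis f_surj : forall X : forall i, 'M[K]_((d i).+1), exists a, forall i, f i a = X i.
Hypothesis f_inj : forall a, (forall i, f i a = 0) -> a = 0.

Let idx := {i : 'I_r & 'I_((d i).+1)}.
Let ix i (k : 'I_((d i).+1)) : idx := Tagged (fun i => 'I_((d i).+1)) k.

Lemma ix_eq i (k l : 'I_((d i).+1)) : (ix k == ix l) = (k == l).
Proof. by rewrite -tag_eqE /tag_eq eqxx /= tagged_asE. Qed.

Lemma ix_neq i j (k : 'I_((d i).+1)) (l : 'I_((d j).+1)) : i != j -> (ix k == ix l) = false.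
Proof. by move=> ij; rewrite -tag_eqE /tag_eq /= (negbTE ij). Qed.

Lemma eq_in_blocks a b : (forall i, f i a = f i b) -> a = b.
Proof. by move=> e; apply/eqP; rewrite -subr_eq0; apply/eqP/f_inj => i; rewrite raddfB /= e subrr. Qed.

Lemma matrix_units : exists u : forall i, 'I_((d i).+1) -> 'I_((d i).+1) -> A,
  forall i k l j x y, f j (u i k l) x y = ((ix x == ix k) && (ix y == ix l))%:R.
Proof.
pose P i (k l : 'I_((d i).+1)) (a : A) := forall j x y,
  f j a x y = ((ix x == ix k) && (ix y == ix l))%:R.
have H i k l : exists a, P i k l a.
  have [a aE] := f_surj (fun j => \matrix_(x, y) ((ix x == ix k) && (ix y == ix l))%:R).
  by exists a => j x y; rewrite aE mxE.
have H1 i k : exists uk : 'I_((d i).+1) -> A, forall l, P i k l (uk l).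
  exact: fin_all_exists (H i k).
have H2 i : exists ui : 'I_((d i).+1) -> 'I_((d i).+1) -> A, forall k l, P i k l (ui k l).
  exact: fin_all_exists (H1 i).
have [u uP] := fin_all_exists H2; by exists u.
Qed.

Definition col_act i (a : A) (v : 'cV[K]_((d i).+1)) := f i a *m v.

Lemma col_act_axioms i : module_axioms (@col_act i).
Proof.
split=> [a b v|v|a v w|v a b]; rewrite /col_act.
- by rewrite rmorphM /= -mulmxA.
- by rewrite rmorph1 mul1mx.
- by rewrite mulmxDr.
by rewrite raddfD mulmxDl.
Qed.

Definition col_module i : lmodType A := module_of (col_act_axioms i).

Lemma col_scaleE i a (v : 'cV[K]_((d i).+1)) : a *: (v : col_module i) = f i a *m v :> 'cV[K]_((d i).+1).
Proof. by []. Qed.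

Lemma col_irreducible i : irreducible_module (col_module i).
Proof.
split.
  exists (const_mx 1 : 'cV[K]_((d i).+1)); move/matrixP/(_ ord0 ord0); rewrite !mxE.
  by move/eqP; rewrite oner_eq0.
move=> P P0 Plin; case: (Classical_Prop.classic (exists v, P v /\ v <> 0)) => [[v [Pv v0]]|h]; last first.
  by left=> v Pv; apply: Classical_Prop.NNPP => v0; apply: h; exists v.
right=> w; have [k vk] : exists k, (v : 'cV[K]_((d i).+1)) k 0 != 0.
  apply/existsP; apply: contraPT v0 => /existsPn h; apply.
  by apply/matrixP => k l; rewrite ord1 mxE; apply/eqP; rewrite -[_ == _]negbK h.
have [u uE] := matrix_units.
pose a : A := \sum_l ((w : 'cV[K]_((d i).+1)) l 0 / (v : 'cV[K]_((d i).+1)) k 0) *: u i l k.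
have -> : w = a *: v + 0; last exact: Plin.
rewrite addr0; apply/matrixP => x y; rewrite ord1 [RHS]mxE (bigD1 k) //= big1 => [|z zk].
  rewrite addr0 raddf_sum summxE (bigD1 x) //= big1 => [|z zx].
    by rewrite /= linearZ /= mxE uE !eqxx /= mulr1 addr0 divfK.
  by rewrite /= linearZ /= mxE uE ix_eq eq_sym (negbTE zx) mulr0.
rewrite raddf_sum summxE big1 ?mul0r // => t _.
by rewrite /= linearZ /= mxE uE !ix_eq (negbTE zk) andbF mulr0.
Qed.

Lemma col_noniso i j : isomorphic_modules (col_module i) (col_module j) -> i = j.
Proof.
case=> g /bij_inj g_inj; apply/eqP; apply: contraT => ij; exfalso.
have [u uE] := matrix_units; pose a : A := \sum_k u i k k.
have ai : f i a = 1%:M.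
  apply/matrixP => x y; rewrite raddf_sum summxE mxE (bigD1 y) //= big1 ?addr0.
    by rewrite uE !ix_eq eqxx andbT.
  by move=> z zy; rewrite uE !ix_eq [y == z]eq_sym (negbTE zy) andbF.
have aj : f j a = 0.
  apply/matrixP => x y; rewrite raddf_sum summxE mxE big1 // => k _.
  by rewrite uE ix_neq // eq_sym.
have [v v0] := (col_irreducible i).1; apply: v0; apply: g_inj; rewrite raddf0.
have vE : a *: v = v by rewrite [LHS]col_scaleE ai mul1mx.
by rewrite -vE linearZ_LR [LHS]col_scaleE aj mul0mx.
Qed.

(** Some diagonal unit u_kk of a block i does not kill [v0]. With w = u_kk v0, a column with entries
    c_l is sent to the sum of the c_l u_lk w; this map is nonzero, and irreducibility on both sides
    makes it bijective. *)
Lemma irreducible_col (V : lmodType A) : irreducible_module V ->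
  exists i, isomorphic_modules V (col_module i).
Proof.
move=> [[v0 v0_neq0] Virr]; have [u uE] := matrix_units.
have one : 1 = \sum_i \sum_k u i k k :> A.
  apply: eq_in_blocks => j; rewrite rmorph1 raddf_sum (bigD1 j) //= [X in _ + X]big1 ?addr0.
    apply/matrixP => x y; rewrite raddf_sum summxE mxE (bigD1 y) //= big1 ?addr0.
      by rewrite uE !ix_eq eqxx andbT.
    by move=> z zy; rewrite uE !ix_eq [y == z]eq_sym (negbTE zy) andbF.
  move=> i ij; apply/matrixP => x y; rewrite raddf_sum summxE mxE big1 // => k _.
  by rewrite uE ix_neq // eq_sym.
have [i [k wk]] : exists i k, u i k k *: v0 != 0.
  apply: Classical_Prop.NNPP => h; apply: v0_neq0.
  rewrite -[v0]scale1r one scaler_suml big1 // => i _; rewrite scaler_suml big1 // => k _.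
  by apply/eqP; apply: contraT => h'; case: h; exists i, k.
have mul_u a l : a * u i l k = \sum_m (f i a) m l *: u i m k.
  apply: eq_in_blocks => j; rewrite rmorphM raddf_sum; apply/matrixP => x y.
  rewrite summxE [LHS]mxE.
  have [ji|ij] := eqVneq j i.
    subst j; rewrite (bigD1 l) //= [in LHS]big1 ?addr0 => [|z zl]; last first.
      by rewrite uE ix_eq (negbTE zl) mulr0.
    rewrite (bigD1 x) //= [in RHS]big1 ?addr0 => [|z zx]; last first.
      by rewrite /= linearZ /= mxE uE ix_eq eq_sym (negbTE zx) mulr0.
    by rewrite /= linearZ /= mxE !uE !eqxx.
  rewrite !big1 // => z _; last by rewrite uE ix_neq ?mulr0.
  by rewrite /= linearZ /= mxE uE ix_neq ?mulr0.
have [w wE] : exists w, w = u i k k *: v0 by eexists.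
rewrite -wE in wk.
pose g (v : col_module i) : V := (\sum_l ((v : 'cV[K]_((d i).+1)) l 0) *: u i l k) *: w.
have g_lin : linear g.
  move=> a v1 v2; rewrite /g scalerA -scalerDl; congr (_ *: _).
  rewrite mulr_sumr; under [in RHS]eq_bigr do rewrite -scalerAr mul_u scaler_sumr.
  rewrite exchange_big /= -big_split /=; apply: eq_bigr => m _.
  under [in RHS]eq_bigr do rewrite scalerA.
  rewrite -scaler_suml -scalerDl; congr (_ *: _).
  by rewrite mxE [X in X + _]mxE; congr (_ + _); apply: eq_bigr => z _; rewrite mulrC.
pose gM := GRing.isLinear.Build _ _ _ _ g g_lin.
pose gL : {linear col_module i -> V} := HB.pack g gM.
have gk : g (delta_mx k 0 : 'cV[K]_((d i).+1)) = w.
  rewrite /g (bigD1 k) //= big1 ?addr0 => [|z zk]; last by rewrite mxE (negbTE zk) scale0r.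
  rewrite mxE !eqxx scale1r wE scalerA; congr (_ *: _).
  rewrite mul_u (bigD1 k) //= uE !eqxx scale1r big1 ?addr0 // => z zk.
  by rewrite uE ix_eq (negbTE zk) scale0r.
have g0 : forall v, gL v = 0 -> v = 0.
  have [] // := (col_irreducible i).2 (fun v => gL v = 0).
  - exact: raddf0.
  - by move=> a v1 v2 e1 e2; rewrite linearP e1 e2 scaler0 addr0.
  by move/(_ (delta_mx k 0 : 'cV[K]_((d i).+1))); rewrite [LHS]gk => e; rewrite e eqxx in wk.
have g_inj : injective gL.
  by move=> v1 v2 e; apply/eqP; rewrite -subr_eq0; apply/eqP/g0; rewrite raddfB /= [X in X - _]e subrr.
(* The boolean equality allows [xchoose] to produce the inverse map. *)
have g_surj : forall v, exists s, gL s == v.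
  have [] // := Virr (fun v => exists s, gL s == v).
  - by exists 0; rewrite raddf0.
  - by move=> a v1 v2 [s1 /eqP <-] [s2 /eqP <-]; exists (a *: s1 + s2); rewrite linearP.
  move=> H; have := H w; rewrite /= => e; case/eqP: wk; apply: e.
  by exists (delta_mx k 0 : 'cV[K]_((d i).+1)); apply/eqP/gk.
exists i; pose h v := xchoose (g_surj v).
have hK : cancel h gL by move=> v; apply/eqP/(xchooseP (g_surj v)).
have gK : cancel gL h by move=> s; apply: g_inj; rewrite hK.
have h_lin : linear h by move=> a v1 v2; apply: g_inj; rewrite hK linearP !hK.
pose hM := GRing.isLinear.Build _ _ _ _ h h_lin.
by exists (HB.pack h hM : {linear V -> col_module i}); exists gL.
Qed.

Variables (I : finType) (z : I -> {i : 'I_r & 'I_((d i).+1)}).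
Variable t_of : {i : 'I_r & 'I_((d i).+1)} -> I.
Hypothesis zK : cancel z t_of.
Hypothesis t_ofK : cancel t_of z.

Local Notation M := ({ffun I -> K^o} : lmodType K).

(** [z] and [t_of] identify I with the disjoint union of the column indices of all blocks, so that
    this is the projection of M onto its i-th column module. *)
Definition block i (m : M) : 'cV[K]_((d i).+1) := \col_k m (t_of (ix k)).

Definition block_act (a : A) (m : M) : M :=
  [ffun t => (f (tag (z t)) a *m block (tag (z t)) m) (tagged (z t)) 0].

Lemma block_actE i a m : block i (block_act a m) = f i a *m block i m.
Proof. by apply/matrixP => k l; rewrite ord1 mxE ffunE t_ofK. Qed.

Lemma block_ext m1 m2 : (forall i, block i m1 = block i m2) -> m1 = m2.
Proof.
move=> e; apply/ffunP => t; have := e (tag (z t)).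
move/matrixP/(_ (tagged (z t)) 0); rewrite !mxE.
have -> : ix (tagged (z t)) = z t by rewrite /ix; case: (z t).
by rewrite zK.
Qed.

Lemma block_linear i : linear (block i).
Proof. by move=> c m1 m2; apply/matrixP => k l; rewrite /block !mxE !ffunE. Qed.

HB.instance Definition _ i := GRing.isLinear.Build _ _ _ _ (block i) (block_linear i).

Lemma block_act_linearr a : linear (block_act a).
Proof.
move=> c m1 m2; apply: block_ext => i; rewrite linearP /= !block_actE linearP /= mulmxDr.
by rewrite -scalemxAr.
Qed.

Lemma block_act_linearl m : linear (block_act^~ m).
Proof.
move=> c a1 a2; apply: block_ext => i; rewrite linearP /= !block_actE linearP /= mulmxDl.
by rewrite -scalemxAl.
Qed.

Lemma block_act_axioms : module_axioms block_act.
Proof.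
split=> [a b v|v|a v w|v a b]; apply: block_ext => i.
- by rewrite !block_actE rmorphM /= -mulmxA.
- by rewrite block_actE rmorph1 mul1mx.
- by rewrite raddfD /= !block_actE raddfD /= mulmxDr.
by rewrite raddfD /= !block_actE raddfD /= mulmxDl.
Qed.

Lemma block_act_gelfand : gelfand_model (module_of block_act_axioms : lmodType A).
Proof.
split; first by exists r, d, f.
pose g i (v : col_module i) : module_of block_act_axioms :=
  [ffun t => \sum_k (t == t_of (ix k))%:R * (v : 'cV[K]_((d i).+1)) k 0] : M.
have t_of_inj := can_inj t_ofK.
have gii i v : block i (g i v : M) = v.
  apply/matrixP => k l; rewrite ord1 mxE ffunE (bigD1 k) //= eqxx mul1r big1 ?addr0 // => m mk.
  by rewrite (inj_eq t_of_inj) ix_eq eq_sym (negbTE mk) mul0r.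
have gij i j v : i != j -> block j (g i v : M) = 0.
  move=> ij; apply/matrixP => k l; rewrite !mxE ffunE big1 // => m _.
  by rewrite (inj_eq t_of_inj) ix_neq 1?eq_sym // mul0r.
have g_lin i : linear (g i).
  move=> a v1 v2; apply: block_ext => j.
  rewrite [RHS](raddfD (block j)) /= [X in _ = X + _]block_actE.
  case: (eqVneq i j) => [<-|ij]; first by rewrite !gii.
  by rewrite !gij // mulmx0 addr0.
pose gM i := GRing.isLinear.Build _ _ _ _ (g i) (g_lin i).
pose gL i : {linear col_module i -> module_of block_act_axioms} := HB.pack (g i) (gM i).
exists r, col_module, gL.
have block_sum j (v : forall i, col_module i) : block j (\sum_i gL i (v i) : M) = v j.
  rewrite raddf_sum (bigD1 j) //= gii big1 ?addr0 // => i ij; exact: gij.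
split.
- exact: col_irreducible.
- exact: col_noniso.
- exact: irreducible_col.
- move=> m; exists (fun i => block i (m : M)); apply: block_ext => i.
  by rewrite [RHS]block_sum.
by move=> v e i; rewrite -(block_sum i v) [X in block i X]e raddf0.
Qed.

End Wedderburn.

(** * The cellular basis of the Okada algebra *)

Section WordValue.
Variables (K : fieldType) (n : nat) (A : algType K) (F : 'I_n.-1 -> A).

Definition letter_elt (j : nat) : A := if insub j is Some i then F i else 0.

Definition word_value (s : seq nat) : A := \prod_(j <- s) letter_elt j.

Lemma word_value_nil : word_value [::] = 1.
Proof. exact: big_nil. Qed.

Lemma word_value_cons j s : word_value (j :: s) = letter_elt j * word_value s.
Proof. exact: big_cons. Qed.

Lemma word_value_cat s t : word_value (s ++ t) = word_value s * word_value t.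
Proof. exact: big_cat. Qed.

Lemma letter_elt_val (i : 'I_n.-1) : letter_elt (val i) = F i.
Proof. by rewrite /letter_elt valK. Qed.

Lemma word_elt_word_value (w : seq 'I_n.-1) : word_elt F w = word_value (map val w).
Proof. by rewrite /word_value big_map; apply: eq_bigr => i _; rewrite letter_elt_val. Qed.

Lemma word_value_sound (x y : nat -> K) s c t : okada_relations x y F ->
  wred x y s c t -> word_value s = c *: word_value t.
Proof.
move=> [r_sq r_comm r_braid] st.
have E u : word_value u = foldr (fun j v => letter_elt j * v) 1 u.
  by elim: u => [|j u IH]; rewrite ?word_value_nil ?word_value_cons ?IH.
rewrite !E; apply: (@wred_sound K x y A (fun c v => c *: v)
  (fun j v => letter_elt j * v) _ _ _ _ _ _ s c t 1 st) => /=.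
- by move=> v; rewrite scale1r.
- by move=> a b v; rewrite scalerA.
- by move=> j a v; rewrite scalerAr.
- move=> j v; rewrite mulrA scalerAl; congr (_ * v); rewrite /letter_elt.
  by case: insubP => [i _ <-|_]; rewrite ?r_sq // mul0r scaler0.
- move=> i j v ij; rewrite !mulrA; congr (_ * v); rewrite /letter_elt.
  case: insubP => [k _ kE|_]; last by rewrite mul0r mulr0.
  case: insubP => [l _ lE|_]; last by rewrite mul0r mulr0.
  by apply: r_comm; rewrite -[nat_of_ord k]/(val k) -[nat_of_ord l]/(val l) kE lE.
move=> i v; rewrite !mulrA scalerAl; congr (_ * v); rewrite /letter_elt.
case: insubP => [k kn kE|_]; last by rewrite mulr0 scaler0.
have il : (i < n.-1)%N by lia.
rewrite insubT; rewrite r_braid //.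
Qed.

End WordValue.

Lemma word_value_morph (K : fieldType) n (A A' : algType K) (f : {lrmorphism A -> A'})
    (F : 'I_n.-1 -> A) s :
  f (word_value F s) = word_value (fun i => f (F i)) s.
Proof.
elim: s => [|j s IH]; first by rewrite !word_value_nil rmorph1.
rewrite !word_value_cons rmorphM /= IH; congr (_ * _).
by rewrite /letter_elt; case: insub => // ; rewrite rmorph0.
Qed.

Lemma word_value_eq (K : fieldType) n (A : algType K) (F G : 'I_n.-1 -> A) s :
  F =1 G -> word_value F s = word_value G s.
Proof.
move=> e; apply: eq_bigr => j _; rewrite /letter_elt.
by case: insub.
Qed.

Lemma wred_neq0 (K : fieldType) (x y : nat -> K) s c t :
  (forall i, x i != 0) -> (forall i, y i != 0) -> wred x y s c t -> c != 0.
Proof.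
move=> x0 y0; elim=> {s c t} [s|s c t d u _ c0 _ d0|a b s c t _|i j _|i j _|i|i] //;
  rewrite ?oner_eq0 //.
exact: mulf_neq0.
Qed.

(** The rows h form a left inverse of a square matrix, which is then also a right inverse. *)
Lemma list_right_inverse (K : fieldType) (T : eqType) (L : seq T) (g : T -> T -> K) :
  uniq L ->
  {in L, forall a, exists h : T -> K,
     {in L, forall b, \sum_(c <- L) h c * g c b = (a == b)%:R}} ->
  exists V : T -> T -> K,
    {in L &, forall a b, \sum_(c <- L) g a c * V c b = (a == b)%:R}.
Proof.
move=> uL H; case: L uL H => [|t0 L0] uL H; first by exists (fun _ _ => 0) => a b.
set L := t0 :: L0 in uL H *.
have [u uE] := fin_all_exists (fun i : 'I_(size L) => H _ (mem_nth t0 (ltn_ord i))).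
pose e (t : T) : 'I_(size L) := insubd ord0 (index t L).
have eE p : p \in L -> nat_of_ord (e p) = index p L.
  by move=> pL; rewrite val_insubd index_mem pL.
pose U := \matrix_(i < size L, j < size L) u i (nth t0 L j).
pose G := \matrix_(i < size L, j < size L) g (nth t0 L i) (nth t0 L j).
have UG : U *m G = 1%:M.
  apply/matrixP => i j; rewrite !mxE; have := uE i (nth t0 L j) (mem_nth t0 (ltn_ord j)).
  rewrite nth_uniq // => <-; rewrite (big_nth t0) big_mkord.
  by apply: eq_bigr => k _; rewrite !mxE.
exists (fun c b => u (e c) b) => a b aL bL.
have := congr1 (fun B : 'M_(size L) => B (e a) (e b)) (mulmx1C UG).
rewrite !mxE -val_eqE /= !eE //.
have -> : (index a L == index b L) = (a == b).
  apply/eqP/eqP => [/(congr1 (nth t0 L))|->] //.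
  by rewrite !nth_index.
move=> <-; rewrite (big_nth t0) big_mkord; apply: eq_bigr => i _.
rewrite !mxE !eE // !nth_index //; congr (_ * u _ _).
by apply: val_inj; rewrite /= eE ?mem_nth // index_uniq.
Qed.

(** * Linear independence of the C(p, q) *)

Section Basis.
Variables (K : fieldType) (x y : nat -> K) (n : nat).
Hypothesis gram_invertible : forall w, exists h : ypath -> ypath -> K,
  {in pw (true :: w) &, forall a b,
     \sum_(c <- pw (true :: w)) h a c * gram x y w c b = (a == b)%:R}.

Local Notation wact := (wact x y).
Definition letters_lt := all (fun j => (j.+1 < n)%N).

Definition cells : seq (ypath * ypath) :=
  [seq (p, q) | p <- paths n, q <- pw (yshape p)].

Lemma mem_cells p q : ((p, q) \in cells) =
  [&& pvalid p, prank p == n, yshape q == yshape p & pvalid q].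
Proof.
apply/allpairsPdep/and4P => [[p' [q' [h1 h2 [-> ->]]]]|[vp rp sq vq]].
  by move: h1 h2; rewrite mem_paths mem_pw => /andP[-> ->] /andP[-> ->].
by exists p, q; rewrite mem_paths mem_pw vp rp sq vq.
Qed.

Lemma uniq_cells : uniq cells.
Proof.
apply: allpairs_uniq_dep => [|p _|]; rewrite ?uniq_paths ?uniq_pw //.
by move=> [p q] [p' q'] _ _ /= [-> ->].
Qed.

Definition cword2 (t : ypath * ypath) := cword t.1 t.2.

(* The (s.1, s.2) matrix entry of C(t.1, t.2). *)
Definition cell_entry (t s : ypath * ypath) : K := tcoef (wact (yshape s.2) (cword2 t) s.2) s.1.

Lemma one_path : let p := nseq n None in
  [/\ pvalid p, prank p = n & forall q, cword p q = [::]].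
Proof.
split.
- by elim: n.
- by rewrite /prank; elim: n => //= m ->.
by elim: n => [|m IH] [|[k|] q] //=.
Qed.

(** For the path 1...1 the word of C(p, p) is empty, so s is s times C(p, p), and [cell_stepsP]
    straightens it. *)
Lemma word_cell s : letters_lt s -> exists c t,
  t \in cells /\ wred x y s c (cword2 t).
Proof.
have [vp rp pE] := one_path; set p := nseq n None in vp rp pE * => hs.
have [c [p' [q' [[w sq vp' vq' r'] _]]]] := @cell_stepsP K x y n s p p rp erefl vp vp hs.
exists c, (p', q'); rewrite mem_cells vp' vq' sq r' rp !eqxx; split=> //.
by rewrite pE cats0 in w.
Qed.

Lemma letters_cword p q : (p, q) \in cells -> letters_lt (cword p q).
Proof.
rewrite mem_cells => /and4P[vp /eqP rp /eqP sq vq].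
by have := cword_bound vp vq sq; rewrite rp.
Qed.

(** This is the dimension count. The words that realise a matrix unit straighten to multiples of
    elements C(p, q), which gives a left inverse of [cell_entry]; its rows and columns are both
    indexed by [cells]. *)
Lemma cell_entry_inverse : exists V : ypath * ypath -> ypath * ypath -> K,
  {in cells &, forall a b, \sum_(c <- cells) cell_entry a c * V c b = (a == b)%:R}.
Proof.
apply: list_right_inverse uniq_cells _ => -[p q] pq.
have := pq; rewrite mem_cells => /and4P[vp /eqP rp /eqP sq vq].
have [a [ha aE]] := @word_span_units K x y gram_invertible n p q vp vq (esym sq) rp.
have [h hE] : exists h : ypath * ypath -> K, forall r' r, \sum_(t <- cells) h t * cell_entry t (r', r) = comb_coef x y a r r'.
  elim: a ha {aE} => [|[c s] a IH] /=.
    by exists (fun _ => 0) => r' r; rewrite /comb_coef big_nil big1 // => *; rewrite mul0r.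
  case/andP=> /word_cell[c' [t [tT st]]] /IH[h hE].
  exists (fun t' => c * c' * (t' == t)%:R + h t') => r' r.
  under eq_bigr do rewrite mulrDl; rewrite big_split /= hE /comb_coef big_cons; congr (_ + _).
  rewrite (bigD1_seq t) ?uniq_cells //= eqxx big1 => [|t' /negbTE ->]; last by rewrite mulr0 mul0r.
  by rewrite mulr1 addr0 /cell_entry (wred_wact _ _ st) tcoef_sc mulrA.
exists h => -[r' r]; rewrite mem_cells => /and4P[vr' /eqP rr' /eqP sr vr].
rewrite hE aE //; last by rewrite (prank_shape sr).
by rewrite xpair_eqE ![_ == q]eq_sym ![_ == p]eq_sym -natrM mulnb andbC.
Qed.

Lemma cell_entry_indep (c : ypath * ypath -> K) :
  {in cells, forall s, \sum_(t <- cells) c t * cell_entry t s = 0} ->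
  {in cells, forall t, c t = 0}.
Proof.
move=> H t tT; have [V VE] := cell_entry_inverse.
have -> : c t = \sum_(t' <- cells) c t' * (t' == t)%:R.
  rewrite (bigD1_seq t) ?uniq_cells //= eqxx mulr1 big1 ?addr0 // => t' /negbTE ->.
  by rewrite mulr0.
transitivity (\sum_(s <- cells) (\sum_(t' <- cells) c t' * cell_entry t' s) * V s t).
  under [RHS]eq_bigr do rewrite mulr_suml.
  rewrite exchange_big /= !big_seq; apply: eq_bigr => t' t'T.
  by rewrite -VE // mulr_sumr; apply: eq_bigr => s _; rewrite mulrA.
by rewrite big1_seq // => s /andP[_ sT]; rewrite H // mul0r.
Qed.

(** Matrix sizes are successors in [split_semisimple]. The list [pw w] contains [rep_path w], so
    nothing is lost by the predecessor. *)
Definition dw (w : seq bool) := (size (pw w)).-1.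

Lemma dwE w : (dw w).+1 = size (pw w).
Proof.
rewrite /dw prednK // -has_predT; apply/hasP; exists (rep_path w) => //.
by rewrite mem_pw rep_path_shape rep_path_valid eqxx.
Qed.

Definition pnth (w : seq bool) (i : 'I_(dw w).+1) : ypath := nth [::] (pw w) i.

Lemma mem_pnth w (i : 'I_(dw w).+1) : pnth i \in pw w.
Proof. by apply: mem_nth; rewrite -dwE. Qed.

Lemma pnth_inj w : injective (@pnth w).
Proof.
move=> i j /eqP; rewrite nth_uniq ?uniq_pw -?dwE // => /eqP e; exact: val_inj.
Qed.

Lemma pnth_surj w p : p \in pw w -> exists i : 'I_(dw w).+1, pnth i = p.
Proof.
move=> pL; have h : (index p (pw w) < (dw w).+1)%N by rewrite dwE index_mem.
by exists (Ordinal h); rewrite /pnth nth_index.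
Qed.

Lemma sum_pw w (G : ypath -> K) :
  \sum_(p <- pw w) G p = \sum_(i < (dw w).+1) G (pnth i).
Proof. by rewrite (big_nth [::]) -dwE big_mkord. Qed.

Definition mxw w s : 'M[K]_((dw w).+1) :=
  \matrix_(i, j) tcoef (wact w s (pnth j)) (pnth i).

Lemma mxw_cat w s t : all (fun j => j.+1 < srank w)%N t ->
  mxw w (s ++ t) = mxw w s *m mxw w t.
Proof.
move=> ht; apply/matrixP => i j; rewrite !mxE wact_cat.
have := mem_pnth j; rewrite mem_pw => /andP[/eqP sj vj].
rewrite (tcoef_lin _ _ (uniq_pw w)); last first.
  case E: (wact w t (pnth j)) => [[c q]|] //=.
  by have [sq vq] := wact_valid sj vj ht E; rewrite mem_pw sq vq eqxx.
by rewrite sum_pw; apply: eq_bigr => k _; rewrite !mxE mulrC.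
Qed.

Lemma mxw_nil w : mxw w [::] = 1%:M.
Proof.
apply/matrixP => i j; rewrite !mxE /= (inj_eq (@pnth_inj w)) eq_sym.
by case: eqP.
Qed.

Lemma mxw_wred w s c t : wred x y s c t -> mxw w s = c *: mxw w t.
Proof.
by move=> st; apply/matrixP => i j; rewrite !mxE (wred_wact _ _ st) tcoef_sc.
Qed.

Lemma mxw_relations w : srank w = n ->
  okada_relations x y (fun i : 'I_n.-1 => mxw w [:: val i]).
Proof.
move=> wn; have lt1 (i : 'I_n.-1) : all (fun j => j.+1 < srank w)%N [:: val i].
  by rewrite /= wn; have := ltn_ord i; lia.
have catE (i j : 'I_n.-1) : mxw w [:: val i] * mxw w [:: val j] = mxw w [:: val i; val j].
  by rewrite -mulmxE -mxw_cat.
split=> [i|i j ij|i j ij].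
- by rewrite catE; apply/mxw_wred/wred_sq.
- by rewrite !catE -[RHS]scale1r; apply/mxw_wred/wred_swapl.
rewrite catE -mulmxE -mxw_cat; last exact: lt1.
have jE : val j = i.+1 by [].
by rewrite /= jE; apply/mxw_wred/wred_braid.
Qed.

Lemma word_value_mxw w s : srank w = n -> letters_lt s ->
  word_value (fun i : 'I_n.-1 => mxw w [:: val i] : 'M[K]_((dw w).+1)) s = mxw w s.
Proof.
move=> wn; elim: s => [|j s IH] /=; first by rewrite word_value_nil mxw_nil.
case/andP=> jn sn; rewrite word_value_cons IH // -[j :: s]/([:: j] ++ s) mxw_cat ?wn //.
have h : (j < n.-1)%N by lia.
by rewrite /letter_elt insubT.
Qed.

End Basis.

(** * The presented algebra and its matrix blocks *)

Section OkadaAlgebra.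
Variables (K : fieldType) (x y : nat -> K) (n : nat) (O : algType K).
Variable E : 'I_n.-1 -> O.
Hypothesis presO : is_okada_algebra x y E.
Hypothesis x_neq0 : forall i, x i != 0.
Hypothesis y_neq0 : forall i, y i != 0.
Hypothesis gram_invertible : forall w, exists h : ypath -> ypath -> K,
  {in pw (true :: w) &, forall a b,
     \sum_(c <- pw (true :: w)) h a c * gram x y w c b = (a == b)%:R}.

Local Notation wact := (wact x y).
Local Notation cell_entry := (cell_entry x y).
Local Notation cells := (cells n).
Local Notation letters_lt := (letters_lt n).

Definition shape_at (i : 'I_(size (shapes n))) := nth [::] (shapes n) i.
Local Notation blk i := (dw (shape_at i)).

Lemma srank_shape_at i : srank (shape_at i) = n.
Proof. by apply/eqP; rewrite -mem_shapes mem_nth. Qed.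

Lemma shape_at_inj : injective shape_at.
Proof.
move=> i j /eqP; rewrite nth_uniq ?uniq_shapes // => /eqP e; exact: val_inj.
Qed.

Lemma shape_at_surj w : srank w = n -> exists i, shape_at i = w.
Proof.
move=> wn; have h : (index w (shapes n) < size (shapes n))%N.
  by rewrite index_mem mem_shapes wn.
by exists (Ordinal h); rewrite /shape_at nth_index // mem_shapes wn.
Qed.

Lemma representations :
  exists f : forall i, {lrmorphism O -> 'M[K]_((blk i).+1)},
  forall i s, letters_lt s -> f i (word_value E s) = mxw x y (shape_at i) s.
Proof.
have H i : exists f : {lrmorphism O -> 'M[K]_((blk i).+1)},
    forall s, letters_lt s -> f (word_value E s) = mxw x y (shape_at i) s.
  have [_ _ univ] := presO.
  have [f fE] := univ _ _ (mxw_relations x y (srank_shape_at i)).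
  exists f => s hs; rewrite word_value_morph (word_value_eq _ fE).
  exact: word_value_mxw (srank_shape_at i) hs.
exact: fin_all_exists H.
Qed.

Definition cell_elt t : O := word_value E (cword2 t).

Lemma word_value_letters (w : seq 'I_n.-1) : letters_lt (map val w).
Proof. by rewrite /letters_lt all_map; apply/allP => i _ /=; have := ltn_ord i; lia. Qed.

Lemma word_value_span s : letters_lt s -> exists c t,
  [/\ t \in cells, wred x y s c (cword2 t) & word_value E s = c *: cell_elt t].
Proof.
move=> /(word_cell x y)[c [t [tT st]]]; exists c, t; split=> //.
by have [rel _ _] := presO; apply: word_value_sound rel st.
Qed.

Lemma cell_span a : exists c : ypath * ypath -> K, a = \sum_(t <- cells) c t *: cell_elt t.
Proof.
have [_ /(_ a)[s ->] _] := presO.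
elim: s => [|[k w] s [c IH]].
  by exists (fun _ => 0); rewrite big_nil big1 // => t _; rewrite scale0r.
have [k' [t [tT _ wE]]] := word_value_span (word_value_letters w).
exists (fun t' => k * k' * (t' == t)%:R + c t').
rewrite big_cons IH; under [RHS]eq_bigr do rewrite scalerDl; rewrite big_split /=; congr (_ + _).
rewrite (bigD1_seq t) ?uniq_cells //= eqxx mulr1 [X in _ + X]big1 ?addr0 => [|t' /negbTE ->]; last first.
  by rewrite mulr0 scale0r.
by rewrite -scalerA -wE -word_elt_word_value.
Qed.

Section Blocks.
Variable f : forall i, {lrmorphism O -> 'M[K]_((blk i).+1)}.
Hypothesis fE : forall i s, letters_lt s -> f i (word_value E s) = mxw x y (shape_at i) s.

Lemma block_coordinates s : s \in cells ->
  exists i (k l : 'I_((blk i).+1)), pnth k = s.1 /\ pnth l = s.2.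
Proof.
case: s => p q; rewrite mem_cells => /and4P[vp /eqP rp /eqP sq vq].
have [i iE] : exists i, shape_at i = yshape p by apply: shape_at_surj.
have [|k kE] := @pnth_surj (shape_at i) p; first by rewrite mem_pw iE eqxx.
have [|l lE] := @pnth_surj (shape_at i) q; first by rewrite mem_pw iE sq eqxx.
by exists i, k, l.
Qed.

Lemma shape_pnth i (k : 'I_((blk i).+1)) : yshape (pnth k) = shape_at i.
Proof. by have := mem_pnth k; rewrite mem_pw => /andP[/eqP]. Qed.

Lemma valid_pnth i (k : 'I_((blk i).+1)) : pvalid (pnth k).
Proof. by have := mem_pnth k; rewrite mem_pw => /andP[]. Qed.

Lemma f_cell i k l t : t \in cells ->
  f i (cell_elt t) k l = cell_entry t (pnth k, pnth l).
Proof.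
case: t => p q /letters_cword h; rewrite /cell_elt fE // mxE.
by rewrite /cell_entry /= shape_pnth.
Qed.

Lemma f_comb i k l (c : ypath * ypath -> K) :
  f i (\sum_(t <- cells) c t *: cell_elt t) k l =
  \sum_(t <- cells) c t * cell_entry t (pnth k, pnth l).
Proof.
rewrite raddf_sum summxE !big_seq; apply: eq_bigr => t tT.
by rewrite /= linearZ /= mxE f_cell.
Qed.

Lemma f_inj_cells (c : ypath * ypath -> K) :
  (forall i, f i (\sum_(t <- cells) c t *: cell_elt t) = 0) ->
  {in cells, forall t, c t = 0}.
Proof.
move=> H; apply: (cell_entry_indep gram_invertible) => s sT.
have [i [k [l [kE lE]]]] := block_coordinates sT.
by have := f_comb k l c; rewrite H mxE kE lE -surjective_pairing => <-.
Qed.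

Lemma f_inj a : (forall i, f i a = 0) -> a = 0.
Proof.
have [c ->] := cell_span a => /f_inj_cells c0.
by rewrite big1_seq // => t /andP[_ tT]; rewrite c0 // scale0r.
Qed.

Lemma f_surj (X : forall i, 'M[K]_((blk i).+1)) : exists a, forall i, f i a = X i.
Proof.
have unit_ex i (k l : 'I_((blk i).+1)) : exists u, forall j (k' l' : 'I_((blk j).+1)),
    f j u k' l' = ((pnth k' == pnth k) && (pnth l' == pnth l))%:R.
  have rk : prank (pnth k) = n by rewrite /prank shape_pnth srank_shape_at.
  have skl : yshape (pnth k) = yshape (pnth l) by rewrite !shape_pnth.
  have [a [ha aE]] := word_span_units gram_invertible (valid_pnth k) (valid_pnth l) skl rk.
  exists (\sum_(cs <- a) cs.1 *: word_value E cs.2) => j k' l'.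
  have rl : prank (pnth l') = n by rewrite /prank shape_pnth srank_shape_at.
  rewrite andbC -mulnb natrM -(aE _ (valid_pnth l') rl).
  rewrite raddf_sum summxE /comb_coef !big_seq; apply: eq_bigr => cs csa.
  by rewrite /= linearZ /= fE ?mxE ?shape_pnth //; apply: (allP ha).
have [u uE] : exists u : forall i, 'I_((blk i).+1) -> 'I_((blk i).+1) -> O,
    forall i k l j (k' l' : 'I_((blk j).+1)),
    f j (u i k l) k' l' = ((pnth k' == pnth k) && (pnth l' == pnth l))%:R.
  have H1 i (k : 'I_((blk i).+1)) := fin_all_exists (unit_ex i k).
  have H2 i := fin_all_exists (H1 i).
  exact: fin_all_exists H2.
exists (\sum_i \sum_k \sum_l X i k l *: u i k l) => j.
rewrite raddf_sum (bigD1 j) //= [X in _ + X]big1 ?addr0 => [|i ij]; last first.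
  apply/matrixP => k' l'; rewrite raddf_sum summxE mxE big1 // => k _.
  rewrite raddf_sum summxE big1 // => l _; rewrite /= linearZ /= mxE uE.
  case: eqP => [e|]; last by rewrite mulr0.
  by case/eqP: ij; apply: shape_at_inj; rewrite -(shape_pnth k) -e shape_pnth.
apply/matrixP => k' l'; rewrite raddf_sum summxE (bigD1 k') //= [X in _ + X]big1 ?addr0.
  rewrite raddf_sum summxE (bigD1 l') //= [X in _ + X]big1 ?addr0.
    by rewrite linearZ /= mxE uE !eqxx mulr1.
  by move=> l ll; rewrite linearZ /= mxE uE !(inj_eq (@pnth_inj _)) [l' == l]eq_sym (negbTE ll) andbF mulr0.
move=> k kk; rewrite raddf_sum summxE big1 // => l _.
by rewrite /= linearZ /= mxE uE !(inj_eq (@pnth_inj _)) [k' == k]eq_sym (negbTE kk) mulr0.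
Qed.

End Blocks.

Lemma cell_indep (c : ypath * ypath -> K) :
  \sum_(t <- cells) c t *: cell_elt t = 0 -> {in cells, forall t, c t = 0}.
Proof.
have [f fE] := representations; move=> H; apply: (f_inj_cells fE) => i.
by rewrite H raddf0.
Qed.

Lemma cell_elt_neq0 t : t \in cells -> cell_elt t != 0.
Proof.
move=> tT; apply/eqP => t0.
have := @cell_indep (fun t' => (t' == t)%:R) _ t tT; rewrite eqxx => H.
suff /H/eqP : \sum_(t' <- cells) (t' == t)%:R *: cell_elt t' = 0 by rewrite oner_eq0.
rewrite (bigD1_seq t) ?uniq_cells //= t0 scaler0 add0r big1 // => t' /negbTE ->.
by rewrite scale0r.
Qed.

Lemma cell_elt_prop t t' c : t \in cells -> t' \in cells ->
  cell_elt t = c *: cell_elt t' -> t = t' /\ c = 1.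
Proof.
move=> tT t'T e; have H := @cell_indep (fun s => (s == t)%:R - c * (s == t')%:R).
have single s : s \in cells -> \sum_(t0 <- cells) (t0 == s)%:R *: cell_elt t0 = cell_elt s.
  move=> sT; rewrite (bigD1_seq s) ?uniq_cells //= eqxx scale1r big1 ?addr0 // => t0 /negbTE ->.
  by rewrite scale0r.
have {}H : {in cells, forall s, (s == t)%:R - c * (s == t')%:R = 0}.
  apply: H; under eq_bigr do rewrite scalerBl -scalerA; rewrite sumrB single //.
  by rewrite -scaler_sumr single // e subrr.
have := H t tT; rewrite eqxx; case: (eqVneq t t') => [tt'|_].
  by rewrite mulr1 => /eqP; rewrite subr_eq0 => /eqP <-.
by rewrite mulr0 subr0 => /eqP; rewrite oner_eq0.
Qed.

End OkadaAlgebra.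

(** * Diagrams and the cellular basis *)

Section DiagramBasis.
Variables (K : fieldType) (x y : nat -> K) (n : nat) (O : algType K).
Variable E : 'I_n.-1 -> O.
Hypothesis presO : is_okada_algebra x y E.
Hypothesis x_neq0 : forall i, x i != 0.
Hypothesis y_neq0 : forall i, y i != 0.
Hypothesis gram_invertible : forall w, exists h : ypath -> ypath -> K,
  {in pw (true :: w) &, forall a b,
     \sum_(c <- pw (true :: w)) h a c * gram x y w c b = (a == b)%:R}.
Variable rw : okada n -> seq 'I_n.-1.
Hypothesis rwP : forall d, reduced_word d (rw d).
Variable B : okada n -> O.
Hypothesis BE : forall d, B d = word_elt E (rw d).
Variable lam : okada n -> okada n -> K.
Hypothesis lamE : forall d1 d2, B d1 * B d2 = lam d1 d2 *: B (okada_comp d1 d2).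

Local Notation wact := (wact x y).
Local Notation cells := (cells n).
Local Notation letters_lt := (letters_lt n).
Local Notation cell_elt := (cell_elt E).
Local Notation idd := (id_diag n).
Local Notation word d := (map val (rw d)).

Definition dword s := foldr (@dact n) (Some idd) s.

Lemma dact_val (i : 'I_n.-1) (d : okada n) : dact (val i) (Some d) = Some (gact i d).
Proof. by rewrite /dact valK. Qed.

Lemma dword_val (w : seq 'I_n.-1) : dword (map val w) = Some (diag_of_word w).
Proof.
rewrite /diag_of_word; elim: w => [|i w IH]; first by rewrite big_nil.
by rewrite big_cons comp_gen /dword /= -/(dword _) IH dact_val.
Qed.

Lemma letters_val s : letters_lt s -> exists w : seq 'I_n.-1, map val w = s.
Proof.
elim: s => [|j s IH] /=; first by exists [::].
case/andP=> jn /IH[w <-]; have h : (j < n.-1)%N by lia.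
by exists (Ordinal h :: w).
Qed.

Lemma gact_idd i : gact i idd = gen_diag i.
Proof.
have mE v : mate idd v = vopp v by rewrite /mate ffunE.
have lE v : lab idd v = vabs v :> nat.
  by rewrite /lab ffunE inordK // ltnS; have /andP[] := vabs_bound v.
apply: okada_ext => v; rewrite ?mate_gact ?lab_gact ?mate_gen ?lab_gen.
  rewrite /gmate !mE; case: v => j /=; rewrite ?(inj_eq inl_inj) ?(inj_eq inr_inj) //.
rewrite /glab !mE !lE /gen_lab; case: v => j /=.
  rewrite !(inj_eq inl_inj); case: (eqVneq j (gen_lo i)) => [->|jl] /=.
    by case: eqP => //; lia.
  case: (eqVneq j (gen_hi i)) => [->|jh] /=; first by rewrite eqxx.
  case: eqP => // e; case/eqP: jh; apply: val_inj => /=; lia.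
rewrite !(inj_eq inr_inj); case: (eqVneq j (gen_lo i)) => [->|jl] /=.
  by case: eqP => //; lia.
case: (eqVneq j (gen_hi i)) => [->|jh] /=; first by rewrite eqxx; lia.
case: eqP => // e; case/eqP: jh; apply: val_inj => /=; lia.
Qed.

Lemma rw_idd : rw idd = [::].
Proof.
have [_ /(_ [::])] := rwP idd; rewrite /diag_of_word big_nil => /(_ erefl).
by rewrite leqn0 => /nilP.
Qed.

Lemma B_idd : B idd = 1.
Proof. by rewrite BE rw_idd /word_elt big_nil. Qed.

Lemma rw_gen i : rw (gen_diag i) = [:: i].
Proof.
have diag1 (j : 'I_n.-1) : @diag_of_word n [:: j] = @gen_diag n j.
  by rewrite /diag_of_word big_cons big_nil comp_gen gact_idd.
have [] := rwP (gen_diag i); case: (rw _) => [|j [|k s]] wE /(_ [:: i] (diag1 i)) //= _.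
  move: wE; rewrite /diag_of_word big_nil => /(congr1 (fun d => mate d (lo i))).
  by rewrite mate_gen /mate ffunE /= eqxx.
move: wE; rewrite diag1 => /(congr1 (fun d => mate d (lo i))).
rewrite !mate_gen /= eqxx; case: eqP => [e _|_].
  by congr [:: _]; apply: val_inj; have := congr1 val e.
case: eqP => // e [] e'; have /= := congr1 val e; lia.
Qed.

Lemma B_gen i : B (gen_diag i) = E i.
Proof. by rewrite BE rw_gen /word_elt big_seq1. Qed.

Lemma B_word_value d : B d = word_value E (word d).
Proof. by rewrite BE word_elt_word_value. Qed.

(** The pair t is tied to d in the algebra and in the monoid. Independence of the C(p, q) makes t a
    function of d, and the last clause makes d a function of t. *)
Definition encodes d t := [/\ t \in cells, B d = cell_elt t & dword (cword2 t) = Some d].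

Lemma encodes_ex d : exists t, encodes d t.
Proof.
have [rwd rw_min] := rwP d.
(* A straightening with a scalar other than 1 would produce a shorter word. *)
have [c [t [tT st bE]]] := word_value_span presO (word_value_letters (rw d)).
have dE : dword (cword2 t) = Some d.
  by rewrite -rwd -dword_val; apply/esym/(dact_sound _ st).
exists t; split=> //; case: t tT st bE dE => p q tT st bE dE.
have [w wE] := letters_val (letters_cword tT).
have : diag_of_word w = d by move: dE; rewrite /cword2 /= -wE dword_val => -[].
move/rw_min => le; have [le' /(_ _) c1] := wred_size st.
rewrite B_word_value bE c1 ?scale1r //; apply/eqP; rewrite eqn_leq le' /= size_map.
by rewrite /cword2 /= -wE size_map.
Qed.

Lemma encodes_fun d t t' : encodes d t -> encodes d t' -> t = t'.
Proof.
move=> [tT bt _] [tT' bt' _].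
have e : cell_elt t = 1 *: cell_elt t' by rewrite scale1r -bt bt'.
by have [] := cell_elt_prop presO gram_invertible tT tT' e.
Qed.

Lemma encodes_inj d d' t : encodes d t -> encodes d' t -> d = d'.
Proof. by move=> [_ _ e] [_ _]; rewrite e => -[]. Qed.

(** Proportionality suffices, because [B d] is itself some C(p, q). The products in [lamE] can thus
    be followed without tracking their scalars. *)
Lemma encodes_scal d t c : t \in cells -> cell_elt t = c *: B d -> encodes d t.
Proof.
move=> tT; have [t' kt'] := encodes_ex d; have [tT' -> _] := kt' => e.
by have [-> _] := cell_elt_prop presO gram_invertible tT tT' e.
Qed.

Lemma dword_cons s j d : letters_lt (j :: s) -> dword (j :: s) = Some d ->
  exists (i : 'I_n.-1) d', [/\ val i = j, dword s = Some d' & d = gact i d'].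
Proof.
case/andP=> jn _; have h : (j < n.-1)%N by lia.
rewrite /dword /= -/(dword s) {1}/dact insubT /=; case: (dword s) => //= d' [<-].
by exists (Ordinal h), d'; split=> //; congr gact; apply: val_inj.
Qed.

Lemma word_value_scal s d : letters_lt s -> dword s = Some d -> exists c, word_value E s = c *: B d.
Proof.
elim: s d => [|j s IH] d hs.
  by case=> <-; exists 1; rewrite word_value_nil scale1r B_idd.
case/(dword_cons hs) => i [d' [iE dE ->]]; case/andP: hs => _ /IH/(_ dE)[c sE].
exists (c * lam (gen_diag i) d'); rewrite word_value_cons -iE letter_elt_val sE -B_gen.
by rewrite -scalerAr lamE scalerA comp_gen.
Qed.

Lemma word_value_rev_scal s d : letters_lt s -> dword s = Some d ->
  exists c, word_value E (rev s) = c *: B (mirror d).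
Proof.
elim: s d => [|j s IH] d hs.
  case=> <-; exists 1; have -> : mirror idd = idd.
    apply: okada_ext => v; first by rewrite mate_mirror /mate !ffunE !voppK.
    by rewrite lab_mirror /lab !ffunE vabs_opp.
  by rewrite word_value_nil scale1r B_idd.
case/(dword_cons hs) => i [d' [iE dE ->]]; case/andP: hs => _ /IH/(_ dE)[c sE].
exists (c * lam (mirror d') (gen_diag i)).
rewrite rev_cons -cats1 word_value_cat sE word_value_cons word_value_nil mulr1 -iE letter_elt_val -B_gen.
by rewrite -scalerAl lamE scalerA -mirror_comp_gen comp_gen.
Qed.

Lemma dword_cell t : t \in cells -> exists d, dword (cword2 t) = Some d.
Proof.
case: t => p q /letters_cword/letters_val[w wE].
by exists (diag_of_word w); rewrite /cword2 /= -wE dword_val.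
Qed.

Lemma encodes_surj t : t \in cells -> exists d, encodes d t.
Proof.
move=> tT; have [d dE] := dword_cell tT; exists d.
have [|c cE] := word_value_scal _ dE; first by case: t tT {dE} => p q /letters_cword.
exact: encodes_scal tT cE.
Qed.

Lemma swap_cells p q : (p, q) \in cells -> (q, p) \in cells.
Proof.
rewrite !mem_cells => /and4P[-> /eqP rp /eqP sq ->]; rewrite sq eqxx /=.
by rewrite (prank_shape sq) rp eqxx.
Qed.

Lemma word_value_rev_cell p q : (p, q) \in cells ->
  word_value E (rev (cword p q)) = cell_elt (q, p).
Proof.
rewrite mem_cells => /and4P[vp _ /eqP sq vq]; have [rel _ _] := presO.
by rewrite (word_value_sound rel (cword_rev x y vp vq sq)) scale1r.
Qed.

Lemma encodes_mirror d p q : encodes d (p, q) -> encodes (mirror d) (q, p).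
Proof.
move=> [tT _ dE]; have [c cE] := word_value_rev_scal (letters_cword tT) dE.
apply: (encodes_scal (c := c)); first exact: swap_cells.
by rewrite -word_value_rev_cell.
Qed.

(** The product of [B d1] and [B d2] is evaluated by [lamE] and by straightening. Both results are
    multiples of one nonzero C(p', q'), so [lam d1 d2] is the scalar of the derivation, which is
    nonzero since the parameters are. *)
Lemma encodes_comp d1 d2 p q : encodes d2 (p, q) -> exists p' q',
  [/\ encodes (okada_comp d1 d2) (p', q'), lam d1 d2 != 0 &
    [/\ q' = q, yshape p' = yshape p &
        wact (yshape p) (word d1) p = Some (lam d1 d2, p')] \/
    wact (yshape p) (word d1) p = None /\ slt (yshape p') (yshape p)].
Proof.
move=> [tT bE _]; have := tT; rewrite mem_cells => /and4P[vp /eqP rp /eqP sq vq].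
have [c [p' [q' [[st sq' vp' vq' rp'] h]]]] :=
  @cell_stepsP K x y n (word d1) p q rp sq vp vq (word_value_letters (rw d1)).
have tT' : (p', q') \in cells by rewrite mem_cells vp' vq' rp' rp sq' !eqxx.
have [rel _ _] := presO.
have cE : lam d1 d2 *: B (okada_comp d1 d2) = c *: cell_elt (p', q').
  by rewrite -lamE bE B_word_value -word_value_cat (word_value_sound rel st).
have c0 := wred_neq0 x_neq0 y_neq0 st.
have k' : encodes (okada_comp d1 d2) (p', q').
  apply: (encodes_scal (c := c^-1 * lam d1 d2)) => //.
  by rewrite -scalerA cE scalerA mulVf // scale1r.
have lc : lam d1 d2 = c.
  have [_ b' _] := k'; move/eqP: cE; rewrite b' -subr_eq0 -scalerBl scaler_eq0.
  rewrite (negbTE (cell_elt_neq0 presO gram_invertible tT')) orbF subr_eq0.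
  by move/eqP.
by exists p', q'; rewrite lc.
Qed.

(** Reversing the words of d1 and d2 evaluates, up to scalars, to the mirror images. Reversing their
    straightening then shows that both sides are encoded by the same pair. *)
Lemma mirror_comp (d1 d2 : okada n) :
  mirror (okada_comp d1 d2) = okada_comp (mirror d2) (mirror d1).
Proof.
have [[p2 q2] k2] := encodes_ex d2; have [p0 [q0 [_ l0 _]]] := encodes_comp d1 k2.
have [rw1 _] := rwP d1; have [rw2 _] := rwP d2.
have w1 : dword (word d1) = Some d1 by rewrite dword_val rw1.
have w2 : dword (word d2) = Some d2 by rewrite dword_val rw2.
have [c1 e1] := word_value_rev_scal (word_value_letters (rw d1)) w1.
have [c2 e2] := word_value_rev_scal (word_value_letters (rw d2)) w2.
have hs : letters_lt (word d1 ++ word d2).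
  by rewrite /letters_lt all_cat; apply/andP; split; apply: word_value_letters.
have [c [[p q] [tT st tE]]] := word_value_span presO hs.
have c0 := wred_neq0 x_neq0 y_neq0 st.
have k : encodes (okada_comp d1 d2) (p, q).
  apply: (encodes_scal (c := c^-1 * lam d1 d2)) => //.
  by rewrite -scalerA -lamE !B_word_value -word_value_cat tE scalerA mulVf // scale1r.
have mk := encodes_mirror k; have [rel _ _] := presO.
have mE : c2 *: B (mirror d2) * (c1 *: B (mirror d1)) = c *: cell_elt (q, p).
  by rewrite -e1 -e2 -word_value_cat -rev_cat (word_value_sound rel (wred_rev st)) word_value_rev_cell.
apply: (encodes_inj mk); apply: (encodes_scal (c := c^-1 * (c2 * c1 * lam (mirror d2) (mirror d1)))).
  exact: swap_cells.
rewrite -!scalerA -lamE -[LHS]scale1r -(mulVf c0) -scalerA -mE; congr (_ *: _).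
by rewrite -scalerAl -scalerAr.
Qed.

Lemma comp_mirror (d1 d2 : okada n) : okada_comp d1 (mirror d2) =
  mirror (okada_comp d2 (mirror d1)).
Proof. by rewrite mirror_comp mirrorK. Qed.

(** Right multiplication by the mirror of d is left multiplication by d seen in the mirror. As t has
    both indices equal to p, d meets the same p twice, and the two indices move in the same way
    unless the shape drops. *)
Lemma encodes_conj (d t : okada n) p : encodes t (p, p) -> exists q1 q2,
  encodes (okada_comp (okada_comp d t) (mirror d)) (q1, q2) /\
  ([/\ q1 = q2, yshape q2 = yshape p & wact (yshape p) (word d) p = Some (lam d t, q2)] \/
   wact (yshape p) (word d) p = None /\ slt (yshape q1) (yshape p)).
Proof.
move=> kt; have [p1 [p2 [k1 _ h1]]] := encodes_comp d kt.
have [p3 [p4 [k3 _ h3]]] := encodes_comp d (encodes_mirror k1).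
exists p4, p3; rewrite comp_mirror; split; first exact: encodes_mirror.
have [tT3 _ _] := k3; have [tT1 _ _] := k1.
have s43 : yshape p4 = yshape p3 by move: tT3; rewrite mem_cells => /and4P[_ _ /eqP].
have s21 : yshape p2 = yshape p1 by move: tT1; rewrite mem_cells => /and4P[_ _ /eqP].
case: h1 => [[e2 s1 w1]|[w1 lt1]].
  left; rewrite e2 in h3; case: h3 => [[-> s3]|[]]; last by rewrite w1.
  by rewrite w1 => -[_ <-]; rewrite s1.
right; split=> //; rewrite s43; case: h3 => [[_ -> _]|[_ lt3]]; first by rewrite s21.
by apply: slt_trans lt3 _; rewrite s21.
Qed.

Lemma dact_weight s d d' : foldr (@dact n) (Some d) s = Some d' ->
  (total_weight d' <= total_weight d)%N /\
  (total_weight d' = total_weight d -> PLab d' = PLab d).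
Proof.
elim: s d' => [|j s IH] d' /=; first by case=> ->.
case E1: (foldr _ _ _) => [e|]; last by rewrite /dact; case: insub.
have [h1 h2] := IH _ E1; rewrite /dact; case: insub => //= i [<-].
have h3 := total_weight_gact i e; split; first exact: leq_trans h3 h1.
move=> h4; have h5 : total_weight e = total_weight d.
  by apply/eqP; rewrite eqn_leq h1 -h4 h3.
by rewrite PLab_gact ?h2 // h4 h5.
Qed.

(** The matrix unit from p to p' is a combination of words, so p' occurs in the image of p under one
    of them; the action is monomial, hence that word sends p to a multiple of p'. *)
Lemma path_reach p p' : pvalid p -> pvalid p' -> yshape p' = yshape p -> prank p = n ->
  exists s c, letters_lt s /\ wact (yshape p) s p = Some (c, p').
Proof.
move=> vp vp' sp rp; have rp' : prank p' = n by rewrite (prank_shape sp).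
have [a [ha aE]] := word_span_units gram_invertible vp' vp sp rp'.
have := aE p vp rp p'; rewrite !eqxx mulr1 /comb_coef.
have [/hasP[[c s] csa]|/hasPn h] :=
    boolP (has (fun cs => tcoef (wact (yshape p) cs.2 p) p' != 0) a); last first.
  rewrite big1_seq => [/esym/eqP|cs /andP[_ /h]]; first by rewrite oner_eq0.
  by rewrite negbK => /eqP ->; rewrite mulr0.
move=> /= h _; exists s; move: h; case: (wact _ s p) => [[c' p1]|] /=; last by rewrite eqxx.
case: (eqVneq p1 p') => [->|_]; last by rewrite eqxx.
by move=> _; exists c'; split=> //; apply: (allP ha (c, s)).
Qed.

(** A word that takes p to p' turns the diagram d into d' letter by letter, and no letter increases
    the weight. The roles of d and d' can be exchanged, which forces equality. *)
Lemma weight_le d d' p p' q : encodes d (p, q) -> encodes d' (p', q) -> yshape p' = yshape p ->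
  (total_weight d' <= total_weight d)%N /\
  (total_weight d' = total_weight d -> PLab d' = PLab d).
Proof.
move=> [tT _ dE] [tT' _ dE'] sp.
have := tT; rewrite mem_cells => /and4P[vp /eqP rp /eqP sq vq].
have := tT'; rewrite mem_cells => /and4P[vp' _ _ _].
have [s [c [hs sE]]] := path_reach vp vp' sp rp.
have [c' [p1 [q1 [[st _ _ _ _] h]]]] := @cell_stepsP K x y n s p q rp sq vp vq hs.
apply: (@dact_weight s); rewrite -dE' -dE /dword -foldr_cat (dact_sound _ st).
case: h => [[-> _]|[]]; last by rewrite sE.
by rewrite sE => -[_ ->].
Qed.

Lemma PLab_same_left d d' p p' q : encodes d (p, q) -> encodes d' (p', q) ->
  yshape p' = yshape p -> PLab d' = PLab d.
Proof.
move=> k k' sp; have [h1 h2] := weight_le k k' sp.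
have [h3 _] := weight_le k' k (esym sp).
by apply: h2; apply/eqP; rewrite eqn_leq h1 h3.
Qed.

(** Within one shape, the left path is replaced first, and then the right one through the mirror
    image, which preserves PLab. For distinct shapes, the comparison is made on the diagrams of
    [rep_path]. *)
Lemma PLab_shape d d' p q p' q' : encodes d (p, q) -> encodes d' (p', q') ->
  (PLab d == PLab d') = (yshape p == yshape p').
Proof.
have same e e' a b a' b' : encodes e (a, b) -> encodes e' (a', b') -> yshape a = yshape a' ->
    PLab e = PLab e'.
  move=> k k' saa'; have [tT _ _] := k; have [tT' _ _] := k'.
  have := tT; rewrite mem_cells => /and4P[va /eqP ra /eqP sb vb].
  have := tT'; rewrite mem_cells => /and4P[va' /eqP ra' /eqP sb' vb'].
  have [e1 k1] : exists e1, encodes e1 (a', b).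
    by apply: encodes_surj; rewrite mem_cells va' ra' sb saa' vb !eqxx.
  rewrite -(PLab_same_left k k1) // -(PLab_mirror e1) -(PLab_mirror e').
  by apply: (PLab_same_left (encodes_mirror k') (encodes_mirror k1)); rewrite sb sb'.
move=> k k'; apply/eqP/eqP => [PE|]; last exact: (same _ _ _ _ _ _ k k').
have [tT _ _] := k; have [tT' _ _] := k'.
have := tT; rewrite mem_cells => /and4P[_ /eqP rp _ _].
have := tT'; rewrite mem_cells => /and4P[_ /eqP rp' _ _].
have rep w : srank w = n -> exists d0, encodes d0 (rep_path w, rep_path w).
  by move=> wn; apply: encodes_surj; rewrite mem_cells rep_path_valid /prank rep_path_shape wn !eqxx.
have [d0 k0] := rep _ rp; have [d1 k1] := rep _ rp'.
have [_ _ e0] := k0; have [_ _ e1] := k1.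
apply: (PLab_rep rp rp' e0 e1).
rewrite -(same _ _ _ _ _ _ k k0) ?rep_path_shape // PE.
by apply: (same _ _ _ _ _ _ k' k1); rewrite rep_path_shape.
Qed.

Lemma sym_path (t : sym_okada n) : exists p, encodes (val t) (p, p).
Proof.
have [[p q] k] := encodes_ex (val t); exists p.
have := encodes_mirror k; rewrite -(eqP (valP t)) => k'.
by have [e _] := encodes_fun k k'; rewrite {2}e.
Qed.

Lemma sym_of_path p : p \in paths n -> exists t : sym_okada n, encodes (val t) (p, p).
Proof.
rewrite mem_paths => /andP[vp rp].
have [|d k] := @encodes_surj (p, p); first by rewrite mem_cells vp rp eqxx.
have dS : d == mirror d by apply/eqP/(encodes_inj k)/encodes_mirror.
by exists (exist _ d dS).
Qed.

(** The test on PLab holds precisely when the shape has not dropped, that is, when d does not kill p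
    in V_w; otherwise both sides vanish. *)
Lemma sym_act_coordinate d (t t' : sym_okada n) p p' :
  encodes (val t) (p, p) -> encodes (val t') (p', p') ->
  sym_act lam d t t' = tcoef (wact (yshape p) (word d) p) p'.
Proof.
move=> k k'; have [q1 [q2 [ku h]]] := encodes_conj d k.
rewrite /sym_act (PLab_shape ku k); case: h => [[e s w]|[w lt]].
  rewrite e s eqxx w /= /sym_vec !ffunE.
  have -> : (val t' == okada_comp (okada_comp d (val t)) (mirror d)) = (q2 == p').
    apply/eqP/eqP => [tu|qp].
      by rewrite -tu e in ku; have [] := encodes_fun ku k'.
    by rewrite e qp in ku; apply: encodes_inj k' ku.
  by case: eqP => _; rewrite /GRing.scale /= ?mulr1 ?mulr0.
by rewrite w; case: eqP => [e|_]; [rewrite e slt_irr in lt | rewrite ffunE].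
Qed.

End DiagramBasis.

(** * Identification of the action on symmetric diagrams *)

Lemma linear_eq_span (K : fieldType) (U V : lmodType K) (g h : U -> V)
    (I : eqType) (s : seq I) (F : I -> U) (c : I -> K) :
  linear g -> linear h -> {in s, forall i, g (F i) = h (F i)} ->
  g (\sum_(i <- s) c i *: F i) = h (\sum_(i <- s) c i *: F i).
Proof.
move=> g_lin h_lin gh.
pose gM := GRing.isLinear.Build _ _ _ _ g g_lin; pose gL : {linear U -> V} := HB.pack g gM.
pose hM := GRing.isLinear.Build _ _ _ _ h h_lin; pose hL : {linear U -> V} := HB.pack h hM.
rewrite -[g _]/(gL _) -[h _]/(hL _) !raddf_sum !big_seq; apply: eq_bigr => i si.
have gZ : gL (c i *: F i) = c i *: gL (F i) := linearZ_LR gL _ _.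
have hZ : hL (c i *: F i) = c i *: hL (F i) := linearZ_LR hL _ _.
by apply: etrans gZ (etrans _ (esym hZ)); congr (_ *: _); apply: gh.
Qed.

Lemma pnth_tag_inj n (s s' : {i : 'I_(size (shapes n)) & 'I_((dw (shape_at i)).+1)}) :
  pnth (tagged s) = pnth (tagged s') -> s = s'.
Proof.
case: s s' => i k [j l] /= e.
have ij : i = j by apply: shape_at_inj; rewrite -(shape_pnth k) e shape_pnth.
by subst j; rewrite (pnth_inj e).
Qed.

Theorem theorem4p2
    (K0 K : fieldType) (iota : {rmorphism K0 -> K}) (x y : nat -> K)
    (charK0 : [pchar K0] =i pred0)
    (genericK : is_rational_function_field iota x y)
    (n : nat) (n_ge1 : (1 <= n)%N)
    (O : algType K) (E : 'I_n.-1 -> O) (presO : is_okada_algebra x y E)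
    (* a word of minimal length for each diagram, and the elements E_d *)
    (rw : okada n -> seq 'I_n.-1) (rwP : forall d, reduced_word d (rw d))
    (B : okada n -> O) (BE : forall d, B d = word_elt E (rw d))
    (lam : okada n -> okada n -> K)
    (lamE : forall d1 d2, B d1 * B d2 = lam d1 d2 *: B (okada_comp d1 d2)) :
  exists act : O -> sym_space K n -> sym_space K n,
    [/\ extends_sym_act B lam act,
        forall act', extends_sym_act B lam act' ->
          forall a m, act' a m = act a m
      & exists modP : module_axioms act, gelfand_model (module_of modP : lmodType O)].
Proof.
have x0 := generic_x_neq0 genericK; have y0 := generic_y_neq0 genericK.
have gI := gram_inv genericK.
have [f fE] := representations presO.
have fS := f_surj gI fE; have fI := f_inj presO gI fE.
pose idx := {i : 'I_(size (shapes n)) & 'I_((dw (shape_at i)).+1)}.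
pose on_diag (t : sym_okada n) (s : idx) :=
  encodes E B (val t) (pnth (tagged s), pnth (tagged s)).
have [z zP] : exists z : sym_okada n -> idx, forall t, on_diag t (z t).
  apply: fin_all_exists => t; have [p k] := sym_path presO gI rwP BE lamE t.
  have [tT _ _] := k; have [i [k1 [_ [e _]]]] := block_coordinates tT.
  by exists (existT _ i k1 : idx); rewrite /on_diag /= e.
have [t_of tP] : exists t_of : idx -> sym_okada n, forall s, on_diag (t_of s) s.
  apply: (@fin_all_exists idx (fun _ => sym_okada n) (fun s t => on_diag t s)) => s.
  apply: (sym_of_path presO gI rwP BE lamE).
  by rewrite mem_paths valid_pnth /prank shape_pnth srank_shape_at eqxx.
have zK : cancel z t_of by move=> t; apply/val_inj/(encodes_inj (tP (z t)) (zP t)).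
have t_ofK : cancel t_of z.
  move=> s; apply: pnth_tag_inj.
  by case: (encodes_fun presO gI (zP (t_of s)) (tP s)).
have on_basis d t : block_act f z t_of (B d) (sym_vec K (val t)) = sym_act lam d t.
  apply/ffunP => t'; rewrite ffunE mxE.
  rewrite (sym_act_coordinate presO x0 y0 gI rwP BE lamE d (zP t) (zP t')).
  set p := pnth (tagged (z t)); set p' := pnth _.
  (* The matrix product in the block of t' only sees the column of p. If p has another shape, this
     sum is empty and the coordinate in V_w is zero as well. *)
  transitivity (\sum_(q <- pw (shape_at (tag (z t')))) (q == p)%:R *
     tcoef (wact x y (shape_at (tag (z t'))) (map val (rw d)) q) p').
    rewrite sum_pw; apply: eq_bigr => k _; rewrite !mxE ffunE mulrC.
    rewrite (B_word_value BE) fE ?mxE; last exact: word_value_letters.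
    congr ((nat_of_bool _)%:R * _); apply/eqP/eqP => [/val_inj e|e].
      by rewrite /p -e t_ofK.
    apply: (congr1 val); apply: etrans (zK t); congr (t_of _).
    exact: (@pnth_tag_inj n (existT _ (tag (z t')) k) (z t) e).
  rewrite sum_delta ?uniq_pw // mem_pw valid_pnth andbT shape_pnth.
  case: eqP => [->|ne] //; apply/esym; rewrite -(shape_pnth (tagged (z t))).
  apply: tcoef_wact_shape; first exact: valid_pnth.
    by rewrite /prank shape_pnth srank_shape_at; apply: word_value_letters.
  by rewrite !shape_pnth; apply/eqP => e; apply: ne.
exists (block_act f z t_of); split.
- split=> [a|m|d t]; last exact: on_basis.
    exact: block_act_linearr.
  exact: block_act_linearl.
- move=> act' [lin_r lin_l on_basis'] a m.
  have mE : m = \sum_(t : sym_okada n) (m t : K) *: sym_vec K (val t).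
    apply/ffunP => t; rewrite sum_ffunE (bigD1 t) //= big1 ?addr0.
      by rewrite !ffunE eqxx /GRing.scale /= mulr1.
    move=> t' t't; rewrite !ffunE (inj_eq val_inj) eq_sym (negbTE t't).
    by rewrite /GRing.scale /= mulr0.
  have [c ->] := cell_span presO a.
  apply: (@linear_eq_span K O (sym_space K n) (act'^~ m) ((block_act f z t_of)^~ m)) => [||t tT].
    exact: lin_l.
    exact: block_act_linearl.
  (* Every C(p, q) is some [B d], so the [B d] span O and the values on basis vectors determine the
     bilinear map. *)
  have [d [_ dE _]] := encodes_surj presO gI rwP BE lamE tT; rewrite -dE {}mE.
  apply: (@linear_eq_span K (sym_space K n) (sym_space K n) (act' (B d)) (block_act f z t_of (B d))) => [||u _].
    exact: lin_r.
    exact: block_act_linearr.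
  by rewrite on_basis' on_basis.
exists (block_act_axioms f zK t_ofK).
exact (block_act_gelfand fS fI zK t_ofK).
Qed.
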